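(* Let $0<2\beta<\alpha$. There is a constant $C$, independent of $f$ and $g$, such that: if $f\in\Lambda^\alpha_{\mathcal{L}}$, then $\mathcal{L}^\beta f\in\Lambda^{\alpha-2\beta}_{\mathcal{L}}$ and $\|\mathcal{L}^\beta f\|_{\Lambda^{\alpha-2\beta}_{\mathcal{L}}}\le C\|f\|_{\Lambda^\alpha_{\mathcal{L}}}$; respectively, if $g\in\Lambda^\alpha_{\mathcal{H}}$, then $\mathcal{H}^\beta g\in\Lambda^{\alpha-2\beta}_{\mathcal{H}}$ and $\|\mathcal{H}^\beta g\|_{\Lambda^{\alpha-2\beta}_{\mathcal{H}}}\le C\|g\|_{\Lambda^\alpha_{\mathcal{H}}}$.
   Context: Fix $n\ge1$. Let $\mathcal{H}=-\Delta_x+|x|^2$ on $\mathbb{R}^n$ and $\mathcal{L}=\partial_t-\Delta_x+|x|^2$ on $\mathbb{R}^{n+1}\ni(t,x)$. Functions are identified when equal almost everywhere. For $y>0$, $f\in L^\infty(\mathbb{R}^{n+1})$, $g\in L^\infty(\mathbb{R}^n)$, the Poisson semigroups $\mathcal{P}_y=e^{-y\sqrt{\mathcal{L}}}$ and $P_y=e^{-y\sqrt{\mathcal{H}}}$ are $$\mathcal{P}_yf(t,x)=\frac{y}{2\sqrt\pi}\int_0^\infty\int_{\mathbb{R}^n}e^{-\frac{y^2}{4\tau}}\,\frac{e^{-\frac{|x-z|^2}{4}\coth\tau}\,e^{-\frac{|x+z|^2}{4}\tanh\tau}}{(2\pi\sinh2\tau)^{n/2}}\,f(t-\tau,z)\,dz\,\frac{d\tau}{\tau^{3/2}},$$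 and $P_yg(x)$ is given by the same formula with $f(t-\tau,z)$ replaced by $g(z)$. For $\alpha>0$, with $k=[\alpha]+1$ ($[\cdot]$ the integer part), $\Lambda^\alpha_{\mathcal{L}}$ is the set of $f\in L^\infty(\mathbb{R}^{n+1})$ for which there is $C_k$ with $\|\partial_y^k\mathcal{P}_yf\|_{L^\infty(\mathbb{R}^{n+1})}\le C_ky^{-k+\alpha}$ for all $y>0$; its norm is $\|f\|_\infty+C$ with $C$ the infimum of such $C_k$. The space $\Lambda^\alpha_{\mathcal{H}}$ and its norm are defined identically for $g\in L^\infty(\mathbb{R}^n)$ with $P_y$ in place of $\mathcal{P}_y$ and $L^\infty(\mathbb{R}^n)$ in place of $L^\infty(\mathbb{R}^{n+1})$. For $\beta>0$ put $c_{2\beta}=\int_0^\infty(e^{-\tau}-1)^{[2\beta]+1}\frac{d\tau}{\tau^{1+2\beta}}$ and $$\mathcal{L}^\beta f=\frac1{c_{2\beta}}\int_0^\infty(\mathcal{P}_\tau-I)^{[2\beta]+1}f\,\frac{d\tau}{\tau^{1+2\beta}},\qquad \mathcal{H}^\beta g=\frac1{c_{2\beta}}\int_0^\infty(P_\tau-I)^{[2\beta]+1}g\,\frac{d\tau}{\tau^{1+2\beta}},$$ the integrals being taken pointwise. *)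

(* Defs.v *)
From HB Require Import structures.
From mathcomp Require Import all_boot all_order all_algebra.
From mathcomp Require Import all_classical all_reals all_analysis.

Set Implicit Arguments.
Unset Strict Implicit.
Unset Printing Implicit Defensive.
Import Order.TTheory GRing.Theory Num.Theory.
Import numFieldNormedType.Exports.
Local Open Scope classical_set_scope.
Local Open Scope ring_scope.

Notation Rn R n := (n.-tuple (measurableTypeR R)).

Section lebesgue_step.
Context {R : realType} (n : nat).
Variable mu : {sigma_finite_measure set (Rn R n) -> \bar R}.

Definition Rn_cons (p : measurableTypeR R * Rn R n) : Rn R n.+1 :=
  [tuple of p.1 :: p.2].

Lemma measurable_Rn_cons : measurable_fun setT Rn_cons.
Proof. exact: measurable_cons. Qed.

Definition lebesgue_step : set (Rn R n.+1) -> \bar R :=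
  pushforward (lebesgue_measure \x mu)%E Rn_cons.

HB.instance Definition _ := Measure.copy lebesgue_step
  (measure_function_pushforward__canonical__measure_function_Measure
     (lebesgue_measure \x mu)%E measurable_Rn_cons).

Lemma lebesgue_step_sigma_finite : sigma_finite setT lebesgue_step.
Proof.
have /sigma_finiteP[F [TF ndF Ffin]] := sigma_finiteT (@lebesgue_measure R).
have /sigma_finiteP[G [TG ndG Gfin]] := sigma_finiteT mu.
pose g (x : Rn R n.+1) : measurableTypeR R * Rn R n :=
  (thead x, [tuple of behead x]).
have mg : measurable_fun setT g.
  by apply/measurable_fun_pair => /=; [exact: measurable_tnth|exact: measurable_behead].
exists (fun i => g @^-1` (F i `*` G i)).
  apply/esym; rewrite -subTset => x _.
  have [i _ Fi] : (\bigcup_i F i) (g x).1 by rewrite -TF.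
  have [j _ Gj] : (\bigcup_j G j) (g x).2 by rewrite -TG.
  exists (maxn i j) => //; split => /=.
  - by apply: (subsetPset _ _ (ndF _ _ (leq_maxl i j))).
  - by apply: (subsetPset _ _ (ndG _ _ (leq_maxr i j))).
move=> i; have [mF muF] := Ffin i; have [mG muG] := Gfin i; split.
  by rewrite -[X in measurable X]setTI; apply: mg => //; exact: measurableX.
have -> : lebesgue_step (g @^-1` (F i `*` G i)) =
    (lebesgue_measure \x mu)%E (F i `*` G i).
  rewrite /lebesgue_step /pushforward -comp_preimage.
  suff -> : g \o Rn_cons = id by [].
  apply/funext => -[a b]; rewrite /g /Rn_cons /= theadE; congr (_, _).
  by apply: eq_from_tnth => k; rewrite !(tnth_nth a).
by rewrite product_measure1E// lte_mul_pinfty// ge0_fin_numE.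
Qed.

HB.instance Definition _ := Measure_isSigmaFinite.Build _ _ _ lebesgue_step
  lebesgue_step_sigma_finite.

End lebesgue_step.

(* Lebesgue measure on R^n: the n-fold product of lebesgue_measure, R^(n+1)
   being identified with R * R^n. *)
Fixpoint lebesgue_Rn (R : realType) (n : nat) :
    {sigma_finite_measure set (Rn R n) -> \bar R} :=
  match n with
  | 0 => \d_ ([tuple] : Rn R 0)
  | m.+1 => lebesgue_step (lebesgue_Rn R m)
  end.

Lemma lebesgue_Rn_box (R : realType) (n : nat)
    (A : 'I_n -> set (measurableTypeR R)) :
  (forall i, measurable (A i)) ->
  lebesgue_Rn R n [set x | forall i, A i (tnth x i)] =
  (\prod_(i < n) lebesgue_measure (A i))%E.
Proof.
elim: n A => [|n IHn] A mA.
  by rewrite big_ord0 /= diracE mem_set// => -[].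
rewrite big_ord_recl -IHn//= /lebesgue_step /pushforward -product_measure1E//.
- congr (_ _); apply/seteqP; split => -[a b] /=.
  + move=> H; split => [|i] /=; first by have := H ord0; rewrite tnth0.
    by have := H (lift ord0 i); rewrite tnthS.
  + move=> [/= Aa Ab] i; case: (unliftP ord0 i) => [j ->|->]; last by rewrite tnth0.
    by rewrite tnthS; exact: Ab.
- rewrite (_ : [set x | _] =
      \bigcap_(i in setT) ((fun x : Rn R n => tnth x i) @^-1` A (lift ord0 i))).
    apply: fin_bigcap_measurable => // i _.
    by rewrite -[X in measurable X]setTI; exact: measurable_tnth.
  by apply/seteqP; split => x H i; [move=> _; exact: (H i)|exact: (H i I)].
Qed.

Section hyperbolic.
Context {R : realType}.
Implicit Type s : R.

Definition sinh s : R := (expR s - expR (- s)) / 2.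
Definition cosh s : R := (expR s + expR (- s)) / 2.
Definition tanh s : R := sinh s / cosh s.
Definition coth s : R := cosh s / sinh s.

End hyperbolic.

Section poisson_semigroups.
Context {R : realType} (n : nat).

(* The measurable space underlying R^(n+1), with points (t, x). *)
Definition spacetime : measurableType _ := (measurableTypeR R * Rn R n)%type.

Definition lebesgue_spacetime : {measure set spacetime -> \bar R} :=
  (lebesgue_measure \x lebesgue_Rn R n)%E.

Definition mehler_kernel (tau : R) (x z : Rn R n) : R :=
  expR (- ((\sum_(i < n) (tnth x i - tnth z i) ^+ 2) / 4) * coth tau) *
  expR (- ((\sum_(i < n) (tnth x i + tnth z i) ^+ 2) / 4) * tanh tau) /
  (2 * pi * sinh (2 * tau)) `^ (n%:R / 2).

Definition poissonL (y : R) (f : spacetime -> R) (p : spacetime) : R :=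
  y / (2 * Num.sqrt pi) *
  \int[lebesgue_measure]_(tau in `]0, +oo[)
    ((\int[lebesgue_Rn R n]_z
       (expR (- (y ^+ 2 / (4 * tau))) * mehler_kernel tau p.2 z *
        f ((p.1 : R) - tau, z))) / tau `^ (3 / 2)).

Definition poissonH (y : R) (g : Rn R n -> R) (x : Rn R n) : R :=
  y / (2 * Num.sqrt pi) *
  \int[lebesgue_measure]_(tau in `]0, +oo[)
    ((\int[lebesgue_Rn R n]_z
       (expR (- (y ^+ 2 / (4 * tau))) * mehler_kernel tau x z * g z)) /
     tau `^ (3 / 2)).

End poisson_semigroups.

Arguments spacetime : clear implicits.
Arguments lebesgue_spacetime : clear implicits.

(* L^oo classes are represented by Borel functions: every class contains one,
   and membership in Lip and Lip_norm depend only on the class.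
   mu and P stand for Lebesgue measure and the Poisson semigroup, either on
   R^(n+1) (poissonL) or on R^n (poissonH). *)
Section adapted_lipschitz.
Context d (T : measurableType d) {R : realType}.
Variables (mu : {measure set T -> \bar R}) (P : R -> (T -> R) -> T -> R).
Implicit Types (alpha beta : R) (f : T -> R).

Definition lip_order alpha : nat := (Num.truncn alpha).+1.

(* For f in L^oo and P one of the two semigroups, s |-> P s f p is smooth on
   s > 0 at every p, so derive1n is a genuine derivative here. *)
Definition lip_const alpha f : set R :=
  [set C | forall y : R, 0 < y ->
    (Lnorm mu +oo (fun p => (derive1n (lip_order alpha) (fun s => P s f p) y)%:E) <=
     (C * y `^ (- (lip_order alpha)%:R + alpha))%:E)%E].

Definition Lip alpha : set (T -> R) :=
  [set f | f \in Lfun mu +oo%E /\ lip_const alpha f !=set0].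

Definition Lip_norm alpha f : R :=
  fine (Lnorm mu +oo%E (EFin \o f)) + inf (lip_const alpha f).

Definition frac_order beta : nat := (Num.truncn (2 * beta)).+1.

Definition frac_const beta : R :=
  \int[lebesgue_measure]_(tau in `]0, +oo[)
    ((expR (- tau) - 1) ^+ frac_order beta / tau `^ (1 + 2 * beta)).

Definition frac_integrand beta f (p : T) (tau : R) : R :=
  iter (frac_order beta) (fun h q => P tau h q - h q) f p /
  tau `^ (1 + 2 * beta).

Definition frac_power beta f (p : T) : R :=
  (frac_const beta)^-1 *
  \int[lebesgue_measure]_(tau in `]0, +oo[) frac_integrand beta f p tau.

(* Rintegral is total, hence an explicit convergence condition. It can only
   hold almost everywhere: the integral diverges where the chosen
   representative f differs from the limit of P tau f as tau tends to 0. *)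
Definition frac_power_defined beta f : Prop :=
  \forall p \ae mu, lebesgue_measure.-integrable `]0, +oo[
    (EFin \o frac_integrand beta f p).

End adapted_lipschitz.

(* Main.v *)
Require Import Defs.
From HB Require Import structures.
From mathcomp Require Import all_boot all_order all_algebra.
From mathcomp Require Import all_classical all_reals all_analysis.
From mathcomp Require Import ring lra.
From mathcomp Require Import measurable_realfun ess_sup_inf.

(** A function g on R^n may be read as the function g \o snd on space-time,
    independent of time. The Poisson semigroup, the essential norm, the
    spaces Lip and the fractional powers all commute with this reading, so
    the statement for the Hermite operator is the statement for the
    parabolic operator on functions independent of time, with the same
    constant. Only the parabolic case needs work. Below, al and be stand for
    alpha and beta.

    The argument there sees the semigroup P only through a few properties,
    collected in smoothing_semigroup: it is a linear contraction of bounded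
    Borel functions with P_s P_t = P_(s+t), its first derivative in y is at
    most K M / y on functions bounded by M, it commutes with integrals, and
    a bounded function killed by every P_s vanishes almost everywhere. Write
    D_j for the j-th derivative in y of P_y f. The semigroup law gives that
    D_(j+1) at y is D_1 at y/2 applied to D_j at y/2, so a bound A y^(al-k)
    on D_k passes to all higher orders (semigroup_deriv_up). Integrating
    from infinity, where D_j vanishes, brings the bound down to any order m
    with an exponent ga <= al, 0 < ga < m (deriv_interpolate). With m = 1
    this makes P_y f converge uniformly as y tends to 0, and the limit F is
    equal to f almost everywhere by injectivity (boundary_value). From then
    on F replaces f, and every estimate holds at every point.

    Let m = [2 be] + 1. The iterate (P_tau - I)^m F is the m-th difference
    with step tau of the orbit y |-> P_y F, taken at y = 0. It is O(tau^ga)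
    for some ga with 2 be < ga < m, and O(1) for large tau, so the defining
    integral converges and is bounded (frac_int_bounded). Let l = [al - 2
    be] + 1. The l-th derivative of P_y applied to that integral is the
    integral of the m-th differences of D_l at y (deriv_frac_int). The
    derivative of order m + l decays like y^(-e) with e = m + l - al. For
    tau <= y the difference is at most tau^m y^(-e). For tau > y part of the
    decay is traded against the step, giving tau^(m-e') y^(e'-e) with m - 2
    be < e' < m. Both parts integrate against tau^(-1-2 be) to a multiple of
    y^(al - 2 be - l) (frac_int_deriv_le).

    It remains to see that the Poisson semigroup is of this kind. It is the
    integral operator whose kernel is the one-sided stable density of index
    1/2 in the elapsed time, times the Mehler kernel. Both factors satisfy a
    Chapman-Kolmogorov identity: for the Mehler kernel it is a Gaussian
    integral (mehler1_semigroup), for the stable density an explicit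
    antiderivative (levy_convolution). The total masses are at most 1, and
    the derivative in y is bounded by the kernel at a smaller y
    (levy_deriv_le). Injectivity follows because the kernel concentrates at
    its pole as y tends to 0 (spacetime_kernel_concentrate), which forces a
    function killed by the semigroup to have integral 0 over each bounded
    open box (kernel_approx_identity). *)

Set Implicit Arguments.
Unset Strict Implicit.
Unset Printing Implicit Defensive.
Import Order.TTheory GRing.Theory Num.Theory.
Import numFieldNormedType.Exports.
Local Open Scope classical_set_scope.
Local Open Scope ring_scope.

(** * Increments and iterated differences *)

Section calculus.
Context {R : realType}.
Implicit Types (f g F G : R -> R) (a b x y s tau : R).

(** The mean value theorem for G + F and for G - F, whose derivatives are
    nonnegative. It stands in for integrating the bound on the derivative,
    which may blow up at the end points, where only continuity is asked. *)
Lemma le_norm_increment F G dF dG a b : a < b ->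
  {within `[a, b], continuous F} -> {within `[a, b], continuous G} ->
  (forall x, a < x < b -> is_derive x 1 F (dF x)) ->
  (forall x, a < x < b -> is_derive x 1 G (dG x)) ->
  (forall x, a < x < b -> `|dF x| <= dG x) ->
  `|F b - F a| <= G b - G a.
Proof.
move=> ab cF cG hF hG h.
(* e is 1 or -1, which treats the two sides of the absolute value at once. *)
have ge0 (e : R) : `|e| = 1 -> 0 <= (G b - G a) + e * (F b - F a).
  move=> e1.
  have [||c cab] := @MVT R (fun x => G x + e * F x)
    (fun x => dG x + e * dF x) a b ab.
  - move=> x; rewrite in_itv/= => xab.
    have := hF _ xab; have := hG _ xab => ? ?.
    by apply: is_deriveD; rewrite -[_ * _]/(e *: _); apply: is_deriveZ.
  - move=> x; apply: cvgD; first exact: cG.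
    by apply: cvgM; [exact: cvg_cst|exact: cF].
  rewrite (_ : G b + e * F b - (G a + e * F a) =
    (G b - G a) + e * (F b - F a)); last by ring.
  move=> ->; apply: mulr_ge0; last by rewrite subr_ge0 ltW.
  move: cab; rewrite in_itv/= => /h dcc.
  have : - (e * dF c) <= `|dF c| by rewrite (le_trans (ler_norm _))// normrN normrM e1 mul1r.
  by move: dcc; lra.
have := ge0 1 (normr1 _); have := ge0 (-1) (normrN1 _).
by rewrite ler_norml => *; apply/andP; split; lra.
Qed.

Lemma is_derive_powR a x : 0 < x ->
  is_derive x 1 (fun y => y `^ a) (a * x `^ (a - 1)).
Proof.
move=> x0; have xin : x \in `]0, +oo[ by rewrite in_itv/= x0.
apply: DeriveDef; first exact: derivable_powR.
by rewrite -derive1E powR_derive1.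
Qed.

Lemma continuous_powR a x : 0 < x -> {for x, continuous (fun y => y `^ a)}.
Proof.
move=> x0; apply: differentiable_continuous; apply/derivable1_diffP.
by have := is_derive_powR a x0 => -[].
Qed.

Lemma le_powRN a x y : 0 < x -> x <= y -> 0 <= a -> y `^ (- a) <= x `^ (- a).
Proof.
move=> x0 xy a0; have y0 := lt_le_trans x0 xy.
rewrite !powRN lef_pV2 ?posrE ?powR_gt0//.
by apply: ge0_ler_powR => //; rewrite nnegrE ltW.
Qed.

Lemma derivable_pos_within_continuous f a b : 0 < a ->
  (forall x, 0 < x -> derivable f x 1) -> {within `[a, b], continuous f}.
Proof.
move=> a0 df; apply: derivable_within_continuous => x; rewrite in_itv/= => /andP[ax _].
by apply: df; exact: lt_le_trans ax.
Qed.

Lemma is_derive_shiftl f (d y x : R) :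
  is_derive (y + x) 1 f d -> is_derive x 1 (fun s => f (y + s)) d.
Proof.
move=> hd.
have hs : is_derive x 1 (fun s : R => y + s) 1.
  by rewrite -[X in is_derive _ _ _ X]add0r; apply: is_deriveD.
have := @is_derive1_comp _ f (fun s => y + s) x _ _ hd hs.
by rewrite mulr1.
Qed.

(** The singularity s^(-th) of the bound is integrable at the left end point
    because th < 1; its primitive s^(1-th) is the comparison function. *)
Lemma increment_powR f df (y tau K th : R) : 0 < tau -> 0 <= K -> th < 1 -> 0 < y ->
  (forall x, 0 < x -> is_derive x 1 f (df x)) ->
  (forall s, 0 < s <= tau -> `|df (y + s)| <= K * s `^ (- th)) ->
  `|f (y + tau) - f y| <= K / (1 - th) * tau `^ (1 - th).
Proof.
move=> tau0 K0 th1 y0 hf hdf.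
have d0 : 0 < 1 - th by rewrite subr_gt0.
pose G s := K / (1 - th) * s `^ (1 - th).
have -> : K / (1 - th) * tau `^ (1 - th) = G tau - G 0.
  by rewrite /G powR0 ?gt_eqF// mulr0 subr0.
rewrite -[in f y](addr0 y).
apply: (@le_norm_increment (fun s => f (y + s)) G (fun s => df (y + s))
   (fun s => K * s `^ (- th)) 0 tau) => //.
- apply: derivable_within_continuous => x; rewrite in_itv/= => /andP[x0 _].
  by have /is_derive_shiftl[] := hf (y + x) (ltr_wpDr x0 y0).
- apply/continuous_within_itvP => //; split.
  + move=> x; rewrite in_itv/= => /andP[x0 _].
    by apply: cvgM; [exact: cvg_cst|exact: continuous_powR].
  + rewrite /G powR0 ?gt_eqF// mulr0 -[X in _ --> X](mulr0 (K / (1 - th))).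
    by apply: cvgM; [exact: cvg_cst|exact: powR_cvg0].
  + apply: cvgM; [exact: cvg_cst|apply: cvg_at_left_filter].
    exact: continuous_powR.
- by move=> x /andP[x0 xt]; apply: is_derive_shiftl; apply: hf; exact: addr_gt0.
- move=> x /andP[x0 _].
  have -> : K * x `^ (- th) = (K / (1 - th)) *: ((1 - th) * x `^ (1 - th - 1)).
    rewrite /GRing.scale/= mulrA divfK ?gt_eqF//.
    by congr (_ * _ `^ _); ring.
  by apply: is_deriveZ; apply: is_derive_powR.
- by move=> x /andP[x0 xt]; apply: hdf; rewrite x0 ltW.
Qed.

(** The bound on the derivative is integrable up to infinity, so the increment
    is controlled by y alone, however large z is. *)
Lemma increment_powR_pinfty f df (y z K c : R) : 0 < y < z -> 0 <= K -> 0 < c ->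
  (forall x, 0 < x -> is_derive x 1 f (df x)) ->
  (forall s, y < s -> `|df s| <= K * s `^ (- c - 1)) ->
  `|f z - f y| <= K / c * y `^ (- c).
Proof.
move=> /andP[y0 yz] K0 c0 hf hdf.
pose G s := - (K / c) * s `^ (- c).
apply: (@le_trans _ _ (G z - G y)); last first.
  rewrite /G mulNr mulNr opprK gerDr oppr_le0 mulr_ge0 ?powR_ge0//.
  by rewrite divr_ge0// ltW.
have dG x : 0 < x -> is_derive x 1 G (K * x `^ (- c - 1)).
  move=> x0; have -> : K * x `^ (- c - 1) = - (K / c) *: (- c * x `^ (- c - 1)).
    by rewrite /GRing.scale/= mulrA mulrNN divfK ?gt_eqF.
  by apply: is_deriveZ; apply: is_derive_powR.
have cf : {within `[y, z], continuous f}.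
  by apply: (@derivable_pos_within_continuous f y z y0) => x /hf[].
have cG : {within `[y, z], continuous G}.
  by apply: (@derivable_pos_within_continuous G y z y0) => x /dG[].
apply: (le_norm_increment yz cf cG (dF := df) (dG := fun s => K * s `^ (- c - 1))).
- by move=> x /andP[yx _]; apply: hf; exact: lt_trans yx.
- by move=> x /andP[yx _]; apply: dG; exact: lt_trans yx.
- by move=> x /andP[yx _]; exact: hdf.
Qed.

Definition fdiff (m : nat) tau g := iter m (fun h y => h (y + tau) - h y) g.

Lemma fdiffS m tau g y :
  fdiff m.+1 tau g y = fdiff m tau g (y + tau) - fdiff m tau g y.
Proof. by []. Qed.

Lemma fdiff_le m tau g y K : 0 <= tau -> (forall z, y <= z -> `|g z| <= K) ->
  `|fdiff m tau g y| <= 2 ^+ m * K.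
Proof.
move=> tau0; elim: m y => [|m IH] y hg; first by rewrite expr0 mul1r hg.
rewrite fdiffS (le_trans (ler_normB _ _))// exprS -mulrA mulr_natl mulr2n.
apply: lerD; apply: IH => // z yz; apply: hg => //.
by rewrite (le_trans _ yz)// lerDl.
Qed.

Definition smooth_pos f := forall j x, 0 < x -> derivable (derive1n j f) x 1.

Lemma smooth_pos_is_derive f j x : smooth_pos f -> 0 < x ->
  is_derive x 1 (derive1n j f) (derive1n j.+1 f x).
Proof.
by move=> sf x0; rewrite derive1nS derive1E; apply/derivableP; exact: sf.
Qed.

Lemma is_derive_fdiff f m l tau x : smooth_pos f -> 0 <= tau -> 0 < x ->
  is_derive x 1 (fdiff m tau (derive1n l f)) (fdiff m tau (derive1n l.+1 f) x).
Proof.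
move=> sf tau0; elim: m x => [|m IH] x x0; first exact: smooth_pos_is_derive.
rewrite fdiffS; apply: is_deriveB; last exact: IH.
under eq_fun do rewrite addrC.
by apply: is_derive_shiftl; rewrite addrC; apply: IH; exact: ltr_wpDr.
Qed.

(** Each of the m differences integrates one derivative over an interval of
    length tau. Giving every one of them the same share th = e/m < 1 of the
    exponent e keeps all these integrals convergent at the base point, so the
    bound does not depend on y0 and survives y0 -> 0. *)
Lemma fdiff_powR_le f m l (tau y0 y K e : R) : smooth_pos f -> (0 < m)%N ->
  0 <= e < m%:R -> 0 < tau -> 0 < y0 -> y0 <= y -> 0 <= K ->
  (forall z, y0 <= z -> `|derive1n (m + l) f z| <= K * z `^ (- e)) ->
  `|fdiff m tau (derive1n l f) y| <=
    (1 - e / m%:R)^-1 ^+ m * K * tau `^ (m%:R - e).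
Proof.
move=> sf m0 /andP[e0 em] tau0 y00 y0y K0 hK.
have mR : 0 < m%:R :> R by rewrite ltr0n.
set th := e / m%:R; have th1 : th < 1 by rewrite ltr_pdivrMr// mul1r.
have th0 : 0 <= th by rewrite divr_ge0// ltW.
have d0 : 0 < 1 - th by rewrite subr_gt0.
set C := (1 - th)^-1; have C0 : 0 < C by rewrite invr_gt0.
(* After j differences, j shares of the exponent have been turned into powers
   of tau, and m - j of them still act on the base point. *)
have main j z : (j <= m)%N -> y0 <= z ->
    `|fdiff j tau (derive1n (m + l - j) f) z| <=
    C ^+ j * K * tau `^ (j%:R * (1 - th)) * z `^ (- (th * (m%:R - j%:R))).
  elim: j z => [|j IH] z jm y0z.
    rewrite subn0 expr0 mul1r mul0r powRr0 mulr1 subr0 divfK ?gt_eqF//.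
    exact: hK.
  have z0 := lt_le_trans y00 y0z.
  have -> : (m + l - j.+1)%N = (m + l - j).-1 by rewrite subnS.
  have hj : (m + l - j).-1.+1 = (m + l - j)%N.
    by rewrite prednK// subn_gt0 (leq_trans jm)// leq_addr.
  rewrite fdiffS.
  pose K' := C ^+ j * K * tau `^ (j%:R * (1 - th)) * z `^ (- (th * (m%:R - j.+1%:R))).
  have K'0 : 0 <= K' by rewrite !mulr_ge0// ?powR_ge0// exprn_ge0// ltW.
  apply: le_trans (@increment_powR _ _ z tau K' th tau0 K'0 th1 z0
      (fun x => @is_derive_fdiff f j _ tau x sf (ltW tau0)) _) _.
    move=> s /andP[s0 st]; rewrite hj.
    have zs : y0 <= z + s by rewrite (le_trans y0z)// lerDl ltW.
    apply: (le_trans (IH _ (ltnW jm) zs)).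
    rewrite /K' -[leRHS]mulrA; apply: ler_wpM2l.
      by rewrite !mulr_ge0// ?powR_ge0// exprn_ge0// ltW.
    have -> : - (th * (m%:R - j%:R)) = - (th * (m%:R - j.+1%:R)) + - th.
      by rewrite -addn1 natrD; ring.
    have zs0 : 0 < z + s by exact: lt_le_trans zs.
    rewrite powRD; last by rewrite (gt_eqF zs0) implybT.
    apply: ler_pM; rewrite ?powR_ge0//.
      by apply: le_powRN; rewrite ?lerDl ?(ltW s0)// mulr_ge0// subr_ge0 ler_nat.
    by apply: le_powRN => //; rewrite lerDr ltW.
  rewrite le_eqVlt; apply/orP; left; apply/eqP; rewrite /K' exprS -/C.
  have -> : tau `^ (j.+1%:R * (1 - th)) = tau `^ (j%:R * (1 - th)) * tau `^ (1 - th).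
    rewrite -powRD; last by rewrite (gt_eqF tau0) implybT.
    by congr (_ `^ _); rewrite -addn1 natrD; ring.
  by ring.
have := main m y (leqnn m) y0y.
rewrite subrr mulr0 oppr0 powRr0 mulr1.
have -> : (m + l - m)%N = l by rewrite addnC addnK.
have -> : m%:R * (1 - th) = m%:R - e.
  by rewrite mulrBr mulr1 /th mulrCA divff ?mulr1// gt_eqF.
by [].
Qed.

(** The derivative of order l is the integral from y to infinity of the one of
    order l + 1. The second bound only serves to know that it vanishes at
    infinity, which is why K' is absent from the conclusion. *)
Lemma derive1n_down f (l : nat) (K K' g : R) : smooth_pos f -> 0 <= K -> 0 < g < l%:R ->
  (forall y, 0 < y -> `|derive1n l.+1 f y| <= K * y `^ (- l.+1%:R + g)) ->
  (forall y, 0 < y -> `|derive1n l f y| <= K' * y `^ (- l%:R)) ->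
  forall y, 0 < y -> `|derive1n l f y| <= K / (l%:R - g) * y `^ (- l%:R + g).
Proof.
move=> sf K0 /andP[g0 gl] hS hl y y0.
have c0 : 0 < l%:R - g by rewrite subr_gt0.
have l0 : 0 < l%:R :> R by exact: lt_trans gl.
set B := K / _ * _.
have bd z : y < z -> `|derive1n l f y| <= B + K' * z `^ (- l%:R).
  move=> yz; have z0 := lt_trans y0 yz.
  have := @increment_powR_pinfty (derive1n l f) (derive1n l.+1 f) y z K (l%:R - g).
  rewrite y0 yz => /(_ isT K0 c0 (fun x => @smooth_pos_is_derive f l x sf)).
  have h s : y < s -> `|derive1n l.+1 f s| <= K * s `^ (- (l%:R - g) - 1).
    move=> ys; rewrite (_ : - (l%:R - g) - 1 = - l.+1%:R + g).
      by apply: hS; exact: lt_trans ys.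
    by rewrite -natr1; ring.
  move=> /(_ h); rewrite opprB (addrC g) -/B => h1.
    have := hl z z0; have := ler_normB (derive1n l f z) (derive1n l f z - derive1n l f y).
    rewrite opprB addrCA subrr addr0; move: h1; lra.
apply/ler_addgt0Pl => eps eps0.
(* z is so large that the remainder K' z^(-l) is below eps: it exceeds both 1
   and |K'| / eps. *)
pose z := y + 1 + `|K'| / eps.
have Ke : 0 <= `|K'| / eps by rewrite divr_ge0// ltW.
have yz : y < z by rewrite /z; move: Ke; lra.
have z1 : 1 <= z by rewrite /z; move: Ke; lra.
have z0 : 0 < z by exact: lt_le_trans z1.
rewrite addrC (le_trans (bd _ yz))// lerD2l (le_trans (ler_norm _))// normrM.
rewrite (ger0_norm (powR_ge0 _ _)) powRN.
have l1 : 1 <= l%:R :> R by rewrite ler1n -(ltr0n R).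
have zl : z <= z `^ l%:R by exact: le1r_powR.
rewrite ler_pdivrMr ?powR_gt0// (@le_trans _ _ (eps * z))//; last first.
  by rewrite ler_wpM2l// ltW.
by rewrite mulrC -ler_pdivrMr// /z; move: Ke; lra.
Qed.

Lemma derive1n_eq_pos f g : (forall y, 0 < y -> f y = g y) ->
  forall j y, 0 < y -> derive1n j f y = derive1n j g y.
Proof.
move=> fg; elim => [|j IH] y y0; first exact: fg.
rewrite !derive1nS !derive1E; apply: near_eq_derive.
by near=> z; apply: IH; near: z; exact: lt_nbhsr.
Unshelve. all: by end_near. Qed.

End calculus.

(** * Improper integrals of positive functions *)

Section improper_integrals.
Context {R : realType}.
Implicit Types (f F : R -> R) (D : set R).
Notation mu := (@lebesgue_measure R).
Local Notation Rpos := (`]0%R, +oo[%classic : set R).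

Lemma cvg_inv_addn k : (n + k).+1%:R^-1 @[n --> \oo] --> (0 : R).
Proof.
have := @cvg_harmonic R; rewrite -(cvg_shiftn k); exact: cvg_trans.
Qed.

Lemma cvg_natn_addn k : (n + k)%:R @[n --> \oo] --> (+oo : set_system R).
Proof. by have := @cvgr_idn R; rewrite -(cvg_shiftn k); exact: cvg_trans. Qed.

Lemma cvg_difference_quotient (phi : R -> R) (y : R) : derivable phi y 1 ->
  n.+1%:R * (phi (y + n.+1%:R^-1) - phi y) @[n --> \oo] --> derive1 phi y.
Proof.
move=> df; rewrite derive1E.
have := df; rewrite /derivable => /cvg_ex[l hl].
have := cvg_lim _ hl; rewrite -/(derive _ _ _) => -> //.
have inv0 : n.+1%:R^-1 @[n --> \oo] --> (0 : R).
  exact: cvg_harmonic.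
move/cvgr_dnbhsP : hl => /(_ (fun n => n.+1%:R^-1)) h.
have {h} := h (conj (fun n => invr_neq0 (lt0r_neq0 (ltr0Sn R n))) inv0).
apply: cvg_trans; apply: near_eq_cvg; apply: nearW => n /=.
by rewrite invrK /GRing.scale/= mulr1 (addrC y).
Qed.

Lemma powR_cvgy0 (q : R) : 0 < q -> x `^ (- q) @[x --> +oo] --> (0 : R).
Proof.
move=> q0; apply/cvgrPdist_le => e e0; near=> x.
rewrite sub0r normrN ger0_norm ?powR_ge0//.
have xe : e `^ (- q^-1) <= x by near: x; exact: nbhs_pinfty_ge.
rewrite (le_trans (le_powRN _ xe (ltW q0))) ?powR_gt0//.
by rewrite -powRrM mulrNN mulVf ?gt_eqF// powRr1// ltW.
Unshelve. all: by end_near. Qed.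

(** The fundamental theorem of calculus on an increasing sequence of compact
    intervals, passed to the limit by monotone convergence: this is where the
    function has to be nonnegative. *)
Lemma ge0_FTC_exhaust D (a_ b_ : R^nat) f F (l : R) :
  (forall i, a_ i < b_ i) -> D = \bigcup_i `[a_ i, b_ i]%classic ->
  nondecreasing_seq (fun i => `[a_ i, b_ i]%classic : set R) ->
  (forall x, D x -> 0 <= f x) -> (forall x, D x -> {for x, continuous f}) ->
  (forall x, D x -> is_derive x 1 F (f x)) ->
  F (b_ n) - F (a_ n) @[n --> \oo] --> l ->
  (\int[mu]_(x in D) (f x)%:E = l%:E)%E.
Proof.
move=> ab DE nd f0 cf dF cvF.
have abD i x : `[a_ i, b_ i]%classic x -> D x by move=> h; rewrite DE; exists i.
have cfi i : {within `[a_ i, b_ i], continuous f}.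
  apply: continuous_in_subspaceT => x; rewrite inE => /abD; exact: cf.
have mf i : measurable_fun `[a_ i, b_ i] (EFin \o f).
  apply/measurable_EFinP; apply: subspace_continuous_measurable_fun => //.
have FTC i : (\int[mu]_(x in `[a_ i, b_ i]) (f x)%:E = (F (b_ i) - F (a_ i))%:E)%E.
  rewrite EFinB; apply: continuous_FTC2 => //.
    have dFi x : x \in `[a_ i, b_ i] -> derivable F x 1.
      by move=> xi; have [] := dF x (abD i x xi).
    have := derivable_within_continuous dFi.
    move=> /(continuous_within_itvP _ (ab i))[h1 h2 h3]; split => // x xi.
    by apply: dFi; exact: subset_itv_oo_cc xi.
  move=> x xi; rewrite derive1E; have [] // := dF x (abD i x _).
  exact: subset_itv_oo_cc xi.
have cvI : (\int[mu]_(x in `[a_ i, b_ i]) (f x)%:E @[i --> \oo] -->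
    \int[mu]_(x in \bigcup_i `[a_ i, b_ i]%classic) (f x)%:E)%E.
  apply: ge0_nondecreasing_set_cvg_integral => //.
  by move=> i x /abD/f0; rewrite lee_fin.
rewrite DE -(cvg_lim _ cvI)//.
under eq_fun do rewrite FTC.
by apply/cvg_lim => //; apply: cvg_EFin; [exact: nearW|exact: cvF].
Qed.

Lemma ge0_FTC_0y f F (A B : R) :
  (forall x : R, 0 < x -> 0 <= f x) -> (forall x : R, 0 < x -> {for x, continuous f}) ->
  (forall x : R, 0 < x -> is_derive x 1 F (f x)) ->
  F x @[x --> 0^'+] --> A -> F x @[x --> +oo] --> B ->
  (\int[mu]_(x in Rpos) (f x)%:E = (B - A)%:E)%E.
Proof.
move=> f0 cf dF FA FB.
pose a_ i : R := i.+2%:R^-1; pose b_ i : R := i.+2%:R.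
have pos x : Rpos x -> 0 < x by rewrite /= in_itv/= andbT.
apply: (@ge0_FTC_exhaust _ a_ b_ f F) => [i||i j ij|x /pos|x /pos|x /pos|].
- by rewrite /a_ /b_ (@lt_trans _ _ 1)// ?invf_lt1// ltr1n.
- apply/seteqP; split=> x.
    move=> /pos x0; have [n _ xn] := near_infty_natSinv_lt (PosNum x0).
    have [m _ xm] := nbhs_infty_ger x.
    exists (maxn n m) => //=; rewrite in_itv/=; apply/andP; split.
      rewrite /a_ (@le_trans _ _ (n.+1%:R^-1))//; last exact/ltW/(xn n)/leqnn.
      rewrite lef_pV2 ?posrE ?ltr0n// ler_nat ltnS (leq_trans (leq_maxl n m))//.
    rewrite /b_ (@le_trans _ _ m%:R)//; first exact/(xm m)/leqnn.
    by rewrite ler_nat (leq_trans (leq_maxr n m))// (leq_trans (leqnSn _)).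
  move=> [i _]; rewrite /= !in_itv/= => /andP[ax _]; rewrite andbT.
  by rewrite (lt_le_trans _ ax)// /a_ invr_gt0.
- rewrite subsetEset => x /=; rewrite !in_itv/= => /andP[h1 h2]; apply/andP; split.
    by rewrite (le_trans _ h1)// /a_ lef_pV2 ?posrE// ler_nat.
  by rewrite (le_trans h2)// /b_ ler_nat.
- exact: f0.
- exact: cf.
- exact: dF.
- apply: cvgB.
    move/cvg_pinftyP : FB; apply.
    by rewrite /b_; under eq_fun do rewrite -addn2; exact: cvg_natn_addn.
  move/cvg_at_rightP : FA; apply; split=> [n|]; first by rewrite /a_ invr_gt0.
  by rewrite /a_; under eq_fun do rewrite -addn1; exact: cvg_inv_addn.
Qed.

Lemma ge0_FTC_0b f F (b A B : R) : 0 < b ->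
  (forall x : R, 0 < x < b -> 0 <= f x) -> (forall x : R, 0 < x < b -> {for x, continuous f}) ->
  (forall x : R, 0 < x < b -> is_derive x 1 F (f x)) ->
  F x @[x --> 0^'+] --> A -> F x @[x --> b^'-] --> B ->
  (\int[mu]_(x in `]0%R, b[) (f x)%:E = (B - A)%:E)%E.
Proof.
move=> b0 f0 cf dF FA FB.
(* Starting with the third of the interval keeps a_ i < b_ i for every i. *)
pose a_ i : R := b / i.+3%:R; pose b_ i : R := b - b / i.+3%:R.
have pos x : (`]0, b[%classic : set R) x -> 0 < x < b by rewrite /= in_itv/=.
have a0 i : 0 < a_ i by rewrite /a_ divr_gt0.
have ab3 i : a_ i <= b / 3.
  by rewrite /a_ ler_pM2l// lef_pV2 ?posrE// ler_nat.
have b3 : b / 3 < b - b / 3 by rewrite -subr_gt0; lra.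
have ab i : a_ i < b_ i by have := ab3 i; rewrite /b_ -/(a_ i); move: b3; lra.
have DE : `]0, b[%classic = \bigcup_i `[a_ i, b_ i]%classic :> set R.
  apply/seteqP; split=> x.
    move=> /pos/andP[x0 xb].
    have m0 : 0 < Num.min x (b - x) / b.
      by rewrite divr_gt0// lt_min x0 subr_gt0.
    have [n _ xn] := near_infty_natSinv_lt (PosNum m0).
    have : n.+3%:R^-1 < Num.min x (b - x) / b.
      have /= h := xn n (leqnn n); apply: le_lt_trans h.
      by rewrite lef_pV2 ?posrE// ler_nat ltnS leqW.
    rewrite ltr_pdivlMr// lt_min mulrC -/(a_ n) => /andP[h1 h2].
    by exists n => //=; rewrite in_itv/= (ltW h1)/= /b_ -/(a_ n); move: h2; lra.
  move=> [i _]; rewrite /= !in_itv/= => /andP[h1 h2]; apply/andP; split.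
    exact: lt_le_trans h1.
  by rewrite (le_lt_trans h2)// /b_ ltrBlDr ltrDl; exact: a0.
have nd : nondecreasing_seq (fun i => `[a_ i, b_ i]%classic : set R).
  move=> i j ij; have aij : a_ j <= a_ i.
    by rewrite /a_ ler_pM2l// lef_pV2 ?posrE// ler_nat !ltnS.
  rewrite subsetEset => x /=; rewrite !in_itv/= => /andP[h1 h2].
  rewrite (le_trans aij h1)/= (le_trans h2)// /b_ lerD2l lerN2.
  exact: aij.
apply: (ge0_FTC_exhaust ab DE nd (fun x xD => f0 x (pos x xD))
  (fun x xD => cf x (pos x xD)) (fun x xD => dF x (pos x xD))).
have a_0 : a_ n @[n --> \oo] --> 0.
  rewrite -[X in _ --> X](mulr0 b); apply: cvgM; first exact: cvg_cst.
  by under eq_fun do rewrite -addn2; exact: cvg_inv_addn.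
apply: cvgB.
  move/cvg_at_leftP : FB; apply; split=> [n|].
    by rewrite /b_ ltrBlDr ltrDl; exact: a0.
  by rewrite -[X in _ --> X](subr0 b); apply: cvgB => //; exact: cvg_cst.
by move/cvg_at_rightP : FA; apply; split.
Qed.

Lemma integral_powR_0b (p b : R) : 0 < p -> 0 < b ->
  (\int[mu]_(x in `]0%R, b]) (x `^ (p - 1))%:E = (b `^ p / p)%:E)%E.
Proof.
move=> p0 b0.
have cpow (x : R) : 0 < x -> {for x, continuous (fun x => x `^ (p - 1))}.
  exact: continuous_powR.
rewrite -integral_itv_bndo_bndc; last first.
  apply/measurable_EFinP; exact: measurable_funTS.
rewrite mulrC -[X in X%:E]subr0.
apply: (@ge0_FTC_0b _ (fun x => p^-1 * x `^ p)) => //.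
- by move=> x /andP[x0 _]; exact: powR_ge0.
- by move=> x /andP[x0 _]; exact: cpow.
- move=> x /andP[x0 _].
  have -> : x `^ (p - 1) = p^-1 *: (p * x `^ (p - 1)).
    by rewrite /GRing.scale/= mulrA mulVf ?gt_eqF// mul1r.
  by apply: is_deriveZ; exact: is_derive_powR.
- rewrite -[X in _ --> X](mulr0 p^-1); apply: cvgM; first exact: cvg_cst.
  exact: powR_cvg0.
- apply: cvgM; first exact: cvg_cst.
  by apply: cvg_at_left_filter; exact: continuous_powR.
Qed.

Lemma integral_powR_by (q b : R) : 0 < q -> 0 < b ->
  (\int[mu]_(x in `]b, +oo[) (x `^ (- q - 1))%:E = (b `^ (- q) / q)%:E)%E.
Proof.
move=> q0 b0.
rewrite integral_itv_obnd_cbnd; last first.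
  by apply/measurable_EFinP; exact: measurable_funTS.
rewrite (@ge0_continuous_FTC2y _ _ (fun x => - q^-1 * x `^ (- q)) _ 0).
- by rewrite sub0e -EFinN; congr EFin; rewrite mulNr opprK mulrC.
- by move=> x bx; exact: powR_ge0.
- apply: continuous_in_subspaceT => x; rewrite inE/= in_itv/= andbT => bx.
  by apply: continuous_powR; exact: lt_le_trans bx.
- rewrite -[X in _ --> X](mulr0 (- q^-1)); apply: cvgM; first exact: cvg_cst.
  exact: powR_cvgy0.
- move=> x bx; apply: derivableZ.
  by have [] := is_derive_powR (- q) (lt_trans b0 bx).
- apply: cvgM; first exact: cvg_cst.
  by apply: cvg_at_right_filter; exact: continuous_powR.
- move=> x; rewrite in_itv/= andbT => bx.
  rewrite derive1E.
  suff [] : is_derive x 1 (fun x => - q^-1 * x `^ (- q)) (x `^ (- q - 1)) by [].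
  have -> : x `^ (- q - 1) = - q^-1 *: (- q * x `^ (- q - 1)).
    by rewrite /GRing.scale/= mulrA mulrNN mulVf ?gt_eqF// mul1r.
  by apply: is_deriveZ; apply: is_derive_powR; exact: lt_trans bx.
Qed.

(** The integral is split at y, each side being compared with the power that is
    integrable there. *)
Lemma powR_dominated (h : R -> R) (a b p q y : R) : 0 < p -> 0 < q -> 0 < y ->
  measurable_fun Rpos h ->
  (forall x : R, 0 < x <= y -> `|h x| <= a * x `^ (p - 1)) ->
  (forall x, y < x -> `|h x| <= b * x `^ (- q - 1)) ->
  (\int[mu]_(x in Rpos) `|h x|%:E <= (a * y `^ p / p + b * y `^ (- q) / q)%:E)%E.
Proof.
move=> p0 q0 y0 mh ha hb.
have a0 : 0 <= a.
  have := ha y; rewrite y0 lexx => /(_ isT)/(le_trans (normr_ge0 _)).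
  by rewrite pmulr_lge0// powR_gt0.
have b0 : 0 <= b.
  have := hb (y + 1); rewrite ltrDl ltr01 => /(_ isT)/(le_trans (normr_ge0 _)).
  by rewrite pmulr_lge0// powR_gt0// addr_gt0.
have U : `]0, +oo[%classic = `]0, y] `|` `]y, +oo[ :> set R.
  apply/seteqP; split => x /=; rewrite !in_itv/= !andbT.
    by move=> ->; case: (leP x y) => xy; [left|right].
  by move=> [/andP[]//|/(lt_trans y0)].
have mE (f : R -> R) (A : set R) : measurable A -> measurable_fun setT f ->
    measurable_fun A (EFin \o f).
  by move=> mA mf; apply/measurable_EFinP; exact: measurable_funTS.
have mn : measurable_fun Rpos (fun x => `|h x|%:E).
  by apply/measurable_EFinP; exact: measurableT_comp.
rewrite U ge0_integral_setU//=; last 2 first.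
- by move: mn; rewrite U.
- apply/disj_setPLR => x /=; rewrite !in_itv/= andbT => /andP[_ xy].
  by rewrite ltNge xy.
rewrite EFinD; apply: leeD.
- rewrite -mulrA EFinM -(integral_powR_0b p0 y0) -ge0_integralZl//=; last 2 first.
  + by apply: mE => //; exact: measurable_powR.
  + by move=> x _; rewrite lee_fin powR_ge0.
  apply: ge0_le_integral => //=.
  + by apply: measurable_funS mn => //; rewrite U; exact: subsetUl.
  + by apply: (mE (fun x => a * x `^ (p - 1))) => //; apply: measurable_funM.
- rewrite -mulrA EFinM -(integral_powR_by q0 y0) -ge0_integralZl//=; last 2 first.
  + by apply: mE => //; exact: measurable_powR.
  + by move=> x _; rewrite lee_fin powR_ge0.
  apply: ge0_le_integral => //=.
  + by apply: measurable_funS mn => //; rewrite U; exact: subsetUr.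
  + by apply: (mE (fun x => b * x `^ (- q - 1))) => //; apply: measurable_funM.
  + by move=> x; rewrite in_itv/= andbT => xy; rewrite -EFinM lee_fin; exact: hb.
Qed.

End improper_integrals.

(** * Domination by one power near zero and another at infinity *)

Section domination.
Context {R : realType}.
Implicit Types (f g h : R -> R) (a b p q x y t : R).
Notation mu := (@lebesgue_measure R).
Local Notation Rpos := (`]0%R, +oo[%classic : set R).

Lemma Rpos_gt0 x : Rpos x -> 0 < x.
Proof. by rewrite /= in_itv/= andbT. Qed.

(** The exponents are normalized so that the two pieces integrate to a y^p / p
    and b y^(-q) / q. *)
Definition powR_bound a b p q y x : R :=
  if x <= y then a * x `^ (p - 1) else b * x `^ (- q - 1).

Lemma measurable_powR_bound a b p q y : measurable_fun setT (powR_bound a b p q y).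
Proof.
apply: measurable_fun_ifT.
- exact: measurable_fun_ler.
- by apply: measurable_funM => //; exact: measurable_powR.
- by apply: measurable_funM => //; exact: measurable_powR.
Qed.

Lemma powR_bound_ge0 a b p q y x : 0 <= a -> 0 <= b -> 0 <= powR_bound a b p q y x.
Proof. by move=> a0 b0; rewrite /powR_bound; case: ifP => _; rewrite mulr_ge0// powR_ge0. Qed.

Lemma powR_bound_dominates h a b p q y : 0 < p -> 0 < q -> 0 < y ->
  measurable_fun Rpos h ->
  (forall x, 0 < x -> `|h x| <= powR_bound a b p q y x) ->
  mu.-integrable Rpos (EFin \o h) /\
  `|\int[mu]_(x in Rpos) h x| <= a * y `^ p / p + b * y `^ (- q) / q.
Proof.
move=> p0 q0 y0 mh hb.
have le : (\int[mu]_(x in Rpos) `|h x|%:E <= (a * y `^ p / p + b * y `^ (- q) / q)%:E)%E.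
  apply: powR_dominated => // x.
    by move=> /andP[x0 xy]; have := hb x x0; rewrite /powR_bound xy.
  by move=> yx; have := hb x (lt_trans y0 yx); rewrite /powR_bound [x <= y]leNgt yx.
have ih : mu.-integrable Rpos (EFin \o h).
  apply/integrableP; split; first exact/measurable_EFinP.
  by apply: le_lt_trans le _; rewrite ltry.
split => //; rewrite -lee_fin; apply: le_trans le.
rewrite EFin_normr_Rintegral//.
by apply: le_abse_integral => //; have /integrableP[] := ih.
Qed.

Lemma integrable_powR_bound a b p q y : 0 <= a -> 0 <= b -> 0 < p -> 0 < q -> 0 < y ->
  mu.-integrable Rpos (EFin \o powR_bound a b p q y).
Proof.
move=> a0 b0 p0 q0 y0; apply: (powR_bound_dominates (a := a) (b := b) p0 q0 y0 _ _).1.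
  by apply: measurable_funTS; exact: measurable_powR_bound.
by move=> x _; rewrite ger0_norm// powR_bound_ge0.
Qed.

End domination.

(** * Limits and measurability of iterated differences *)

Section fdiff_theory.
Context {R : realType}.
Implicit Types (f g : R -> R) (x y z t tau : R).
Local Notation Rpos := (`]0%R, +oo[%classic : set R).

Lemma eq_fdiff m tau f g y : 0 <= tau -> (forall z, y <= z -> f z = g z) ->
  fdiff m tau f y = fdiff m tau g y.
Proof.
move=> tau0; elim: m y => [|m IH] y fg; first exact: fg.
rewrite !fdiffS !IH// => z yz; apply: fg => //.
by rewrite (le_trans _ yz)// lerDl.
Qed.

Lemma fdiff_cvg m tau g (u : R^nat) y : 0 <= tau ->
  (forall z, y <= z -> g (z + u n) @[n --> \oo] --> g z) ->
  fdiff m tau g (y + u n) @[n --> \oo] --> fdiff m tau g y.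
Proof.
move=> tau0; elim: m y => [|m IH] y hg; first exact: hg.
rewrite fdiffS.
have -> : (fun n => fdiff m.+1 tau g (y + u n)) =
    (fun n => fdiff m tau g (y + tau + u n) - fdiff m tau g (y + u n)).
  by apply/funext => n; rewrite fdiffS addrAC.
apply: cvgB; apply: IH => // z yz; apply: hg => //.
by rewrite (le_trans _ yz)// lerDl.
Qed.

(** The step t of the difference is the variable here. The base point moves by
    t from one difference to the next, hence the induction on m for all base
    points x + i t. *)
Lemma continuous_pos_measurable_fdiff m g x (i : nat) : 0 < x ->
  (forall z, 0 < z -> {for z, continuous g}) ->
  measurable_fun Rpos (fun t => fdiff m t g (x + i%:R * t)).
Proof.
move=> x0 cg; elim: m i => [|m IH] i.
  apply: open_continuous_measurable_fun => // t; rewrite inE => /Rpos_gt0 t0.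
  apply: (@continuous_comp _ _ _ (fun t => x + i%:R * t) g).
    by apply: cvgD; [exact: cvg_cst|apply: cvgM; [exact: cvg_cst|exact: cvg_id]].
  by apply: cg; rewrite ltr_wpDr// mulr_ge0// ltW.
have -> : (fun t => fdiff m.+1 t g (x + i%:R * t)) =
    (fun t => fdiff m t g (x + i.+1%:R * t) - fdiff m t g (x + i%:R * t)).
  by apply/funext => t; rewrite fdiffS -addrA -natr1 mulrDl mul1r.
exact: measurable_funB.
Qed.

Lemma smooth_pos_continuous f j x : smooth_pos f -> 0 < x ->
  {for x, continuous (derive1n j f)}.
Proof.
move=> sf x0; apply: differentiable_continuous; apply/derivable1_diffP; exact: sf.
Qed.

End fdiff_theory.

(** * Measurability of integrals depending on a parameter *)

Section parametric_integral.
Local Open Scope ereal_scope.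
Context d1 d2 (T1 : measurableType d1) (T2 : measurableType d2) {R : realType}.
Variable m2 : {sigma_finite_measure set T2 -> \bar R}.

(** Fubini-Tonelli gives this for nonnegative functions; the general case is
    the difference of the two parts. *)
Lemma measurable_fun_parametric_integral (D : set T2) (f : T1 * T2 -> \bar R) :
  measurable D -> measurable_fun setT f ->
  measurable_fun setT (fun x => \int[m2]_(y in D) f (x, y)).
Proof.
move=> mD mf.
pose g := f \_ (setT `*` D).
have mg : measurable_fun setT g.
  apply/(measurable_restrictT _ _).1; first exact: measurableX.
  exact: measurable_funTS.
have -> : (fun x => \int[m2]_(y in D) f (x, y)) =
    fun x => \int[m2]_y g^\+ (x, y) - \int[m2]_y g^\- (x, y).
  apply/funext => x; rewrite integral_mkcond integralE.
  have gE y : g (x, y) = ((fun y => f (x, y)) \_ D) y.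
    rewrite /g /patch; have [yD|yD] := boolP (y \in D).
      by rewrite mem_set//; split => //; exact: set_mem.
    by rewrite memNset// => -[_ /= /mem_set]; exact/negP.
  by congr (_ - _); apply: eq_integral => y _; rewrite ?funeposE ?funenegE gE.
apply: emeasurable_funB.
  apply: (measurable_fun_fubini_tonelli_F g^\+) => //; exact: measurable_funepos.
apply: (measurable_fun_fubini_tonelli_F g^\-) => //; exact: measurable_funeneg.
Qed.

Lemma measurable_fun_parametric_Rintegral (D : set T2) (f : T1 * T2 -> R) :
  measurable D -> measurable_fun setT f ->
  measurable_fun setT (fun x => \int[m2]_(y in D) f (x, y))%R.
Proof.
move=> mD mf; apply: (measurableT_comp (f := fine)) => //.
by apply: (measurable_fun_parametric_integral (f := EFin \o f)) => //; exact/measurable_EFinP.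
Qed.

End parametric_integral.

(** * Smoothing semigroups and their derivatives *)

Section smoothing_semigroup.
Context d (T : measurableType d) {R : realType}.
Implicit Types (f g h : T -> R) (M s t y : R) (p : T).

(** Bounded everywhere, and not only almost everywhere: the semigroup then acts
    on functions, at every point. *)
Definition bounded_borel M f := measurable_fun setT f /\ forall p, `|f p| <= M.

(** What the proof uses of a Poisson semigroup. The field ss_ae allows f to be
    unbounded on a null set, as a representative of a class in L^oo may be. The
    bound in ss_deriv is the smoothing. The functions H in ss_fubini are
    jointly measurable and dominated uniformly in the space variable, so that
    the semigroup passes under the integral. *)
Record smoothing_semigroup (mu : {measure set T -> \bar R})
    (P : R -> (T -> R) -> T -> R) (K : R) : Prop := SmoothingSemigroup {
  ss_bounded : forall y M f, 0 < y -> bounded_borel M f -> bounded_borel M (P y f) ;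
  ss_sub : forall y M N f g p, 0 < y -> bounded_borel M f -> bounded_borel N g ->
    P y (fun q => f q - g q) p = P y f p - P y g p ;
  ss_scale : forall y M c f p, 0 < y -> bounded_borel M f ->
    P y (fun q => c * f q) p = c * P y f p ;
  ss_add : forall s t M f p, 0 < s -> 0 < t -> bounded_borel M f ->
    P s (P t f) p = P (s + t) f p ;
  ss_cvg : forall y M (f_ : nat -> T -> R) f p, 0 < y ->
    (forall n, bounded_borel M (f_ n)) -> (forall q, f_ n q @[n --> \oo] --> f q) ->
    P y (f_ n) p @[n --> \oo] --> P y f p ;
  ss_deriv : forall y M f p, 0 < y -> bounded_borel M f ->
    derivable (fun s => P s f p) y 1 /\
    `|derive1 (fun s => P s f p) y| <= K * M / y ;
  ss_inj : forall M h, bounded_borel M h ->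
    (forall s p, 0 < s -> P s h p = 0) -> {ae mu, forall p, h p = 0} ;
  ss_measurable : forall M f, bounded_borel M f ->
    measurable_fun setT (fun q : measurableTypeR R * T => P q.1 f q.2) ;
  ss_fubini : forall y p (G : R -> R) (H : T * measurableTypeR R -> R), 0 < y ->
    measurable_fun setT H ->
    lebesgue_measure.-integrable (`]0, +oo[%classic : set R) (EFin \o G) ->
    (forall q t, 0 < t -> `|H (q, t)| <= G t) ->
    P y (fun q => \int[lebesgue_measure]_(t in `]0, +oo[) H (q, t)) p =
    \int[lebesgue_measure]_(t in `]0, +oo[) P y (fun q => H (q, t)) p ;
  ss_ae : forall y M f g p, 0 < y -> measurable_fun setT f -> bounded_borel M g ->
    {ae mu, forall q, f q = g q} -> P y f p = P y g p }.

Lemma bounded_borel_ge0 M f p : bounded_borel M f -> 0 <= M.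
Proof. by move=> [_ /(_ p)]; exact: le_trans. Qed.

Lemma bounded_borelB M N f g : bounded_borel M f -> bounded_borel N g ->
  bounded_borel (M + N) (fun p => f p - g p).
Proof.
move=> [mf hf] [mg hg]; split; first exact: measurable_funB.
by move=> p; rewrite (le_trans (ler_normB _ _))// lerD.
Qed.

Lemma bounded_borelZ M c f : bounded_borel M f ->
  bounded_borel (`|c| * M) (fun p => c * f p).
Proof.
move=> [mf hf]; split; first exact: measurable_funM.
by move=> p; rewrite normrM ler_wpM2l.
Qed.

Context (mu : {measure set T -> \bar R}) (P : R -> (T -> R) -> T -> R) (K : R).
Hypothesis PP : smoothing_semigroup mu P K.

Local Notation D f j y p := (derive1n j (fun s => P s f p) y).

Lemma semigroup_deriv1_quotient M f y p : 0 < y -> bounded_borel M f ->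
  n.+1%:R * (P (y + n.+1%:R^-1) f p - P y f p) @[n --> \oo] --> D f 1 y p.
Proof.
move=> y0 bf; have [df _] := ss_deriv PP p y0 bf.
by rewrite derive1n1; exact: cvg_difference_quotient.
Qed.

(** Difference quotients approximate the derivative in y boundedly, so that
    ss_cvg makes the semigroup commute with this derivative. *)
Lemma quotient_bounded M f y n : 0 < y -> bounded_borel M f ->
  bounded_borel (K * M / y)
    (fun p => n.+1%:R * (P (y + n.+1%:R^-1) f p - P y f p)).
Proof.
move=> y0 bf.
have n0 : 0 < n.+1%:R^-1 :> R by rewrite invr_gt0.
have yn0 : 0 < y + n.+1%:R^-1 by rewrite addr_gt0.
have [mf1 _] := ss_bounded PP yn0 bf.
have [mf2 _] := ss_bounded PP y0 bf.
split; first by apply: measurable_funM => //; exact: measurable_funB.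
move=> p; have M0 := bounded_borel_ge0 p bf.
have K0 : 0 <= K * M / y by apply: le_trans (ss_deriv PP p y0 bf).2.
pose phi s := P s f p.
have := @increment_powR _ phi (derive1 phi) y n.+1%:R^-1 (K * M / y) 0 n0 K0 ltr01 y0.
rewrite !oppr0 !addr0 divr1 powRr1 ?invr_ge0// => H.
rewrite normrM ger0_norm// -ler_pdivlMl// mulrC; apply: H => [x x0|s /andP[s0 _]].
  rewrite derive1E; apply/derivableP; exact: (ss_deriv PP p x0 bf).1.
rewrite powRr0 mulr1.
have ys : 0 < y + s by rewrite addr_gt0.
apply: (le_trans (ss_deriv PP p ys bf).2).
have KM : 0 <= K * M by rewrite -(pmulr_lge0 _ (_ : 0 < y^-1)) ?invr_gt0.
by rewrite ler_wpM2l// lef_pV2 ?posrE// lerDl ltW.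
Qed.

Lemma bounded_deriv1 M f y : 0 < y -> bounded_borel M f ->
  bounded_borel (K * M / y) (fun p => D f 1 y p).
Proof.
move=> y0 bf; split; last by move=> p; rewrite derive1n1; exact: (ss_deriv PP p y0 bf).2.
apply: (@measurable_fun_cvg _ _ _ _
  (fun n p => n.+1%:R * (P (y + n.+1%:R^-1) f p - P y f p))).
  by move=> n; have [] := quotient_bounded n y0 bf.
by move=> p _; exact: semigroup_deriv1_quotient bf.
Qed.

Lemma semigroup_deriv1 M f s y p : 0 < s -> 0 < y -> bounded_borel M f ->
  P s (fun q => D f 1 y q) p = D f 1 (s + y) p.
Proof.
move=> s0 y0 bf; have sy0 : 0 < s + y by rewrite addr_gt0.
have h1 := ss_cvg PP (p := p) s0 (fun n => quotient_bounded n y0 bf)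
  (fun q => semigroup_deriv1_quotient (p := q) y0 bf).
have h2 := semigroup_deriv1_quotient (p := p) sy0 bf.
suff E : (fun n => P s (fun q => n.+1%:R * (P (y + n.+1%:R^-1) f q - P y f q)) p) =
    (fun n => n.+1%:R * (P (s + y + n.+1%:R^-1) f p - P (s + y) f p)).
  by rewrite E in h1; exact: (cvg_unique _ h1 h2).
apply/funext => n.
have n0 : 0 < n.+1%:R^-1 :> R by rewrite invr_gt0.
have yn0 : 0 < y + n.+1%:R^-1 by rewrite addr_gt0.
have b1 := ss_bounded PP yn0 bf; have b2 := ss_bounded PP y0 bf.
rewrite (ss_scale PP _ _ s0 (bounded_borelB b1 b2)) (ss_sub PP _ s0 b1 b2).
by rewrite (ss_add PP _ s0 yn0 bf) (ss_add PP _ s0 y0 bf) addrA.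
Qed.

(** A bound c / y^i on the derivative of order i, taken at y/2, becomes K c
    2^(i+1) / y^(i+1) after one more derivative at y/2. *)
Fixpoint deriv_cst (j : nat) : R :=
  if j is i.+1 then K * deriv_cst i * 2 ^+ j else 1.

(** The semigroup law turns the derivative of order j at z into the orbit of
    the derivative of order j at a fixed a < z, whose first derivative
    exists. *)
Lemma semigroup_deriv_step M j f (a z : R) p :
  bounded_borel M (fun q => D f j a q) ->
  (forall s q, 0 < s -> P s (fun q => D f j a q) q = D f j (s + a) q) ->
  a < z -> is_derive z 1 (fun s => D f j s p) (D (fun q => D f j a q) 1 (z - a) p).
Proof.
move=> hb hP az; have za : 0 < z - a by rewrite subr_gt0.
have [h1 _] := ss_deriv PP p za hb.
set g := fun q => D f j a q.
have h2 : is_derive (- a + z) 1 (fun s => P s g p) (D g 1 (z - a) p).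
  by rewrite (addrC (- a)) derive1n1 derive1E; exact/derivableP.
apply: near_eq_is_derive (is_derive_shiftl h2).
near=> s; have sa : a < s by near: s; exact: lt_nbhsr.
by rewrite /g hP ?(addrC _ s) ?subrK// subr_gt0.
Unshelve. all: by end_near. Qed.

(** The two parts are proved together: the bound makes the derivative of order
    j a function on which the semigroup acts, and the semigroup law for it
    gives the bound at the next order, with the time y split in two halves. *)
Lemma semigroup_derivn M f j : bounded_borel M f ->
  (forall y, 0 < y -> bounded_borel (deriv_cst j * M / y ^+ j) (fun p => D f j y p)) /\
  (forall s y p, 0 < s -> 0 < y -> P s (fun q => D f j y q) p = D f j (s + y) p).
Proof.
move=> bf; elim: j => [|j [hb hP]].
  split=> [y y0|s y p s0 y0]; last exact: (ss_add PP p s0 y0 bf).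
  by rewrite /= mul1r expr0 divr1; exact: (ss_bounded PP y0 bf).
have E (a z : R) p : 0 < a -> a < z -> D f j.+1 z p = D (fun q => D f j a q) 1 (z - a) p.
  move=> a0 az; rewrite derive1nS derive1E.
  have hs s q : 0 < s -> P s (fun q => D f j a q) q = D f j (s + a) q.
    by move=> s0; exact: hP.
  by have [] := semigroup_deriv_step p (hb a a0) hs az.
have half (y : R) : 0 < y -> 0 < y / 2 < y /\ y - y / 2 = y / 2.
  by move=> y0; split; [apply/andP; split; lra|field].
have Efun y : 0 < y -> (fun p => D f j.+1 y p) =
    fun p => D (fun q => D f j (y / 2) q) 1 (y / 2) p.
  move=> /half[/andP[y1 y2] y3]; apply/funext => p.
  by rewrite (E _ _ _ y1 y2) y3.
split=> [y y0|s y p s0 y0].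
  have [/andP[y1 y2] _] := half y y0.
  rewrite Efun//; have [h1 h2] := bounded_deriv1 y1 (hb _ y1); split=> // p.
  apply: (le_trans (h2 p)); rewrite le_eqVlt; apply/orP; left; apply/eqP.
  rewrite /= !exprS expr_div_n; field.
  by rewrite !expf_neq0// gt_eqF.
have [/andP[y1 y2] y3] := half y y0.
rewrite Efun// (semigroup_deriv1 p s0 y1 (hb _ y1)) (E (y / 2)).
- by rewrite -addrA y3.
- exact: y1.
- by rewrite (lt_trans y2)// ltrDr.
Qed.

Lemma semigroup_smooth M f p : bounded_borel M f -> smooth_pos (fun s => P s f p).
Proof.
move=> bf j y y0; have [hb hP] := semigroup_derivn j bf.
have y1 : 0 < y / 2 by rewrite divr_gt0.
have y2 : y / 2 < y by lra.
have hs s q : 0 < s -> P s (fun q => D f j (y / 2) q) q = D f j (s + y / 2) q.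
  by move=> s0; exact: hP.
by have [] := semigroup_deriv_step p (hb _ y1) hs y2.
Qed.

Lemma semigroup_derivS M f j y p : bounded_borel M f -> 0 < y ->
  D f j.+1 y p = D (fun q => D f j (y / 2) q) 1 (y / 2) p.
Proof.
move=> bf y0; have [hb hP] := semigroup_derivn j bf.
have y1 : 0 < y / 2 by rewrite divr_gt0.
have y2 : y / 2 < y by lra.
rewrite derive1nS derive1E.
have hs s q : 0 < s -> P s (fun q => D f j (y / 2) q) q = D f j (s + y / 2) q.
  by move=> s0; exact: hP.
have [_ ->] := semigroup_deriv_step p (hb _ y1) hs y2.
by congr (D _ _ _ _); field.
Qed.

(** Each further derivative costs a factor of order 1/y by semigroup_derivS and
    the smoothing bound at y/2, so the exponent al is kept at all higher
    orders. *)
Lemma semigroup_deriv_up (al : R) k i : exists2 C : R, 0 <= C &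
  forall M f A, bounded_borel M f -> 0 <= A ->
  (forall y p, 0 < y -> `|D f k y p| <= A * y `^ (- k%:R + al)) ->
  forall y p, 0 < y -> `|D f (k + i)%N y p| <= C * A * y `^ (- (k + i)%:R + al).
Proof.
elim: i => [|i [C C0 IH]].
  by exists 1 => // M f A bf A0 h y p y0; rewrite addn0 mul1r h.
exists (C * `|K| * 2 * (2^-1) `^ (- (k + i)%:R + al)).
  by rewrite !mulr_ge0// powR_ge0.
move=> M f A bf A0 h y p y0; rewrite addnS (semigroup_derivS _ _ bf y0).
have y1 : 0 < y / 2 by rewrite divr_gt0.
have [hb _] := semigroup_derivn (k + i)%N bf; have [mD _] := hb _ y1.
have bD : bounded_borel (C * A * (y / 2) `^ (- (k + i)%:R + al))
    (fun q => D f (k + i)%N (y / 2) q).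
  by split=> // q; exact: IH bf A0 h _ _ y1.
have [_ /(_ p)/le_trans] := bounded_deriv1 y1 bD; apply.
rewrite (@powRM _ y) ?invr_ge0 ?(ltW y0)//.
have -> : - (k + i).+1%:R + al = (- (k + i)%:R + al) - 1.
  by rewrite -natr1; ring.
rewrite [X in _ <= _ * X]powRB; last by rewrite (gt_eqF y0) implybT.
rewrite powRr1 ?(ltW y0)//.
set u := y `^ _; set v := _^-1 `^ _.
have -> : K * (C * A * (u * v)) / (y / 2) = (C * A * 2 * v * (u / y)) * K.
  by field; rewrite gt_eqF.
have -> : C * `|K| * 2 * v * A * (u / y) = (C * A * 2 * v * (u / y)) * `|K|.
  by ring.
rewrite ler_wpM2l ?ler_norm// !mulr_ge0// ?powR_ge0// invr_ge0 ltW//.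
Qed.

End smoothing_semigroup.

(** * Essential bounds *)

Section Lnorm_infty.
Context d (T : measurableType d) {R : realType} (mu : {measure set T -> \bar R}).

(** On a space of measure zero the essential supremum has a conventional value,
    but there every property holds almost everywhere. *)
Lemma Lnorm_infty_ae (h : T -> R) (B : R) :
  (Lnorm mu +oo (EFin \o h) <= B%:E)%E -> {ae mu, forall p, `|h p| <= B}.
Proof.
rewrite unlock /Lnorm; case: ifPn => [_ /ess_supP|mu0 _].
  by apply: filterS => p; rewrite /= lee_fin.
exists setT; split => //; apply/eqP; move: mu0.
by rewrite lt0e measure_ge0 andbT negbK.
Qed.

Lemma Lnorm_infty_le (h : T -> R) (B : R) : 0 <= B ->
  {ae mu, forall p, `|h p| <= B} -> (Lnorm mu +oo (EFin \o h) <= B%:E)%E.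
Proof.
move=> B0 hB; rewrite unlock /Lnorm; case: ifPn => [_|_]; last by rewrite lee_fin.
by apply/ess_supP; apply: filterS hB => p; rewrite /= lee_fin.
Qed.

Lemma Lnorm_infty_ge0 (h : T -> R) (B : R) :
  (Lnorm mu +oo (EFin \o h) <= B%:E)%E -> 0 <= B.
Proof. by rewrite -lee_fin; apply: le_trans; exact: Lnorm_ge0. Qed.

End Lnorm_infty.

(** * Interpolation between orders and boundary values *)

Section boundary.
Context d (T : measurableType d) {R : realType}.
Implicit Types (f g h : T -> R) (M N A s t y : R) (p : T).
Context (mu : {measure set T -> \bar R}) (P : R -> (T -> R) -> T -> R) (K : R).
Hypothesis PP : smoothing_semigroup mu P K.

Local Notation D f j y p := (derive1n j (fun s => P s f p) y).

(** Truncation gives each class in L^oo a representative which is bounded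
    everywhere. *)
Definition clamp M f p := Num.max (- M) (Num.min M (f p)).

Lemma bounded_borel_clamp M f : 0 <= M -> measurable_fun setT f ->
  bounded_borel M (clamp M f).
Proof.
move=> M0 mf; split.
  by apply: measurable_maxr => //; exact: measurable_minr.
move=> p; rewrite ler_norml /clamp le_max lexx/= ge_max ge_min lexx/= andbT.
by rewrite ge0_cp.
Qed.

Lemma clamp_id M f p : `|f p| <= M -> clamp M f p = f p.
Proof.
rewrite ler_norml /clamp => /andP[h1 h2].
by rewrite (min_idPr h2); apply/max_idPr.
Qed.

Lemma ae_clamp M f : {ae mu, forall p, `|f p| <= M} ->
  {ae mu, forall p, f p = clamp M f p}.
Proof. by apply: filterS => p /clamp_id. Qed.

Lemma semigroup_ae_bound M f s p : 0 < s -> 0 <= M -> measurable_fun setT f ->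
  {ae mu, forall q, `|f q| <= M} -> `|P s f p| <= M.
Proof.
move=> s0 M0 mf hf; have bc := bounded_borel_clamp M0 mf.
rewrite (ss_ae PP p s0 mf bc (ae_clamp hf)).
exact: (ss_bounded PP s0 bc).2.
Qed.

Definition deriv_le k (al A : R) f :=
  forall y p, 0 < y -> `|D f k y p| <= A * y `^ (- k%:R + al).

(** The derivative at y is P_s of the derivative at y - s, and P_s does not see
    null sets. So the essential bound at y - s is a bound at every point at y,
    and s -> 0 restores the exponent. *)
Lemma ess_deriv_le M k (al A : R) f : bounded_borel M f ->
  (forall y, 0 < y ->
    (Lnorm mu +oo (fun p => (D f k y p)%:E) <= (A * y `^ (- k%:R + al))%:E)%E) ->
  deriv_le k al A f.
Proof.
move=> bf hA y p y0; have [hb hP] := semigroup_derivn PP k bf.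
have cv : A * (y - s) `^ (- k%:R + al) @[s --> 0^'+] --> A * y `^ (- k%:R + al).
  apply: cvgM; first exact: cvg_cst.
  apply: (@cvg_comp _ _ _ (fun s => y - s) (fun z => z `^ (- k%:R + al)) _ (nbhs y)).
    apply: cvg_at_right_filter; rewrite -[X in _ --> X](subr0 y).
    by apply: cvgB; [exact: cvg_cst|exact: cvg_id].
  exact: continuous_powR.
apply: (cvgr_to_ge cv); near=> s.
have s0 : 0 < s by [].
have sy : 0 < y - s by rewrite subr_gt0; near: s; exact: nbhs_right_lt.
rewrite -[in X in D _ _ X _](subrK s y) addrC -hP//.
apply: semigroup_ae_bound => //; first exact: Lnorm_infty_ge0 (hA _ sy).
  by have [] := hb _ sy.
exact: Lnorm_infty_ae (hA _ sy).
Unshelve. all: by end_near. Qed.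

Lemma deriv_cst_bound N f j y p : bounded_borel N f -> 0 < y ->
  `|D f j y p| <= deriv_cst K j * N * y `^ (- j%:R).
Proof.
move=> bf y0; have [hb _] := semigroup_derivn PP j bf.
by have [_ /(_ p)] := hb _ y0; rewrite powR_invn ?(ltW y0).
Qed.

(** At an order j >= k there are two bounds, A y^(-j+al) and N y^(-j) up to
    constants; the first is better for y <= 1 and the second for y >= 1, and
    either gives y^(-j+ga) where it is better. From a high order one descends
    to m by integrating from infinity, which is possible as long as the order
    exceeds ga. *)
Lemma deriv_interpolate (al ga : R) (k m : nat) : 0 < ga < m%:R -> ga <= al ->
  exists2 C : R, 0 <= C & forall N f A, 0 <= N -> bounded_borel N f -> 0 <= A ->
    deriv_le k al A f -> deriv_le m ga (C * (N + A)) f.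
Proof.
move=> /andP[ga0 gam] gaal.
pose S j := exists2 C : R, 0 <= C & forall N f A, 0 <= N -> bounded_borel N f ->
  0 <= A -> deriv_le k al A f -> deriv_le j ga (C * (N + A)) f.
have top i : S (k + i)%N.
  have [C C0 hC] := semigroup_deriv_up PP al k i.
  have [c c0 cc] : exists2 c : R, 0 <= c & deriv_cst K (k + i) <= c.
    by exists `|deriv_cst K (k + i)|; rewrite ?ler_norm.
  exists (C + c); first by rewrite addr_ge0.
  move=> N f A N0 bf A0 hA y p y0.
  have h1 := hC N f A bf A0 hA y p y0.
  have h2 := deriv_cst_bound (k + i) p bf y0.
  have NA0 : 0 <= N + A by rewrite addr_ge0.
  have [y1|/ltW y1] := leP y 1.
    apply: (le_trans h1); apply: ler_pM; rewrite ?powR_ge0 ?mulr_ge0//.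
      by apply: ler_pM => //; [rewrite lerDl|rewrite lerDr].
    by rewrite ger_powR ?y0// lerD2l.
  apply: (le_trans h2); apply: (@le_trans _ _ (c * N * y `^ (- (k + i)%:R))).
    by rewrite ler_wpM2r ?powR_ge0// ler_wpM2r.
  apply: ler_pM; rewrite ?powR_ge0 ?mulr_ge0//.
    by apply: ler_pM => //; [rewrite lerDr|rewrite lerDl].
  by rewrite ler_powR// lerDl ltW.
have down j : (m <= j)%N -> S j.+1 -> S j.
  move=> mj [C C0 hC].
  have gaj : 0 < ga < j%:R by rewrite ga0 (lt_le_trans gam)// ler_nat.
  have jga : 0 < j%:R - ga by rewrite subr_gt0; case/andP: gaj.
  exists (C / (j%:R - ga)); first by rewrite divr_ge0// ltW.
  move=> N f A N0 bf A0 hA y p y0.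
  have NA0 : 0 <= C * (N + A) by rewrite mulr_ge0// addr_ge0.
  have := @derive1n_down _ (fun s => P s f p) j (C * (N + A)) _ ga
    (semigroup_smooth PP (p := p) bf) NA0 gaj (fun y hy => hC N f A N0 bf A0 hA y p hy)
    (fun y hy => deriv_cst_bound j p bf hy) y y0.
  by rewrite (mulrAC C).
have desc i : S (m + i)%N -> S m.
  elim: i => [|i IH]; first by rewrite addn0.
  by rewrite addnS => /down h; apply/IH/h; exact: leq_addr.
by apply: (desc k); rewrite addnC; exact: top.
Qed.

(** With order of smoothness below 1 the first derivative is integrable at 0,
    hence P_y f converges to a function F, and P_s F = P_s f for all s > 0 by
    the semigroup law. Injectivity gives F = f almost everywhere. *)
Lemma boundary_value (al : R) k N f A : 0 < al -> 0 <= N -> bounded_borel N f ->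
  0 <= A -> deriv_le k al A f ->
  exists F, [/\ bounded_borel N F, forall p, P y f p @[y --> 0^'+] --> F p,
    forall s p, 0 < s -> P s F p = P s f p & {ae mu, forall p, f p = F p}].
Proof.
move=> al0 N0 bf A0 hA.
(* Any exponent in (0, 1) which is at most al will do. *)
pose ga : R := Num.min al (2^-1).
have ga0 : 0 < ga by rewrite lt_min al0 invr_gt0 ltr0n.
have ga1 : ga < 1 by rewrite gt_min invf_lt1 ?ltr1n ?orbT.
have ga01 : 0 < ga < 1%:R by rewrite ga0.
have gaal : ga <= al by rewrite ge_min lexx.
have [C C0 hC] := @deriv_interpolate al ga k 1 ga01 gaal.
have {hC} h1 := hC N f A N0 bf A0 hA.
set B := C * (N + A) in h1; have B0 : 0 <= B by rewrite mulr_ge0// addr_ge0.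
pose G y : R := B / ga * y `^ ga.
have dG y : 0 < y -> is_derive y 1 G (B * y `^ (ga - 1)).
  move=> y0; have -> : B * y `^ (ga - 1) = (B / ga) *: (ga * y `^ (ga - 1)).
    by rewrite /GRing.scale/= mulrA divfK ?gt_eqF.
  by apply: is_deriveZ; exact: is_derive_powR.
have inc p y z : 0 < y -> y < z -> `|P z f p - P y f p| <= G z - G y.
  move=> y0 yz; have sm := semigroup_smooth PP (p := p) bf.
  have dP (x : R) : 0 < x -> is_derive x 1 (fun s => P s f p) (D f 1 x p).
    exact: (@smooth_pos_is_derive _ (fun s => P s f p) 0 x sm).
  have cf : {within `[y, z], continuous (fun s => P s f p)}.
    by apply: (@derivable_pos_within_continuous _ (fun s => P s f p) y z y0) => x /dP[].
  have cG : {within `[y, z], continuous G}.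
    by apply: (@derivable_pos_within_continuous _ G y z y0) => x /dG[].
  apply: (le_norm_increment yz cf cG (dF := fun x => D f 1 x p)
     (dG := fun x => B * x `^ (ga - 1))).
  - by move=> x /andP[yx _]; apply: dP; exact: lt_trans yx.
  - by move=> x /andP[yx _]; apply: dG; exact: lt_trans yx.
  - move=> x /andP[yx _]; rewrite (addrC ga); apply: h1; exact: lt_trans yx.
have G0 : G y @[y --> 0^'+] --> 0.
  rewrite -[X in _ --> X](mulr0 (B / ga)); apply: cvgM; first exact: cvg_cst.
  exact: powR_cvg0.
have cvP p : cvg (P y f p @[y --> 0^'+]).
  (* Since increments of G dominate those of the orbit, adding G makes the
     orbit nondecreasing, and a bounded monotone function has a limit. *)
  have : cvg (P y f p + G y @[y --> 0^'+]).
    apply: nondecreasing_at_right_is_cvgr; near=> b.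
      move=> y z; rewrite !in_itv/= => /andP[y0 _] /andP[z0 _].
      rewrite le_eqVlt => /predU1P[->//|yz].
      have := inc p y z y0 yz; rewrite ler_norml => /andP[+ _].
      by rewrite lerBrDr; lra.
    exists (- N) => _ [y /= + <-]; rewrite in_itv/= => /andP[y0 _].
    have [_ /(_ p)] := ss_bounded PP y0 bf; rewrite ler_norml => /andP[+ _].
    by move/le_trans; apply; rewrite lerDl mulr_ge0 ?powR_ge0// divr_ge0// ltW.
  move=> h; have E : (fun y => P y f p) = (fun y => P y f p + G y - G y).
    by apply/funext => y; rewrite addrK.
  by rewrite E; apply: is_cvgB => //; exact: cvgP G0.
pose F p := lim (P y f p @[y --> 0^'+]).
have cvF p : P y f p @[y --> 0^'+] --> F p by exact: cvP.
pose u n : R := n.+1%:R^-1.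
have u0 n : 0 < u n by rewrite invr_gt0.
have cvu : u n @[n --> \oo] --> (0 : R).
  exact: cvg_harmonic.
have cvFu p : P (u n) f p @[n --> \oo] --> F p.
  by move/cvg_at_rightP : (cvF p); apply; split.
have bP n : bounded_borel N (P (u n) f) by exact: (ss_bounded PP (u0 n) bf).
have bF : bounded_borel N F.
  split.
    apply: (@measurable_fun_cvg _ _ _ _ (fun n p => P (u n) f p)) => [n|p _].
      by have [] := bP n.
    exact: cvFu.
  move=> p; have : `|P (u n) f p| @[n --> \oo] --> `|F p| by exact: cvg_norm.
  by move=> /cvgr_to_le; apply; apply: nearW => n; exact: (bP n).2.
have PF s p : 0 < s -> P s F p = P s f p.
  move=> s0; have h := ss_cvg PP (p := p) s0 bP cvFu.
  suff h2 : P s (P (u n) f) p @[n --> \oo] --> P s f p by exact: (cvg_unique _ h h2).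
  have -> : (fun n => P s (P (u n) f) p) = (fun n => P (s + u n) f p).
    by apply/funext => n; exact: (ss_add PP p s0 (u0 n) bf).
  have cs : {for s, continuous (fun s => P s f p)}.
    apply: differentiable_continuous; apply/derivable1_diffP.
    exact: (ss_deriv PP p s0 bf).1.
  have csu : s + u n @[n --> \oo] --> s.
    by rewrite -[X in _ --> X](addr0 s); apply: cvgD => //; exact: cvg_cst.
  exact: (cvg_comp _ _ csu cs).
exists F; split => //.
have bfF := bounded_borelB bf bF.
have := ss_inj PP bfF; have hz s p : 0 < s -> P s (fun q => f q - F q) p = 0.
  by move=> s0; rewrite (ss_sub PP _ s0 bf bF) PF// subrr.
by move=> /(_ hz); apply: filterS => p /eqP; rewrite subr_eq0 => /eqP.
Unshelve. all: by end_near. Qed.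

End boundary.

(** * Iterated differences of an orbit *)

Section iterates.
Context d (T : measurableType d) {R : realType}.
Implicit Types (f g h F : T -> R) (M N A s t y z tau : R) (p : T).
Context (mu : {measure set T -> \bar R}) (P : R -> (T -> R) -> T -> R) (K : R).
Hypothesis PP : smoothing_semigroup mu P K.
Local Notation Rpos := (`]0%R, +oo[%classic : set R).
Local Notation leb := (@lebesgue_measure R).

(** P 0 need not be the identity, so the value at time 0 is put in by hand. *)
Definition orbit F y p := if 0 < y then P y F p else F p.

Lemma orbit_gt0 F y p : 0 < y -> orbit F y p = P y F p.
Proof. by rewrite /orbit => ->. Qed.

Lemma orbit0 F p : orbit F 0 p = F p.
Proof. by rewrite /orbit ltxx. Qed.

Definition fdiff_orbit m tau F y p := fdiff m tau (fun z => orbit F z p) y.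

Lemma fdiff_orbit_semigroup m tau N F y : 0 <= tau -> 0 <= y -> bounded_borel N F ->
  bounded_borel (2 ^+ m * N) (fdiff_orbit m tau F y) /\
  forall s p, 0 < s -> P s (fdiff_orbit m tau F y) p = fdiff_orbit m tau F (s + y) p.
Proof.
move=> tau0 + bF; rewrite /fdiff_orbit; elim: m y => [|m IH] y y0.
  rewrite expr0 mul1r /=; split=> [|s p s0].
    have [yp|yp] := ltP 0 y.
      by rewrite (_ : (fun _ => _) = P y F);
        [exact: (ss_bounded PP yp bF)|apply/funext => p; rewrite orbit_gt0].
    by rewrite (_ : (fun _ => _) = F)//; apply/funext => p; rewrite /orbit ltNge yp.
  rewrite orbit_gt0 ?ltr_wpDr//.
  move: y0; rewrite le_eqVlt => /predU1P[<-|y0].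
    by rewrite addr0; congr (P _ _ _); apply/funext => q; rewrite orbit0.
  rewrite -(ss_add PP p s0 y0 bF); congr (P _ _ _); apply/funext => q.
  by rewrite orbit_gt0.
have yt0 : 0 <= y + tau by rewrite addr_ge0.
have [b1 P1] := IH _ yt0; have [b2 P2] := IH _ y0; split.
  by rewrite exprS -mulrA mulr_natl mulr2n; exact: bounded_borelB.
by move=> s p s0; rewrite fdiffS (ss_sub PP p s0 b1 b2) P1// P2// addrA.
Qed.

(** P tau forgets null sets, so replacing F by f changes only the term of the
    iterate in which P tau does not occur. *)
Lemma iter_ae m tau N f F p : 0 < tau -> bounded_borel N F -> measurable_fun setT f ->
  {ae mu, forall q, f q = F q} ->
  iter m (fun h q => P tau h q - h q) f p =
  fdiff_orbit m tau F 0 p + (-1) ^+ m * (f p - F p).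
Proof.
move=> tau0 bF mf fF; elim: m p => [|m IH] p.
  by rewrite /fdiff_orbit /= orbit0 expr0 mul1r addrC subrK.
have [[mO bO] PO] := fdiff_orbit_semigroup m (ltW tau0) (lexx 0) bF.
rewrite iterS (_ : iter m _ f = fun q => fdiff_orbit m tau F 0 q + (-1) ^+ m * (f q - F q));
  last exact/funext.
rewrite (@ss_ae _ _ _ _ _ _ PP _ _ _ (fdiff_orbit m tau F 0) _ tau0 _ (conj mO bO)).
- rewrite PO// addr0 [in RHS]/fdiff_orbit fdiffS add0r exprS mulN1r mulNr opprD addrA.
  by [].
- apply: measurable_funD => //; apply: measurable_funM => //.
  by apply: measurable_funB => //; have [] := bF.
- by apply: filterS fF => q ->; rewrite subrr mulr0 addr0.
Qed.

(** The base point y + i tau is what the induction on m needs, as each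
    difference shifts it by the step tau. *)
Lemma measurable_fdiff_orbit m (i : nat) y N F : bounded_borel N F ->
  measurable_fun setT (fun q : T * measurableTypeR R =>
    fdiff_orbit m (q.2 : R) F (y + i%:R * (q.2 : R)) q.1).
Proof.
move=> bF; elim: m i => [|m IH] i.
  have mt : measurable_fun setT (fun q : T * measurableTypeR R => y + i%:R * (q.2 : R)).
    by apply: measurable_funD => //; apply: measurable_funM.
  rewrite /fdiff_orbit /=; apply: measurable_fun_ifT.
  - exact: measurable_fun_ltr.
  - have mg : measurable_fun setT (fun q : T * measurableTypeR R =>
        ((y + i%:R * (q.2 : R), q.1) : measurableTypeR R * T)).
      exact/measurable_fun_pair.
    exact: (measurableT_comp (ss_measurable PP bF) mg).
  - by apply: measurableT_comp => //; have [] := bF.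
have -> : (fun q : T * measurableTypeR R =>
    fdiff_orbit m.+1 (q.2 : R) F (y + i%:R * (q.2 : R)) q.1) =
    (fun q : T * measurableTypeR R =>
      fdiff_orbit m (q.2 : R) F (y + i.+1%:R * (q.2 : R)) q.1
      - fdiff_orbit m (q.2 : R) F (y + i%:R * (q.2 : R)) q.1).
  by apply/funext => q; rewrite /fdiff_orbit fdiffS -addrA -natr1 mulrDl mul1r.
exact: measurable_funB.
Qed.

Lemma fdiff_orbit_le m tau N F y p : 0 <= tau -> 0 <= y -> bounded_borel N F ->
  `|fdiff_orbit m tau F y p| <= 2 ^+ m * N.
Proof.
by move=> tau0 y0 bF; have [[_ +] _] := fdiff_orbit_semigroup m tau0 y0 bF; apply.
Qed.

Lemma fdiff_orbit_gt0 m tau F y p : 0 <= tau -> 0 < y ->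
  fdiff_orbit m tau F y p = fdiff m tau (fun z => P z F p) y.
Proof.
move=> tau0 y0; apply: eq_fdiff => // z yz.
by rewrite orbit_gt0// (lt_le_trans y0).
Qed.

Lemma fdiff_orbit_cvg0 m tau N F p : 0 <= tau -> bounded_borel N F ->
  P y F p @[y --> 0^'+] --> F p ->
  fdiff_orbit m tau F n.+1%:R^-1 p @[n --> \oo] --> fdiff_orbit m tau F 0 p.
Proof.
move=> tau0 bF cF.
pose u n : R := n.+1%:R^-1.
have u0 n : 0 < u n by rewrite invr_gt0.
have cvu : u n @[n --> \oo] --> (0 : R).
  exact: cvg_harmonic.
have := @fdiff_cvg _ m tau (fun z => orbit F z p) u 0 tau0.
under eq_fun do rewrite add0r; apply => z.
rewrite le_eqVlt => /predU1P[<-|z0].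
  rewrite orbit0; under eq_fun do rewrite add0r orbit_gt0//.
  by move/cvg_at_rightP : cF; apply; split.
rewrite orbit_gt0//; under eq_fun do rewrite orbit_gt0 ?addr_gt0//.
have cs : {for z, continuous (fun s => P s F p)}.
  apply: differentiable_continuous; apply/derivable1_diffP.
  exact: (ss_deriv PP p z0 bF).1.
have czu : z + u n @[n --> \oo] --> z.
  by rewrite -[X in _ --> X](addr0 z); apply: cvgD => //; exact: cvg_cst.
exact: (cvg_comp _ _ czu cs).
Qed.

(** The difference estimate fdiff_powR_le holds at every positive base point
    with a constant independent of it, and passes to the limit at time 0
    because the orbit is continuous there. *)
Lemma fdiff_orbit0_le m tau N F (ga B : R) p : 0 < tau -> bounded_borel N F ->
  0 < ga < m%:R -> 0 <= B -> P y F p @[y --> 0^'+] --> F p ->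
  deriv_le P m ga B F ->
  `|fdiff_orbit m tau F 0 p| <= (ga / m%:R)^-1 ^+ m * B * tau `^ ga.
Proof.
move=> tau0 bF /andP[ga0 gam] B0 cF hB.
have m0 : (0 < m)%N by rewrite -(ltr0n R) (lt_trans ga0).
have cv : `|fdiff_orbit m tau F n.+1%:R^-1 p| @[n --> \oo] -->
    `|fdiff_orbit m tau F 0 p|.
  by apply: cvg_norm; exact: (fdiff_orbit_cvg0 (ltW tau0) bF cF).
apply: (cvgr_to_le cv); apply: nearW => n.
have n0 : 0 < n.+1%:R^-1 :> R by rewrite invr_gt0.
rewrite fdiff_orbit_gt0 ?(ltW tau0)//.
have ge : 0 <= m%:R - ga < m%:R by rewrite subr_ge0 ltW//= ltrBlDr ltrDl.
have := @fdiff_powR_le _ (fun z => P z F p) m 0 tau n.+1%:R^-1 n.+1%:R^-1 B (m%:R - ga)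
  (semigroup_smooth PP (p := p) bF) m0 ge tau0 n0 (lexx _) B0.
rewrite addn0 (_ : 1 - (m%:R - ga) / m%:R = ga / m%:R); last first.
  by rewrite mulrBl divff ?gt_eqF ?ltr0n// opprB addrC subrK.
rewrite subKr; apply => z nz; rewrite opprB addrC.
by apply: hB; exact: lt_le_trans nz.
Qed.

End iterates.

(** * The fractional power of a regular function *)

Section fractional_power.
Context d (T : measurableType d) {R : realType}.
Implicit Types (f g h F : T -> R) (M N A s t y z tau : R) (p : T).
Context (mu : {measure set T -> \bar R}) (P : R -> (T -> R) -> T -> R) (K : R).
Hypothesis PP : smoothing_semigroup mu P K.
Local Notation Rpos := (`]0%R, +oo[%classic : set R).
Local Notation leb := (@lebesgue_measure R).
Local Notation D f j y p := (derive1n j (fun s => P s f p) y).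

Context (al be : R).
Hypothesis be0 : 0 < 2 * be.
Hypothesis beal : 2 * be < al.
Let m := frac_order be.
Let k := lip_order al.
Let l := lip_order (al - 2 * be).

Let al0 : 0 < al. Proof. exact: lt_trans beal. Qed.

Let bem : 2 * be < m%:R.
Proof. by rewrite /m /frac_order truncnS_gt// ltW. Qed.

Let ball : al - 2 * be < l%:R.
Proof. by rewrite /l /lip_order truncnS_gt// subr_ge0 ltW. Qed.

Let kml : (k <= m + l)%N.
Proof.
rewrite /k /lip_order -ltnS ltnS truncn_lt_nat ?(ltW al0)// natrD.
by move: bem ball; lra.
Qed.

Let m0 : (0 < m)%N. Proof. by []. Qed.

(** The integrand defining the fractional power of F, as a function of the pair
    of a point and a time since Fubini needs it to be jointly measurable; the
    constant factor is left out. *)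
Definition frac_raw F (q : T * measurableTypeR R) : R :=
  fdiff_orbit P m (q.2 : R) F 0 q.1 / (q.2 : R) `^ (1 + 2 * be).

Definition frac_int F p := \int[leb]_(t in Rpos) frac_raw F (p, t).

Lemma measurable_frac_raw N F : bounded_borel N F -> measurable_fun setT (frac_raw F).
Proof.
move=> bF; apply: measurable_funM.
  have := measurable_fdiff_orbit PP m 0 0 bF.
  by under eq_fun do rewrite mul0r addr0.
under eq_fun do rewrite -powRN.
exact: (measurableT_comp (measurable_powR (- (1 + 2 * be))) measurable_snd).
Qed.

Lemma powR_div t (a b : R) : 0 < t -> t `^ a / t `^ b = t `^ (a - b).
Proof. by move=> t0; rewrite powRB// (gt_eqF t0) implybT. Qed.

(** A good representative: bounded everywhere, with the derivative bound at
    every point, and equal everywhere to its own boundary value. *)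
Definition regular N A F := [/\ 0 <= N, 0 <= A, bounded_borel N F,
  deriv_le P k al A F & forall p, P y F p @[y --> 0^'+] --> F p].

(** Near 0 the m-th difference is O(t^ga) for some ga > 2 be, at infinity it is
    bounded; both make the integrand integrable. *)
Lemma frac_raw_bound : exists C ga : R, [/\ 0 <= C, 2 * be < ga &
  forall N A F, regular N A F -> forall p t, 0 < t ->
  `|frac_raw F (p, t)| <= powR_bound (C * (N + A)) (2 ^+ m * (N + A)) (ga - 2 * be) (2 * be) 1 t].
Proof.
(* ga > 2 be gives convergence at 0, ga < m is what the difference estimate
   requires, and ga may not exceed the order al of smoothness. *)
pose ga := Num.min al ((2 * be + m%:R) / 2).
have gal : ga <= al by rewrite ge_min lexx.
have gam2 : ga <= (2 * be + m%:R) / 2 by rewrite ge_min lexx orbT.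
have gam : ga < m%:R by apply: (le_lt_trans gam2); move: bem; lra.
have bega : 2 * be < ga by rewrite lt_min beal/=; move: bem; lra.
have ga0 : 0 < ga < m%:R by rewrite gam (lt_trans be0).
have [C C0 hC] := deriv_interpolate PP k ga0 gal.
exists ((ga / m%:R)^-1 ^+ m * C), ga; split => //.
  by rewrite mulr_ge0// exprn_ge0// invr_ge0 divr_ge0// ltW//; case/andP: ga0.
move=> N A F [N0 A0 bF dF cF] p t t0.
have NA0 : 0 <= N + A by rewrite addr_ge0.
rewrite /frac_raw /= normrM (ger0_norm (_ : 0 <= _^-1)) ?invr_ge0 ?powR_ge0//.
rewrite /powR_bound; case: ifP => _.
  have B0 : 0 <= C * (N + A) by rewrite mulr_ge0.
  have := fdiff_orbit0_le PP t0 bF ga0 B0 (cF p) (hC N F A N0 bF A0 dF).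
  move=> /(ler_wpM2r (_ : 0 <= (t `^ (1 + 2 * be))^-1)) h.
  apply: le_trans (h _) _; first by rewrite invr_ge0 powR_ge0.
  rewrite -(mulrA _ (t `^ _)) powR_div// mulrA.
  by rewrite (_ : ga - (1 + 2 * be) = ga - 2 * be - 1)//; ring.
have := fdiff_orbit_le PP m p (ltW t0) (lexx 0) bF.
move=> /(ler_wpM2r (_ : 0 <= (t `^ (1 + 2 * be))^-1)) h.
apply: le_trans (h _) _; first by rewrite invr_ge0 powR_ge0.
rewrite -powRN (_ : - (1 + 2 * be) = - (2 * be) - 1); last by ring.
by rewrite ler_wpM2r ?powR_ge0// ler_wpM2l// ?exprn_ge0// lerDl.
Qed.

Lemma frac_int_bounded : exists2 C : R, 0 <= C &
  forall N A F, regular N A F ->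
  (forall p, leb.-integrable Rpos (fun t => (frac_raw F (p, t))%:E)) /\
  bounded_borel (C * (N + A)) (frac_int F).
Proof.
have [C [ga [C0 bega hC]]] := frac_raw_bound.
have p0 : 0 < ga - 2 * be by rewrite subr_gt0.
exists (C / (ga - 2 * be) + 2 ^+ m / (2 * be)).
  by rewrite addr_ge0 ?divr_ge0 ?exprn_ge0// ltW.
move=> N A F rF; have [_ _ bF _ _] := rF.
have mr p : measurable_fun Rpos (fun t => frac_raw F (p, t)).
  apply: measurable_funTS; apply: (measurableT_comp (f := frac_raw F)).
    exact: measurable_frac_raw bF.
  exact: measurable_pair1.
have main p := powR_bound_dominates p0 be0 ltr01 (mr p) (hC N A F rF p).
split=> [p|]; first exact: (main p).1.
split; last first.
  move=> p; apply: (le_trans (main p).2); rewrite !powR1 !mulr1 le_eqVlt.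
  by apply/orP; left; apply/eqP; ring.
apply: (@measurable_fun_parametric_Rintegral _ _ _ _ _ leb Rpos (frac_raw F)) => //.
exact: measurable_frac_raw bF.
Qed.

(** The semigroup passes under the integral, and shifts the base point of the
    difference from 0 to y, where the orbit is smooth. *)
Lemma semigroup_frac_int N A F y p : regular N A F -> 0 < y ->
  P y (frac_int F) p =
  \int[leb]_(t in Rpos) (fdiff m t (fun z => P z F p) y / t `^ (1 + 2 * be)).
Proof.
move=> rF y0; have [N0 A0 bF _ _] := rF.
have [C [ga [C0 bega hC]]] := frac_raw_bound.
have p0 : 0 < ga - 2 * be by rewrite subr_gt0.
have NA0 : 0 <= N + A by rewrite addr_ge0.
have a0 : 0 <= C * (N + A) by rewrite mulr_ge0.
have b0 : 0 <= 2 ^+ m * (N + A) by rewrite mulr_ge0// exprn_ge0.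
rewrite /frac_int (ss_fubini PP p y0 (measurable_frac_raw bF)
  (integrable_powR_bound a0 b0 p0 be0 ltr01) (fun q => hC N A F rF q)).
apply: eq_Rintegral => t; rewrite inE => /Rpos_gt0 t0.
have [bO PO] := fdiff_orbit_semigroup PP m (ltW t0) (lexx 0) bF.
rewrite /frac_raw/= (_ : (fun q => _) =
  fun q => (t `^ (1 + 2 * be))^-1 * fdiff_orbit P m t F 0 q); last first.
  by apply/funext => q; rewrite mulrC.
by rewrite (ss_scale PP _ _ y0 bO) PO// addr0 fdiff_orbit_gt0 ?(ltW t0)// mulrC.
Qed.

(** A bound uniform in z >= y, with constants allowed to blow up as y -> 0. It
    is the domination needed to differentiate under the integral. *)
Lemma fdiff_deriv_bound N F j y z p t : bounded_borel N F -> 0 < y -> y <= z -> 0 < t ->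
  `|fdiff m t (fun s => D F j s p) z / t `^ (1 + 2 * be)| <=
  powR_bound (`|deriv_cst K (m + j)| * N * y `^ (- (m + j)%:R))
    (2 ^+ m * (`|deriv_cst K j| * N * y `^ (- j%:R))) (m%:R - 2 * be) (2 * be) 1 t.
Proof.
move=> bF y0 yz t0; have N0 := bounded_borel_ge0 p bF.
have bd i x : y <= x -> `|D F i x p| <= `|deriv_cst K i| * N * y `^ (- i%:R).
  move=> yx; apply: (le_trans (deriv_cst_bound PP i p bF (lt_le_trans y0 yx))).
  have h : deriv_cst K i * N <= `|deriv_cst K i| * N by rewrite ler_wpM2r// ler_norm.
  apply: (le_trans (ler_wpM2r (powR_ge0 _ _) h)); rewrite ler_wpM2l// ?mulr_ge0//.
  by apply: le_powRN.
rewrite normrM (ger0_norm (_ : 0 <= _^-1)) ?invr_ge0 ?powR_ge0//.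
rewrite /powR_bound; case: ifP => _.
  set B := _ * _ * _; have B0 : 0 <= B by rewrite !mulr_ge0// powR_ge0.
  have m00 : 0 <= (0 : R) < m%:R by rewrite lexx ltr0n.
  have := @fdiff_powR_le _ (fun s => P s F p) m j t y z B 0
    (semigroup_smooth PP (p := p) bF) m0 m00 t0 y0 yz B0.
  rewrite mul0r subr0 invr1 expr1n mul1r subr0 => h.
  have {h}/(ler_wpM2r (_ : 0 <= (t `^ (1 + 2 * be))^-1)) h :
      `|fdiff m t (fun s => D F j s p) z| <= B * t `^ m%:R.
    by apply: h => x yx; rewrite oppr0 powRr0 mulr1; exact: bd.
  apply: le_trans (h _) _; first by rewrite invr_ge0 powR_ge0.
  rewrite -mulrA powR_div//.
  by rewrite (_ : m%:R - (1 + 2 * be) = m%:R - 2 * be - 1)//; ring.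
have := @fdiff_le _ m t (fun s => D F j s p) z _ (ltW t0) (fun x zx => bd j x (le_trans yz zx)).
move=> /(ler_wpM2r (_ : 0 <= (t `^ (1 + 2 * be))^-1)) h.
apply: le_trans (h _) _; first by rewrite invr_ge0 powR_ge0.
by rewrite -powRN (_ : - (1 + 2 * be) = - (2 * be) - 1)//; ring.
Qed.

Lemma measurable_fdiff_deriv N F j y p : bounded_borel N F -> 0 < y ->
  measurable_fun Rpos (fun t => fdiff m t (fun s => D F j s p) y / t `^ (1 + 2 * be)).
Proof.
move=> bF y0; apply: measurable_funM.
  have -> : (fun t => fdiff m t (fun s => D F j s p) y) =
      fun t => fdiff m t (fun s => D F j s p) (y + 0%:R * t).
    by apply/funext => t; rewrite mul0r addr0.
  apply: continuous_pos_measurable_fdiff => // z z0; apply: (@smooth_pos_continuous _ (fun s => P s F p)) => //.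
  exact: (semigroup_smooth PP (p := p) bF).
rewrite (_ : (fun x : R => (x `^ (1 + 2 * be))^-1) = fun x => x `^ (- (1 + 2 * be))).
  by apply: measurable_funTS; exact: measurable_powR.
by apply/funext => x; rewrite powRN.
Qed.

(** Differentiation under the integral on the interval (y/2, 2y), where the
    integrands are dominated by their bound at y/2. *)
Lemma deriv_frac_int N A F j y p : regular N A F -> 0 < y ->
  D (frac_int F) j y p =
  \int[leb]_(t in Rpos) (fdiff m t (fun s => D F j s p) y / t `^ (1 + 2 * be)).
Proof.
move=> rF; have [N0 A0 bF _ _] := rF.
have sm := semigroup_smooth PP (p := p) bF.
have mb : 0 < m%:R - 2 * be by rewrite subr_gt0.
elim: j y => [|j IH] y y0; first exact: semigroup_frac_int rF y0.
pose g z t := fdiff m t (fun s => D F j s p) z / t `^ (1 + 2 * be).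
have -> : D (frac_int F) j.+1 y p = derive1 (fun z => \int[leb]_(t in Rpos) g z t) y.
  rewrite derive1nS !derive1E; apply: near_eq_derive.
  by near=> z; rewrite IH//; near: z; exact: lt_nbhsr.
have dg z t : 0 < z -> 0 < t ->
    is_derive z 1 (g^~ t) (fdiff m t (fun s => D F j.+1 s p) z / t `^ (1 + 2 * be)).
  move=> z0 t0.
  have dz : is_derive z 1 (fdiff m t (derive1n j (fun s => P s F p)))
    (fdiff m t (derive1n j.+1 (fun s => P s F p)) z).
    by apply: is_derive_fdiff => //; exact: ltW.
  rewrite [X in is_derive _ _ _ X]mulrC /g.
  have -> : (fun z => fdiff m t (derive1n j (fun s => P s F p)) z / t `^ (1 + 2 * be)) =
      fun z => (t `^ (1 + 2 * be))^-1 *: fdiff m t (derive1n j (fun s => P s F p)) z.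
    by apply/funext => x; rewrite mulrC.
  exact: is_deriveZ.
have y2 : 0 < y / 2 by rewrite divr_gt0.
pose G := powR_bound (`|deriv_cst K (m + j.+1)| * N * (y / 2) `^ (- (m + j.+1)%:R))
    (2 ^+ m * (`|deriv_cst K j.+1| * N * (y / 2) `^ (- j.+1%:R))) (m%:R - 2 * be) (2 * be) 1.
have a0 : 0 <= `|deriv_cst K (m + j.+1)| * N * (y / 2) `^ (- (m + j.+1)%:R).
  by rewrite !mulr_ge0// powR_ge0.
have b0 : 0 <= 2 ^+ m * (`|deriv_cst K j.+1| * N * (y / 2) `^ (- j.+1%:R)).
  by rewrite !mulr_ge0// ?exprn_ge0// powR_ge0.
have Iy z : `]y / 2, 2 * y[%classic z -> 0 < z /\ y / 2 <= z.
  by rewrite /= in_itv/= => /andP[h _]; split; [exact: lt_trans h|exact: ltW].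
rewrite (@differentiation_under_integral _ _ _ leb g Rpos _ y (y / 2) (2 * y) _ _ _ G).
- apply: eq_Rintegral => t; rewrite inE => /Rpos_gt0 t0.
  by rewrite partial1of2E; have [] := dg y t y0 t0.
- exact: measurable_itv.
- by rewrite /= in_itv/=; apply/andP; split; lra.
- move=> z /Iy[z0 yz].
  exact: (powR_bound_dominates mb be0 ltr01 (measurable_fdiff_deriv j p bF z0)
    (fun t => fdiff_deriv_bound j p bF y2 yz)).1.
- by move=> z t /Iy[z0 yz] /Rpos_gt0 t0; have [] := dg z t z0 t0.
- by move=> t; rewrite powR_bound_ge0.
- exact: integrable_powR_bound.
- move=> z t /Iy[z0 yz] /Rpos_gt0 t0; rewrite partial1of2E.
  have [_ ->] := dg z t z0 t0.
  exact: fdiff_deriv_bound.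
Unshelve. all: by end_near. Qed.

(** The heart of the matter: the integral over t of the m-th differences is cut
    at t = y. Below y all m derivatives are spent on the step, above y only m -
    e' of them. *)
Lemma frac_int_deriv_le : exists2 C : R, 0 <= C &
  forall N A F, regular N A F -> deriv_le P l (al - 2 * be) (C * (N + A)) (frac_int F).
Proof.
have [C C0 hC] := semigroup_deriv_up PP al k (m + l - k)%N.
rewrite (subnKC kml) in hC.
pose e := (m + l)%:R - al.
have eE : (m + l)%:R = m%:R + l%:R :> R by rewrite natrD.
have e0 : 0 < e by rewrite /e eE; move: bem ball; lra.
have eb : m%:R - 2 * be < e by rewrite /e eE; move: ball; lra.
(* e' < m is what fdiff_powR_le requires, e' > m - 2 be makes the integral
   converge at infinity, and e' <= e is the decay available. *)
pose e' := Num.min e (m%:R - be).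
have ee' : e' <= e by rewrite ge_min lexx.
have e'b : m%:R - 2 * be < e' by rewrite lt_min eb/=; move: be0; lra.
have e'm : e' < m%:R.
  apply: (@le_lt_trans _ _ (m%:R - be)); first by rewrite ge_min lexx orbT.
  by move: be0; lra.
have e'0 : 0 < e' by apply: lt_trans e'b; move: bem; lra.
have q0 : 0 < 2 * be + e' - m%:R by move: e'b; lra.
have mb : 0 < m%:R - 2 * be by rewrite subr_gt0.
pose C1 := (1 - e' / m%:R)^-1 ^+ m.
have mR : 0 < m%:R :> R by rewrite ltr0n.
have C10 : 0 <= C1.
  by rewrite exprn_ge0// invr_ge0 subr_ge0 ler_pdivrMr// mul1r ltW.
pose Ct := C / (m%:R - 2 * be) + C1 * C / (2 * be + e' - m%:R).
have Ct0 : 0 <= Ct by rewrite addr_ge0 ?divr_ge0 ?mulr_ge0// ltW.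
exists Ct => // N A F rF y p y0; have [N0 A0 bF dF _] := rF.
have CA0 : 0 <= C * A by rewrite mulr_ge0.
have sm := semigroup_smooth PP (p := p) bF.
have bd x : 0 < x -> `|D F (m + l)%N x p| <= C * A * x `^ (- e).
  by move=> x0; rewrite (_ : - e = - (m + l)%:R + al);
    [exact: (hC N F A bF A0 dF)|rewrite /e; ring].
rewrite (deriv_frac_int _ _ rF y0).
apply: (@le_trans _ _ (Ct * A * y `^ (- l%:R + (al - 2 * be)))); last first.
  by rewrite ler_wpM2r ?powR_ge0// ler_wpM2l// lerDr.
have main t : 0 < t -> `|fdiff m t (fun s => D F l s p) y / t `^ (1 + 2 * be)| <=
    powR_bound (C * A * y `^ (- e)) (C1 * (C * A * y `^ (- (e - e'))))
      (m%:R - 2 * be) (2 * be + e' - m%:R) y t.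
  move=> t0; rewrite normrM (ger0_norm (_ : 0 <= _^-1)) ?invr_ge0 ?powR_ge0//.
  rewrite /powR_bound; case: ifP => _.
    have B0 : 0 <= C * A * y `^ (- e) by rewrite mulr_ge0// powR_ge0.
    have m00 : 0 <= (0 : R) < m%:R by rewrite lexx.
    have := @fdiff_powR_le _ (fun s => P s F p) m l t y y _ 0 sm m0 m00 t0 y0 (lexx _) B0.
    rewrite mul0r !subr0 invr1 expr1n mul1r => h.
    have {h}/(ler_wpM2r (_ : 0 <= (t `^ (1 + 2 * be))^-1)) h :
        `|fdiff m t (fun s => D F l s p) y| <= C * A * y `^ (- e) * t `^ m%:R.
      apply: h => x yx; rewrite oppr0 powRr0 mulr1.
      apply: (le_trans (bd x (lt_le_trans y0 yx))); rewrite ler_wpM2l//.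
      by apply: le_powRN => //; exact: ltW.
    apply: le_trans (h _) _; first by rewrite invr_ge0 powR_ge0.
    rewrite -(mulrA (_ * y `^ _)) powR_div//.
    by rewrite (_ : m%:R - (1 + 2 * be) = m%:R - 2 * be - 1)//; ring.
  have B0 : 0 <= C * A * y `^ (- (e - e')) by rewrite mulr_ge0// powR_ge0.
  have m00 : 0 <= e' < m%:R by rewrite (ltW e'0).
  have := @fdiff_powR_le _ (fun s => P s F p) m l t y y _ e' sm m0 m00 t0 y0 (lexx _) B0.
  rewrite -/C1 => h.
  have {h}/(ler_wpM2r (_ : 0 <= (t `^ (1 + 2 * be))^-1)) h :
      `|fdiff m t (fun s => D F l s p) y| <=
      C1 * (C * A * y `^ (- (e - e'))) * t `^ (m%:R - e').
    apply: h => x yx; have x0 := lt_le_trans y0 yx.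
    apply: (le_trans (bd x x0)); rewrite -[leRHS]mulrA ler_wpM2l//.
    have -> : - e = - (e - e') + - e' by ring.
    rewrite powRD; last by rewrite (gt_eqF x0) implybT.
    by rewrite ler_wpM2r ?powR_ge0//; apply: le_powRN; rewrite ?subr_ge0.
  apply: le_trans (h _) _; first by rewrite invr_ge0 powR_ge0.
  rewrite -(mulrA (C1 * _)) powR_div//.
  by rewrite (_ : m%:R - e' - (1 + 2 * be) = - (2 * be + e' - m%:R) - 1)//; ring.
apply: (le_trans (powR_bound_dominates mb q0 y0 (measurable_fdiff_deriv l p bF y0) main).2).
have yD (a b c : R) : c = a + b -> y `^ a * y `^ b = y `^ c.
  by move=> ->; rewrite powRD// (gt_eqF y0) implybT.
rewrite le_eqVlt; apply/orP; left; apply/eqP.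
set Y := y `^ (- l%:R + _).
have h1 : y `^ (- e) * y `^ (m%:R - 2 * be) = Y.
  by apply: yD; rewrite /e eE; ring.
have h2 : y `^ (- (e - e')) * y `^ (- (2 * be + e' - m%:R)) = Y.
  by apply: yD; rewrite /e eE; ring.
transitivity (C * A / (m%:R - 2 * be) * (y `^ (- e) * y `^ (m%:R - 2 * be)) +
  C1 * C * A / (2 * be + e' - m%:R) *
    (y `^ (- (e - e')) * y `^ (- (2 * be + e' - m%:R)))); first by ring.
by rewrite h1 h2 /Ct; ring.
Qed.

End fractional_power.

(** * Fractional powers between Lipschitz classes *)

Lemma derive1nZ_pos {R : realType} (c : R) (f : R -> R) j (y : R) :
  smooth_pos f -> 0 < y -> derive1n j (fun s => c * f s) y = c * derive1n j f y.
Proof.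
move=> sf; elim: j y => [//|j IH] y y0.
have h := @smooth_pos_is_derive _ f j y sf y0.
have hZ : is_derive y 1 (fun s => c *: derive1n j f s) (c *: derive1n j.+1 f y).
  exact: is_deriveZ.
rewrite derive1nS derive1E.
have -> : 'D_1 (derive1n j (fun s => c * f s)) y = 'D_1 (fun s => c *: derive1n j f s) y.
  by apply: near_eq_derive; near=> z; apply: IH; near: z; exact: lt_nbhsr.
by case: hZ.
Unshelve. all: by end_near. Qed.

Section abstract_theorem.
Context d (T : measurableType d) {R : realType}.
Implicit Types (f F : T -> R) (p : T).
Context (mu : {measure set T -> \bar R}) (P : R -> (T -> R) -> T -> R) (K : R).
Hypothesis PP : smoothing_semigroup mu P K.
Local Notation Rpos := (`]0%R, +oo[%classic : set R).
Local Notation leb := (@lebesgue_measure R).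
Local Notation D f j y p := (derive1n j (fun s => P s f p) y).

Lemma Lfun_infty f : f \in Lfun mu +oo%E ->
  measurable_fun setT f /\ exists N : R, [/\ 0 <= N,
    (Lnorm mu +oo (EFin \o f) = N%:E)%E & {ae mu, forall p, `|f p| <= N}].
Proof.
rewrite inE => /andP[]; rewrite !inE /= => mf; rewrite /finite_norm => fin.
split=> //.
have nfin : (Lnorm mu +oo (EFin \o f) \is a fin_num)%E.
  by rewrite ge0_fin_numE ?Lnorm_ge0.
exists (fine (Lnorm mu +oo (EFin \o f))); split.
- by rewrite fine_ge0 ?Lnorm_ge0.
- by rewrite fineK.
- by apply: Lnorm_infty_ae; rewrite fineK.
Qed.

Lemma lip_const_ge0 (al A : R) f : lip_const mu P al f A -> 0 <= A.
Proof.
move=> /(_ 1 ltr01); rewrite powR1 mulr1; exact: Lnorm_infty_ge0.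
Qed.

(** Two corrections on null sets: truncation makes the function bounded
    everywhere, and passing to the boundary value makes it continuous along its
    orbit. *)
Lemma Lip_representative (al A N : R) f : 0 < al -> 0 <= N -> measurable_fun setT f ->
  {ae mu, forall p, `|f p| <= N} -> lip_const mu P al f A ->
  exists2 F, regular P al N A F & {ae mu, forall p, f p = F p}.
Proof.
move=> al0 N0 mf fN hA; have A0 := lip_const_ge0 hA.
set f1 := clamp N f; have b1 : bounded_borel N f1 by exact: bounded_borel_clamp.
have ff1 := ae_clamp fN.
have P1 y p : 0 < y -> P y f p = P y f1 p.
  by move=> y0; exact: (ss_ae PP p y0 mf b1 ff1).
have d1 : deriv_le P (lip_order al) al A f1.
  apply: (ess_deriv_le PP b1) => y y0.
  rewrite (_ : (fun p => _) = fun p => (D f (lip_order al) y p)%:E); first exact: hA.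
  apply/funext => p; congr EFin; apply: derive1n_eq_pos => // z z0.
  by rewrite P1.
have [F [bF cF PF f1F]] := boundary_value PP al0 N0 b1 A0 d1.
exists F.
  split; [exact: N0|exact: A0|exact: bF| |].
    move=> y p y0; rewrite (@derive1n_eq_pos _ _ (fun s => P s f1 p) _ _ _ y0).
      exact: d1.
    by move=> z; exact: PF.
  move=> p; apply: cvg_trans (cF p); apply: near_eq_cvg.
  by near=> y; rewrite PF.
by apply: filterS2 ff1 f1F => p ->.
Unshelve. all: by end_near. Qed.

Section representative.
Context (al be A N : R) (f F : T -> R).
Hypotheses (mf : measurable_fun setT f) (rF : regular P al N A F).
Hypothesis fF : {ae mu, forall p, f p = F p}.
Let m := frac_order be.
Let c : R := (frac_const be)^-1.

Let bF : bounded_borel N F. Proof. by have [] := rF. Qed.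

(** Where f and F differ the last term is not integrable at 0. So the integral
    for f converges only almost everywhere, but the formula shows that it is
    measurable in p everywhere. *)
Lemma frac_integrandE p t : 0 < t -> frac_integrand P be f p t =
  frac_raw P be F (p, t) + (-1) ^+ m * (f p - F p) / t `^ (1 + 2 * be).
Proof.
by move=> t0; rewrite /frac_integrand (iter_ae PP _ p t0 bF mf fF) mulrDl.
Qed.

Lemma frac_integrand_eq p t : f p = F p -> 0 < t ->
  frac_integrand P be f p t = frac_raw P be F (p, t).
Proof. by move=> fp t0; rewrite frac_integrandE// fp subrr mulr0 mul0r addr0. Qed.

Lemma frac_power_eq p : f p = F p -> frac_power P be f p = c * frac_int P be F p.
Proof.
move=> fp; rewrite /frac_power; congr (_ * _).
by apply: eq_Rintegral => t; rewrite inE => /Rpos_gt0 t0; exact: frac_integrand_eq.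
Qed.

Lemma measurable_frac_power : measurable_fun setT (frac_power P be f).
Proof.
apply: measurable_funM => //.
pose H (q : T * measurableTypeR R) : R := frac_raw P be F q +
  (-1) ^+ m * (f q.1 - F q.1) / (q.2 : R) `^ (1 + 2 * be).
have -> : (fun p => \int[leb]_(t in `]0, +oo[) frac_integrand P be f p t) =
    (fun p => \int[leb]_(t in Rpos) H (p, t)).
  apply/funext => p; apply: eq_Rintegral => t; rewrite inE => /Rpos_gt0 t0.
  by rewrite frac_integrandE.
apply: (@measurable_fun_parametric_Rintegral _ _ _ _ _ leb Rpos H) => //.
apply: measurable_funD; first exact: (measurable_frac_raw PP be bF).
apply: measurable_funM.
  apply: measurable_funM => //.
  have mfF : measurable_fun setT (fun q => f q - F q).
    by apply: measurable_funB => //; have [] := bF.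
  exact: (measurableT_comp mfF measurable_fst).
under eq_fun do rewrite -powRN.
exact: (measurableT_comp (measurable_powR (- (1 + 2 * be))) measurable_snd).
Qed.

Lemma frac_power_ae : {ae mu, forall p, frac_power P be f p = c * frac_int P be F p}.
Proof. by apply: filterS fF => p; exact: frac_power_eq. Qed.

Lemma deriv_frac_power M j y p : bounded_borel M (frac_int P be F) -> 0 < y ->
  D (frac_power P be f) j y p = c * D (frac_int P be F) j y p.
Proof.
move=> bW y0.
rewrite -(derive1nZ_pos c j (semigroup_smooth PP (p := p) bW) y0).
apply: derive1n_eq_pos => // z z0.
rewrite (ss_ae PP p z0 measurable_frac_power (bounded_borelZ c bW) frac_power_ae).
exact: (ss_scale PP _ _ z0 bW).
Qed.

End representative.

Theorem frac_power_Lip (al be : R) : 0 < 2 * be -> 2 * be < al ->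
  exists2 C : R, 0 <= C & forall f, Lip mu P al f ->
    [/\ frac_power_defined mu P be f,
        Lip mu P (al - 2 * be) (frac_power P be f) &
        Lip_norm mu P (al - 2 * be) (frac_power P be f) <= C * Lip_norm mu P al f].
Proof.
move=> be0 beal; have al0 := lt_trans be0 beal.
have [C1 C10 h1] := frac_int_bounded PP be0 beal.
have [C2 C20 h2] := frac_int_deriv_le PP be0 beal.
pose c := `|(frac_const be)^-1 : R|; have c0 : 0 <= c by exact: normr_ge0.
(* The summand 1 only makes C positive, so that one may divide by it. *)
pose C := c * C1 + c * C2 + 1.
have C0 : 0 < C by rewrite ltr_wpDl// addr_ge0// mulr_ge0.
exists C; first exact: ltW.
move=> f [fL [A0 hA0]].
have [mf [N [N0 NE fN]]] := Lfun_infty fL.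
have main A : lip_const mu P al f A ->
    [/\ frac_power_defined mu P be f, measurable_fun setT (frac_power P be f),
       (Lnorm mu +oo (EFin \o frac_power P be f) <= (c * C1 * (N + A))%:E)%E &
       lip_const mu P (al - 2 * be) (frac_power P be f) (c * C2 * (N + A))].
  move=> hA; have [F rF fF] := Lip_representative al0 N0 mf fN hA.
  have A_ge0 := lip_const_ge0 hA.
  have [int_raw bW] := h1 N A F rF; have dW := h2 N A F rF.
  have NA0 : 0 <= N + A by rewrite addr_ge0.
  split.
  - apply: (filterS _ (fF)) => p fp; apply: eq_integrable (int_raw p) => //.
    move=> t; rewrite inE => /Rpos_gt0 t0 /=; congr EFin.
    by rewrite (frac_integrand_eq be mf rF fF fp t0).
  - exact: (measurable_frac_power be mf rF fF).
  - apply: Lnorm_infty_le; first by rewrite !mulr_ge0.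
    apply: filterS (frac_power_ae be mf rF fF) => p ->.
    by rewrite normrM -mulrA ler_wpM2l//; have [_] := bW; apply.
  - move=> y y0; apply: Lnorm_infty_le; first by rewrite mulr_ge0 ?powR_ge0 ?mulr_ge0.
    apply: aeW => p; rewrite (deriv_frac_power mf rF fF _ _ bW y0) normrM -!mulrA.
    by rewrite ler_wpM2l// mulrA; exact: dW.
have LipW : Lip mu P (al - 2 * be) (frac_power P be f).
  have [_ mW nW lW] := main A0 hA0; split; last by eexists; exact: lW.
  rewrite inE; apply/andP; split; rewrite !inE//=.
  by rewrite /finite_norm (le_lt_trans nW)// ltry.
split=> //; first by have [] := main A0 hA0.
have step A : lip_const mu P al f A ->
    Lip_norm mu P (al - 2 * be) (frac_power P be f) <= C * (N + A).
  move=> hA; have [_ _ nW lW] := main A hA.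
  have NA0 : 0 <= N + A by rewrite addr_ge0// (lip_const_ge0 hA).
  apply: (@le_trans _ _ ((c * C1 + c * C2) * (N + A))); last first.
    by rewrite ler_wpM2r// /C lerDl.
  rewrite [leRHS]mulrDl /Lip_norm; apply: lerD.
    have nfin : (Lnorm mu +oo (EFin \o frac_power P be f) \is a fin_num)%E.
      by rewrite ge0_fin_numE ?Lnorm_ge0// (le_lt_trans nW)// ltry.
    by rewrite -lee_fin fineK.
  apply: ge_inf => //; exists 0 => B; exact: lip_const_ge0.
(* The norm of f contains the infimum of the admissible constants A, hence the
   estimate for each A is needed. *)
rewrite {2}/Lip_norm NE /=.
rewrite -ler_pdivrMl// -lerBlDl; apply: lb_le_inf; first by exists A0.
move=> A hA; rewrite lerBlDl ler_pdivrMl//; exact: step.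
Qed.

End abstract_theorem.

(** * Reflections and translations of the line *)

Section lebesgue_translation.
Context {R : realType}.
Notation mu := (@lebesgue_measure R).
Local Open Scope ereal_scope.

(** The image measure gives every half-open interval its length, which
    characterizes Lebesgue measure. *)
Lemma lebesgue_measure_reflect (t : R) (A : set R) : measurable A ->
  pushforward mu ((fun x => t - x)%R : _ -> measurableTypeR R) A = mu A.
Proof.
have mf : measurable_fun setT ((fun x => t - x)%R : R -> measurableTypeR R).
  exact: measurable_funB.
move=> mA; apply/esym.
pose nu : {measure set (measurableTypeR R) -> \bar R} :=
  measure_function_pushforward__canonical__measure_function_Measure mu mf.
apply: (@lebesgue_measure_unique R nu) => //= _ [[a b]] _ <-.
rewrite /pushforward (_ : _ @^-1` _ = `[(t - b)%R, (t - a)%R[%classic); last first.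
  apply/seteqP; split=> x /=; rewrite !in_itv/= => /andP[h1 h2]; apply/andP; split; lra.
rewrite !lebesgue_measure_itv/= !lte_fin ltrD2l ltrN2; case: ifPn => // _.
by rewrite -!EFinD; congr EFin; ring.
Qed.

Lemma ge0_integral_reflect (t : R) (f : R -> \bar R) :
  measurable_fun setT f -> (forall x, 0 <= f x) ->
  \int[mu]_x f (t - x)%R = \int[mu]_x f x.
Proof.
move=> mf f0.
have mr : measurable_fun setT ((fun x => t - x)%R : R -> measurableTypeR R).
  exact: measurable_funB.
pose nu : {measure set (measurableTypeR R) -> \bar R} :=
  measure_function_pushforward__canonical__measure_function_Measure mu mr.
have h (A : set R) : measurable A -> A `<=` setT -> mu A = nu A.
  by move=> mA _; rewrite -(lebesgue_measure_reflect t mA).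
have -> : \int[mu]_x f x = \int[nu]_x f x by exact: eq_measure_integral.
by rewrite ge0_integral_pushforward.
Qed.

Lemma ge0_integral_translate (t : R) (f : R -> \bar R) :
  measurable_fun setT f -> (forall x, 0 <= f x) ->
  \int[mu]_x f (x - t)%R = \int[mu]_x f x.
Proof.
move=> mf f0; rewrite -(ge0_integral_reflect 0 mf f0).
rewrite -(@ge0_integral_reflect t (fun x => f (0 - x)%R))//.
  by apply: eq_integral => x _; congr f; ring.
by apply: measurableT_comp => //; exact: measurable_funB.
Qed.

End lebesgue_translation.

(** * The primitive of the Gaussian *)

Section gauss_primitive.
Context {R : realType}.
Notation mu := (@lebesgue_measure R).

(** The error function, based at -oo so that its limits are 0 and sqrt pi. *)
Definition gauss_prim (w : R) : R := \int[mu]_(x in `]-oo, w]) gauss_fun x.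

Lemma is_derive_gauss_prim (w : R) : is_derive w 1 gauss_prim (gauss_fun w).
Proof.
have [] := @continuous_FTC1 R gauss_fun -oo%O w (w + 1).
- by rewrite ltrDl.
- by apply: integrableS integrableT_gauss.
- by rewrite ltNyr.
- exact: continuous_gauss_fun.
move=> h1 h2; split; first exact: h1.
by rewrite -derive1E; exact: h2.
Qed.

Lemma gauss_primE (w : R) :
  gauss_prim w = fine (\int[mu]_x (gauss_fun x * (x <= w)%R%:R)%:E)%E.
Proof.
rewrite /gauss_prim /Rintegral integral_mkcond; congr fine; apply: eq_integral => x _.
rewrite /patch; have -> : (x \in `]-oo, w]%classic) = (x <= w).
  by rewrite mem_setE in_itv/=.
by case: ifP => _; rewrite ?mulr1 ?mulr0.
Qed.

(** Dominated convergence of the truncated Gaussians; b is the limit of the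
    truncations, true as u n -> +oo and false as u n -> -oo. *)
Lemma gauss_prim_seq (b : bool) (u : R^nat) :
  (forall x, \forall n \near \oo, (x <= u n) = b) ->
  gauss_prim (u n) @[n --> \oo] --> b%:R * Num.sqrt pi.
Proof.
move=> hu.
have mf_ n : measurable_fun setT (fun x : R => (gauss_fun x * (x <= u n)%R%:R)%:E).
  apply/measurable_EFinP; apply: measurable_funM; first exact: measurable_gauss_fun.
  have -> : (fun x : R => (x <= u n)%R%:R : R) = fun x => if x <= u n then 1 else 0.
    by apply/funext => x; case: ifP.
  by apply: measurable_fun_ifT => //; exact: measurable_fun_ler.
have lim : (\int[mu]_x (gauss_fun x * (x <= u n)%R%:R)%:E @[n --> \oo] -->
    \int[mu]_x (gauss_fun x * b%:R)%:E)%E.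
  apply: (@dominated_cvg _ _ _ mu setT _ _ _ (EFin \o gauss_fun)) => //.
  - move=> x _; apply: cvg_EFin; first exact: nearW.
    apply: cvg_near_cst; apply: filterS (hu x) => n hn.
    by congr (_ * (nat_of_bool _)%:R); exact: hn.
  - exact: integrableT_gauss.
  - move=> n x _; rewrite lee_fin normrM (ger0_norm (gauss_fun_ge0 _)).
    by case: (x <= _); rewrite ?normr1 ?normr0 ?mulr1 ?mulr0 ?gauss_fun_ge0.
have E : (\int[mu]_x (gauss_fun x * b%:R)%:E = (b%:R * Num.sqrt pi)%:E)%E.
  under eq_integral do rewrite mulrC EFinM.
  rewrite ge0_integralZl// ?integralT_gauss ?lee_fin//.
  - by apply/measurable_EFinP; exact: measurable_gauss_fun.
  - by move=> x _; rewrite lee_fin gauss_fun_ge0.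
rewrite E in lim.
by under eq_fun do rewrite gauss_primE; exact: fine_cvg.
Unshelve. all: by end_near. Qed.

Lemma gauss_prim_pinfty : gauss_prim x @[x --> +oo] --> Num.sqrt pi.
Proof.
apply/cvg_pinftyP => u cu; rewrite -[X in _ --> X]mul1r.
apply: (@gauss_prim_seq true) => x; near=> n.
have /cvgryPge/(_ x) := cu; near: n.
by have /cvgryPge/(_ x) := cu; apply: filterS => n ->.
Unshelve. all: by end_near. Qed.

Lemma gauss_prim_ninfty : gauss_prim x @[x --> -oo] --> 0.
Proof.
apply/cvg_ninftyP => u cu; rewrite -[X in _ --> X](mul0r (Num.sqrt pi)).
apply: (@gauss_prim_seq false) => x.
have /cvgrNyPlt/(_ x) := cu; apply: filterS => n xu.
by rewrite leNgt xu.
Qed.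

End gauss_primitive.

(** * The stable density of index one half *)

Section levy_density.
Context {R : realType}.
Implicit Types (s t y tau x : R).
Notation mu := (@lebesgue_measure R).
Local Notation Rpos := (`]0%R, +oo[%classic : set R).

(** The density of the time at which a Brownian motion first reaches a level
    proportional to y. It carries the subordination of the Poisson semigroup to
    the heat semigroup. *)
Definition levy y tau : R :=
  y / (2 * Num.sqrt pi) * expR (- (y ^+ 2 / (4 * tau))) / tau `^ (3 / 2).

Lemma sqrtpi_gt0 : 0 < Num.sqrt (pi : R).
Proof. by rewrite sqrtr_gt0 pi_gt0. Qed.

Lemma powR32 tau : 0 < tau -> tau `^ (3 / 2) = tau * Num.sqrt tau.
Proof.
move=> t0; have -> : 3 / 2 = 1 + 2^-1 :> R by field.
by rewrite powRD ?(gt_eqF t0) ?implybT// powRr1 ?(ltW t0)// powR12_sqrt// ltW.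
Qed.

Lemma levy_ge0 y tau : 0 <= y -> 0 <= levy y tau.
Proof.
move=> y0; rewrite /levy !mulr_ge0 ?expR_ge0 ?invr_ge0 ?powR_ge0//.
Qed.

Lemma is_derive_mul (f g : R -> R) x (a b : R) :
  is_derive x 1 f a -> is_derive x 1 g b ->
  is_derive x 1 (fun z => f z * g z) (f x * b + g x * a).
Proof. by move=> ha hb; exact: is_deriveM. Qed.

Lemma is_derive_comp1 (f g : R -> R) x (a b : R) :
  is_derive (g x) 1 f a -> is_derive x 1 g b -> is_derive x 1 (fun z => f (g z)) (a * b).
Proof. by move=> ha hb; exact: is_derive1_comp. Qed.

Lemma is_derive_inv_sqrt x : 0 < x ->
  is_derive x 1 (fun z => (Num.sqrt z)^-1) (- (2 * x * Num.sqrt x)^-1).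
Proof.
move=> x0; have s0 : 0 < Num.sqrt x by rewrite sqrtr_gt0.
have h := is_deriveV (lt0r_neq0 s0) (is_derive1_sqrt x0).
apply: is_derive_eq h _; rewrite /GRing.scale/= sqr_sqrtr ?(ltW x0)//.
by field; rewrite !gt_eqF.
Qed.

Lemma is_derive_continuous (f : R -> R) x (a : R) : is_derive x 1 f a -> {for x, continuous f}.
Proof. by move=> [h _]; apply: differentiable_continuous; exact/derivable1_diffP. Qed.

Lemma gauss_prim0 : gauss_prim (0 : R) = Num.sqrt pi / 2.
Proof.
rewrite /gauss_prim /Rintegral; have := @integral0y_gauss R.
rewrite (@ge0_integration_by_substitution0 _ (fun x => (gauss_fun x)%:E)).
- have gN x : gauss_fun (- x) = gauss_fun x by rewrite /gauss_fun sqrrN.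
  have -> : (\int[mu]_(r in `]-oo, 0%R]) (gauss_fun (- r))%:E =
      \int[mu]_(r in `]-oo, 0%R]) (gauss_fun r)%:E)%E.
    by apply: eq_integral => r _; congr EFin; exact: gN.
  by move=> ->.
- by apply/measurable_EFinP; exact: measurable_gauss_fun.
- by move=> r; rewrite lee_fin gauss_fun_ge0.
Qed.

Lemma continuous_levy y x : 0 < x -> {for x, continuous (levy y)}.
Proof.
move=> x0; rewrite /levy; apply: cvgM; [apply: cvgM; first exact: cvg_cst|].
  apply: (@continuous_comp _ _ _ (fun x => - (y ^+ 2 / (4 * x))) expR);
    last exact: continuous_expR.
  apply: cvgN.
  apply: cvgM; first exact: cvg_cst.
  apply: cvgV; first by rewrite gt_eqF// mulr_gt0.
  by apply: cvgM; [exact: cvg_cst|exact: cvg_id].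
apply: cvgV; first by rewrite gt_eqF// powR_gt0.
exact: continuous_powR.
Qed.

Lemma inv_sqrt_cvg_pinfty : (Num.sqrt x)^-1 @[x --> 0^'+] --> (+oo : set_system R).
Proof.
apply/cvgrVy; first by near=> x; rewrite sqrtr_gt0.
rewrite -[X in _ --> X]sqrtr0; apply: cvg_at_right_filter; exact: sqrt_continuous.
Unshelve. all: by end_near. Qed.

(** The substitution u = y / (2 sqrt x) turns the density into a Gaussian, so
    its primitive is a Gaussian primitive. *)
Lemma integral_levy y : 0 < y -> (\int[mu]_(x in Rpos) (levy y x)%:E = 1)%E.
Proof.
move=> y0; pose u x := - (y / 2) * (Num.sqrt x)^-1.
pose F x := 2 / Num.sqrt pi * gauss_prim (u x).
have sp := sqrtpi_gt0.
rewrite -[X in X%:E]subr0; apply: (@ge0_FTC_0y _ _ F).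
- by move=> x _; apply: levy_ge0; exact: ltW.
- by move=> x; exact: continuous_levy.
- move=> x x0; have sx : 0 < Num.sqrt x by rewrite sqrtr_gt0.
  have du : is_derive x 1 u (- (y / 2) * - (2 * x * Num.sqrt x)^-1).
    exact: (is_deriveZ (- (y / 2)) (is_derive_inv_sqrt x0)).
  have dF := is_deriveZ (2 / Num.sqrt pi) (is_derive_comp1 (is_derive_gauss_prim (u x)) du).
  apply: is_derive_eq dF _; rewrite /GRing.scale/= /gauss_fun /levy powR32//.
  have -> : - u x ^+ 2 = - (y ^+ 2 / (4 * x)).
    rewrite /u exprMn exprVn sqr_sqrtr ?(ltW x0)//; field.
    by rewrite gt_eqF.
  by field; rewrite !gt_eqF.
- rewrite -[X in _ --> X](mulr0 (2 / Num.sqrt pi)); apply: cvgM; first exact: cvg_cst.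
  apply: (@cvg_comp _ _ _ u (@gauss_prim R) _ -oo); last exact: gauss_prim_ninfty.
  have : (y / 2) * (Num.sqrt x)^-1 @[x --> 0^'+] --> (+oo : set_system R).
    by apply: gt0_cvgMry; [rewrite divr_gt0|exact: inv_sqrt_cvg_pinfty].
  have -> : u = fun x => - (y / 2 * (Num.sqrt x)^-1).
    by apply/funext => x; rewrite /u mulNr.
  by move/cvgNrNy.
- have -> : 1 = 2 / Num.sqrt pi * gauss_prim (0 : R).
    by rewrite gauss_prim0; field; rewrite gt_eqF.
  apply: cvgM; first exact: cvg_cst.
  have cg : {for (0 : R), continuous (@gauss_prim R)}.
    exact: is_derive_continuous (is_derive_gauss_prim 0).
  have h : (Num.sqrt x)^-1 @[x --> +oo] --> (0 : R).
    apply/gtr0_cvgV0; first by near=> x; rewrite sqrtr_gt0; near: x; exact: nbhs_pinfty_gt.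
    apply/cvgryPge => M; near=> x.
    have M0 : 0 <= `|M| by [].
    apply: (le_trans (ler_norm M)); rewrite -[leLHS](ger0_norm M0) -sqrtr_sqr.
    by apply: ler_wsqrtr; near: x; apply: nbhs_pinfty_ge; exact: num_real.
  have hu : u x @[x --> +oo] --> (0 : R).
    by rewrite -[X in _ --> X](mulr0 (- (y / 2))); apply: cvgM; [exact: cvg_cst|].
  exact: (@cvg_comp _ _ _ u (@gauss_prim R) _ (nbhs 0) _ hu cg).
Unshelve. all: by end_near. Qed.

Lemma cvg_pinfty_mul (F : set_system R) {FF : ProperFilter F} (f g : R -> R) (a : R) :
  0 < a -> f x @[x --> F] --> a -> g x @[x --> F] --> (+oo : set_system R) ->
  f x * g x @[x --> F] --> (+oo : set_system R).
Proof.
move=> a0 cf cg; apply/cvgryPge => M.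
have h1 : \forall x \near F, a / 2 <= f x.
  by apply: (cvgr_ge _ cf); rewrite ltr_pdivrMr// mulr_natr mulr2n ltrDl.
have h2 : \forall x \near F, `|M| / (a / 2) <= g x by move/cvgryPge : cg; apply.
have a2 : 0 < a / 2 by rewrite divr_gt0.
near=> x.
rewrite (le_trans (ler_norm M))// (@le_trans _ _ (a / 2 * (`|M| / (a / 2))))//.
  by rewrite mulrC divfK// gt_eqF.
apply: ler_pM => //; [exact: ltW|by rewrite divr_ge0// ltW|near: x; exact: h1|near: x; exact: h2].
Unshelve. all: by end_near. Qed.

(** With v = (tau - x) / x this is (s sqrt v + t / sqrt v) / (2 sqrt tau). The
    exponent s^2 / (4 x) + t^2 / (4 (tau - x)) of the convolution is equal to
    (s + t)^2 / (4 tau) + levy_arg s (- t) tau x ^+ 2, and also to (s - t)^2 /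
    (4 tau) + levy_arg s t tau x ^+ 2. *)
Definition levy_arg s t tau x : R :=
  (s * (tau - x) + t * x) / (2 * Num.sqrt tau) * (Num.sqrt (x * (tau - x)))^-1.

Lemma is_derive_levy_arg s t tau x : 0 < x < tau ->
  is_derive x 1 (levy_arg s t tau) (- (Num.sqrt tau * (s * (tau - x) - t * x)) /
     (4 * (x * (tau - x)) * Num.sqrt (x * (tau - x)))).
Proof.
move=> /andP[x0 xt]; have tau0 := lt_trans x0 xt.
have tx0 : 0 < tau - x by rewrite subr_gt0.
have Q0 : 0 < x * (tau - x) by rewrite mulr_gt0.
have dl : is_derive x 1 (fun z => tau - z) (- 1).
  by have := is_deriveB (is_derive_cst tau x 1) (is_derive_id x 1); rewrite sub0r.
have dQ : is_derive x 1 (fun z => z * (tau - z)) (tau - x - x).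
  apply: is_derive_eq (is_derive_mul (is_derive_id x 1) dl) _; ring.
have dN : is_derive x 1 (fun z => (s * (tau - z) + t * z) / (2 * Num.sqrt tau))
    ((t - s) / (2 * Num.sqrt tau)).
  have h := is_deriveD (is_deriveZ s dl) (is_deriveZ t (is_derive_id x 1)).
  have := is_derive_mul h (is_derive_cst ((2 * Num.sqrt tau)^-1) x 1).
  move=> h2; apply: is_derive_eq h2 _; rewrite /GRing.scale/=; ring.
have dS := @is_derive_comp1 (fun z => (Num.sqrt z)^-1) (fun z => z * (tau - z)) x _ _
  (is_derive_inv_sqrt Q0) dQ.
apply: is_derive_eq (is_derive_mul dN dS) _.
have q0 : 0 < Num.sqrt tau by rewrite sqrtr_gt0.
have r0 : 0 < Num.sqrt (x * (tau - x)) by rewrite sqrtr_gt0.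
have qE : tau = Num.sqrt tau ^+ 2 by rewrite sqr_sqrtr// ltW.
move: q0 r0 qE; set q := Num.sqrt tau; set r := Num.sqrt _ => q0 r0 qE.
rewrite qE in tx0 *; field.
by rewrite !gt_eqF.
Qed.

Lemma levy_argE s t tau x : 0 < x < tau ->
  levy_arg s t tau x ^+ 2 =
  (s * (tau - x) + t * x) ^+ 2 / (4 * tau * (x * (tau - x))).
Proof.
move=> /andP[x0 xt]; have tau0 := lt_trans x0 xt.
have tx0 : 0 < tau - x by rewrite subr_gt0.
have Q0 : 0 < x * (tau - x) by rewrite mulr_gt0.
rewrite /levy_arg !exprMn !exprVn exprMn !sqr_sqrtr ?(ltW tau0) ?(ltW Q0)//.
by field; rewrite !gt_eqF.
Qed.

Lemma levy_arg_cvg0 s t tau : 0 < s -> 0 < tau ->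
  levy_arg s t tau x @[x --> 0^'+] --> (+oo : set_system R).
Proof.
move=> s0 tau0; have st0 : 0 < Num.sqrt tau by rewrite sqrtr_gt0.
apply: (@cvg_pinfty_mul _ _ _ _ ((s * (tau - 0) + t * 0) / (2 * Num.sqrt tau))).
- by rewrite mulr0 addr0 subr0 divr_gt0 ?mulr_gt0.
- apply: cvg_at_right_filter; apply: cvgM; last exact: cvg_cst.
  apply: cvgD; last by apply: cvgM; [exact: cvg_cst|exact: cvg_id].
  by apply: cvgM; [exact: cvg_cst|apply: cvgB; [exact: cvg_cst|exact: cvg_id]].
- apply/cvgrVy.
    near=> x; rewrite sqrtr_gt0 mulr_gt0// subr_gt0; near: x; exact: nbhs_right_lt.
  rewrite -[X in _ --> X]sqrtr0 -[X in Num.sqrt X](mul0r (tau - 0)).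
  apply: cvg_at_right_filter.
  apply: (@continuous_comp _ _ _ (fun x => x * (tau - x)) Num.sqrt);
    last exact: sqrt_continuous.
  by apply: cvgM; [exact: cvg_id|apply: cvgB; [exact: cvg_cst|exact: cvg_id]].
Unshelve. all: by end_near. Qed.

Lemma levy_arg_cvgtau s t tau : 0 < t -> 0 < tau ->
  levy_arg s t tau x @[x --> tau^'-] --> (+oo : set_system R).
Proof.
move=> t0 tau0; have st0 : 0 < Num.sqrt tau by rewrite sqrtr_gt0.
apply: (@cvg_pinfty_mul _ _ _ _ ((s * (tau - tau) + t * tau) / (2 * Num.sqrt tau))).
- by rewrite subrr mulr0 add0r divr_gt0 ?mulr_gt0.
- apply: cvg_at_left_filter; apply: cvgM; last exact: cvg_cst.
  apply: cvgD; last by apply: cvgM; [exact: cvg_cst|exact: cvg_id].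
  by apply: cvgM; [exact: cvg_cst|apply: cvgB; [exact: cvg_cst|exact: cvg_id]].
- apply/cvgrVy.
    near=> x; rewrite sqrtr_gt0; have x0 : 0 < x by near: x; exact: nbhs_left_gt.
    have xt : x < tau by near: x; exact: nbhs_left_lt.
    by rewrite mulr_gt0// subr_gt0.
  rewrite -[X in _ --> X]sqrtr0 -[X in Num.sqrt X](mulr0 tau) -[X in tau * X](subrr tau).
  apply: cvg_at_left_filter.
  apply: (@continuous_comp _ _ _ (fun x => x * (tau - x)) Num.sqrt);
    last exact: sqrt_continuous.
  by apply: cvgM; [exact: cvg_id|apply: cvgB; [exact: cvg_cst|exact: cvg_id]].
Unshelve. all: by end_near. Qed.

Lemma levy_argN s t tau x : levy_arg (- s) (- t) tau x = - levy_arg s t tau x.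
Proof. by rewrite /levy_arg; ring. Qed.

(** Each of the two ways of completing the square leaves a Gaussian in a
    levy_arg, so Gaussian primitives are available. The derivatives of levy_arg
    s (- t) tau and levy_arg s t tau carry the weights s (tau - x) + t x and s
    (tau - x) - t x; s + t times the first minus s - t times the second is the
    constant 2 s t tau, which the integrand requires. The second argument tends
    to +oo at both ends and contributes nothing in the end; the first goes from
    +oo to -oo. *)
Lemma levy_convolution s t tau : 0 < s -> 0 < t -> 0 < tau ->
  (\int[mu]_(x in `]0%R, tau[) (levy s x * levy t (tau - x))%:E = (levy (s + t) tau)%:E)%E.
Proof.
move=> s0 t0 tau0; have sp := sqrtpi_gt0; have q0 : 0 < Num.sqrt tau by rewrite sqrtr_gt0.
pose c : R := (s + t) ^+ 2 / (4 * tau).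
pose a : R := - ((s + t) * expR (- c)) / (2 * pi * (tau * Num.sqrt tau)).
pose b : R := (s - t) * expR (- c) / (2 * pi * (tau * Num.sqrt tau)).
pose G x : R := a * gauss_prim (levy_arg s (- t) tau x) +
  b * expR (s * t / tau) * gauss_prim (levy_arg s t tau x).
have -> : levy (s + t) tau =
    (a * 0 + b * expR (s * t / tau) * Num.sqrt pi) -
    (a * Num.sqrt pi + b * expR (s * t / tau) * Num.sqrt pi).
  have piE : (pi : R) = Num.sqrt pi ^+ 2 by rewrite sqr_sqrtr// pi_ge0.
  rewrite /levy powR32// -/c /a.
  rewrite [X in 2 * X * (tau * _)]piE; field; rewrite !gt_eqF//.
apply: (@ge0_FTC_0b R (fun x => levy s x * levy t (tau - x)) G tau
  (a * Num.sqrt pi + b * expR (s * t / tau) * Num.sqrt pi)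
  (a * 0 + b * expR (s * t / tau) * Num.sqrt pi) tau0).
- by move=> x _; rewrite mulr_ge0// levy_ge0// ltW.
- move=> x /andP[x0 xt]; apply: cvgM; first exact: continuous_levy.
  apply: (@continuous_comp _ _ _ (fun x => tau - x) (levy t)).
    by apply: cvgB; [exact: cvg_cst|exact: cvg_id].
  by apply: continuous_levy; rewrite subr_gt0.
- move=> x xx; have /andP[x0 xt] := xx.
  have tx0 : 0 < tau - x by rewrite subr_gt0.
  have Q0 : 0 < x * (tau - x) by rewrite mulr_gt0.
  have dA := is_deriveZ a (@is_derive_comp1 _ (levy_arg s (- t) tau) x _ _ (is_derive_gauss_prim _) (is_derive_levy_arg s (- t) xx)).
  have dB := is_deriveZ (b * expR (s * t / tau))
    (@is_derive_comp1 _ (levy_arg s t tau) x _ _ (is_derive_gauss_prim _) (is_derive_levy_arg s t xx)).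
  apply: is_derive_eq (is_deriveD dA dB) _.
  rewrite /GRing.scale/= /gauss_fun !levy_argE//.
  set eA := expR (- ((s * (tau - x) + - t * x) ^+ 2 / _)).
  have -> : expR (- ((s * (tau - x) + t * x) ^+ 2 / (4 * tau * (x * (tau - x))))) =
      eA * expR (- (s * t / tau)).
    by rewrite /eA -expRD; congr expR; field; rewrite !gt_eqF.
  have eK : expR (s * t / tau) * expR (- (s * t / tau)) = 1.
    by rewrite -expRD subrr expR0.
  have E : expR (- (s ^+ 2 / (4 * x))) * expR (- (t ^+ 2 / (4 * (tau - x)))) = eA * expR (- c).
    by rewrite /eA /c -!expRD; congr expR; field; rewrite !gt_eqF.
  have -> : levy s x * levy t (tau - x) = s * t / (4 * pi) * (eA * expR (- c)) /
      (x * (tau - x) * Num.sqrt (x * (tau - x))).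
    rewrite -E /levy !powR32// sqrtrM ?(ltW x0)//.
    have piE : (pi : R) = Num.sqrt pi ^+ 2 by rewrite sqr_sqrtr// pi_ge0.
    rewrite [in RHS]piE; field.
    by rewrite !gt_eqF// sqrtr_gt0.
  rewrite (_ : b * expR (s * t / tau) * (eA * expR (- (s * t / tau)) * _) =
    b * (eA * (- (Num.sqrt tau * (s * (tau - x) - t * x)) /
     (4 * (x * (tau - x)) * Num.sqrt (x * (tau - x))))) *
     (expR (s * t / tau) * expR (- (s * t / tau)))); last by ring.
  rewrite eK mulr1 /a /b.
  set p := (pi : R); have p0 : 0 < p := pi_gt0 R.
  clearbody p; field.
  by rewrite !gt_eqF ?sqrtr_gt0.
- apply: cvgD.
    apply: cvgM; first exact: cvg_cst.
    apply: (@cvg_comp _ _ _ (levy_arg s (- t) tau) (@gauss_prim R) _ +oo);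
      [exact: levy_arg_cvg0|exact: gauss_prim_pinfty].
  apply: cvgM; first exact: cvg_cst.
  apply: (@cvg_comp _ _ _ (levy_arg s t tau) (@gauss_prim R) _ +oo);
    [exact: levy_arg_cvg0|exact: gauss_prim_pinfty].
- apply: cvgD.
    apply: cvgM; first exact: cvg_cst.
    apply: (@cvg_comp _ _ _ (levy_arg s (- t) tau) (@gauss_prim R) _ -oo);
      last exact: gauss_prim_ninfty.
    have h := @levy_arg_cvgtau (- s) t tau t0 tau0.
    have -> : levy_arg s (- t) tau = fun x => - levy_arg (- s) t tau x.
      by apply/funext => x; rewrite -levy_argN opprK.
    by move/cvgNrNy : h.
  apply: cvgM; first exact: cvg_cst.
  apply: (@cvg_comp _ _ _ (levy_arg s t tau) (@gauss_prim R) _ +oo);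
    [exact: levy_arg_cvgtau|exact: gauss_prim_pinfty].
Qed.

End levy_density.

(** * Hyperbolic functions *)

Section hyperbolic_theory.
Context {R : realType}.
Implicit Types s t : R.

Lemma sinhD s t : sinh (s + t) = sinh s * cosh t + cosh s * sinh t.
Proof. by rewrite /sinh /cosh opprD !expRD; field. Qed.

Lemma coshD s t : cosh (s + t) = cosh s * cosh t + sinh s * sinh t.
Proof. by rewrite /sinh /cosh opprD !expRD; field. Qed.

Lemma cosh_sqr s : cosh s ^+ 2 = 1 + sinh s ^+ 2.
Proof.
have e : expR s * expR (- s) = 1 by rewrite -expRD subrr expR0.
by rewrite -e /sinh /cosh; field.
Qed.

Lemma cosh_ge1 s : 1 <= cosh s.
Proof.
have c0 : 0 < cosh s by rewrite /cosh divr_gt0// addr_gt0 ?expR_gt0.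
rewrite -(@ler_pXn2r _ 2) ?nnegrE ?(ltW c0)// expr1n cosh_sqr lerDl.
exact: sqr_ge0.
Qed.

Lemma cosh_gt0 s : 0 < cosh s.
Proof. exact: lt_le_trans (cosh_ge1 s). Qed.

Lemma sinh_gt0 s : 0 < s -> 0 < sinh s.
Proof. by move=> s0; rewrite /sinh divr_gt0// subr_gt0 ltr_expR; lra. Qed.

Lemma sinh2 s : sinh (2 * s) = 2 * sinh s * cosh s.
Proof. by rewrite mulr_natl mulr2n sinhD; ring. Qed.

Lemma cosh2 s : cosh (2 * s) = 2 * cosh s ^+ 2 - 1.
Proof. by rewrite mulr_natl mulr2n coshD [in RHS]cosh_sqr -!expr2 cosh_sqr; ring. Qed.

Lemma cothE s : 0 < s -> coth s = (cosh (2 * s) + 1) / sinh (2 * s).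
Proof.
move=> s0; rewrite sinh2 cosh2 /coth; have := sinh_gt0 s0; have := cosh_gt0 s.
by move=> ? ?; field; rewrite !gt_eqF.
Qed.

Lemma tanhE s : 0 < s -> tanh s = (cosh (2 * s) - 1) / sinh (2 * s).
Proof.
move=> s0; rewrite sinh2 cosh2 cosh_sqr /tanh; have := sinh_gt0 s0; have := cosh_gt0 s.
by move=> ? ?; field; rewrite !gt_eqF.
Qed.

Lemma tanh_ge0 s : 0 < s -> 0 <= tanh s.
Proof. by move=> s0; rewrite divr_ge0// ltW// ?sinh_gt0// cosh_gt0. Qed.

Lemma coth_gt0 s : 0 < s -> 0 < coth s.
Proof. by move=> s0; rewrite divr_gt0// ?sinh_gt0// cosh_gt0. Qed.

Lemma continuous_sinh : continuous (@sinh R).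
Proof.
move=> x; apply: cvgM; last exact: cvg_cst.
apply: cvgB; first exact: continuous_expR.
apply: (@continuous_comp _ _ _ (fun x => - x) expR); last exact: continuous_expR.
by apply: cvgN; exact: cvg_id.
Qed.

Lemma continuous_cosh : continuous (@cosh R).
Proof.
move=> x; apply: cvgM; last exact: cvg_cst.
apply: cvgD; first exact: continuous_expR.
apply: (@continuous_comp _ _ _ (fun x => - x) expR); last exact: continuous_expR.
by apply: cvgN; exact: cvg_id.
Qed.

Lemma continuous_tanh : continuous (@tanh R).
Proof.
move=> x; apply: cvgM; first exact: continuous_sinh.
by apply: cvgV; [rewrite gt_eqF// cosh_gt0|exact: continuous_cosh].
Qed.

End hyperbolic_theory.

(** * The Mehler kernel on the line *)

Section mehler_1d.
Context {R : realType}.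
Implicit Types (s t tau a b c x y m : R).
Notation mu := (@lebesgue_measure R).

Lemma mulr2pi_gt0 x : 0 < x -> 0 < 2 * pi * x.
Proof. by move=> x0; rewrite mulr_gt0// mulr_gt0// pi_gt0. Qed.

Lemma sqrtr_div x y : 0 < x -> 0 < y -> Num.sqrt (x / y) = Num.sqrt x / Num.sqrt y.
Proof. by move=> x0 y0; rewrite (sqrtrM _ (ltW x0)) (sqrtrV (ltW y0)). Qed.

Lemma integral_gauss (k : R) m : 0 < k ->
  (\int[mu]_x (expR (- (k * (x - m) ^+ 2)))%:E = (Num.sqrt (pi / k))%:E)%E.
Proof.
move=> k0; pose sg : R := (Num.sqrt (2 * k))^-1.
have k2 : 0 < 2 * k by rewrite mulr_gt0.
have sg0 : 0 < sg by rewrite invr_gt0 sqrtr_gt0.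
have sg2 : sg ^+ 2 = (2 * k)^-1 by rewrite /sg exprVn sqr_sqrtr// ltW.
have pk : 0 < Num.sqrt (pi / k) by rewrite sqrtr_gt0 divr_gt0// pi_gt0.
have E x : expR (- (k * (x - m) ^+ 2)) = Num.sqrt (pi / k) * normal_pdf m sg x.
  rewrite /normal_pdf gt_eqF// /normal_peak /normal_fun sg2.
  have -> : (2 * k)^-1 * pi *+ 2 = pi / k :> R.
    by rewrite -mulr_natr; field; rewrite gt_eqF.
  rewrite mulVKf ?gt_eqF//; congr expR.
  by rewrite -mulr_natr; field; rewrite gt_eqF.
under eq_integral do rewrite E EFinM.
rewrite ge0_integralZl_EFin//.
- by rewrite integral_normal_pdf mule1.
- by move=> x _; rewrite lee_fin normal_pdf_ge0.
- by apply/measurable_EFinP; exact: measurable_normal_pdf.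
Qed.

Definition mehler1 tau a b : R :=
  expR (- ((a - b) ^+ 2 / 4) * coth tau) * expR (- ((a + b) ^+ 2 / 4) * tanh tau) /
  Num.sqrt (2 * pi * sinh (2 * tau)).

Lemma mehler1_ge0 tau a b : 0 <= mehler1 tau a b.
Proof. by rewrite divr_ge0// mulr_ge0 ?expR_ge0. Qed.

Lemma mehler1C tau a b : mehler1 tau a b = mehler1 tau b a.
Proof. by rewrite /mehler1 -(opprB b a) sqrrN (addrC a). Qed.

(** The double angle formulas merge the two exponentials into one quadratic
    form, the one in which squares can be completed. *)
Lemma mehler1E tau a b : 0 < tau -> mehler1 tau a b =
  expR (- (((a ^+ 2 + b ^+ 2) * cosh (2 * tau) - 2 * a * b) / (2 * sinh (2 * tau)))) /
  Num.sqrt (2 * pi * sinh (2 * tau)).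
Proof.
move=> t0; rewrite /mehler1 -expRD cothE// tanhE//; congr (expR _ / _).
have S0 : 0 < sinh (2 * tau) by rewrite sinh_gt0// mulr_gt0.
by field; rewrite gt_eqF.
Qed.

Lemma measurable_mehler1 tau a : measurable_fun setT (mehler1 tau a).
Proof.
apply: measurable_funM => //; apply: measurable_funM;
  (apply: measurableT_comp => //; apply: measurable_funM => //; apply: measurableT_comp => //;
  apply: measurable_funM => //; apply: measurable_funX).
- exact: measurable_funB.
- exact: measurable_funD.
Qed.

(** The mass of the Mehler kernel is smaller than 1 because the potential |x|^2
    kills; it tends to 1 as tau -> 0. *)
Definition mehler_mass tau a : R :=
  expR (- (a ^+ 2 * sinh (2 * tau) / (2 * cosh (2 * tau)))) / Num.sqrt (cosh (2 * tau)).

(** Completing the square in b leaves a Gaussian of rate C / (2 S) with mean a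
    / C, for C = cosh (2 tau) and S = sinh (2 tau). *)
Lemma integral_mehler1 tau a : 0 < tau ->
  (\int[mu]_b (mehler1 tau a b)%:E = (mehler_mass tau a)%:E)%E.
Proof.
move=> t0; have S0 : 0 < sinh (2 * tau) by rewrite sinh_gt0// mulr_gt0.
have C0 := cosh_gt0 (2 * tau); have CS := cosh_sqr (2 * tau).
rewrite /mehler_mass; move: S0 C0 CS (fun b => mehler1E a b t0).
set S := sinh _; set C := cosh _ => S0 C0 CS E.
pose e := expR (- (a ^+ 2 * S / (2 * C))).
pose g : R := Num.sqrt (2 * pi * S).
have p0 : 0 < (pi : R) := pi_gt0 R.
have pS := mulr2pi_gt0 S0.
have g0 : 0 < g by rewrite sqrtr_gt0.
under eq_integral => b _.
  have -> : (mehler1 tau a b) = (e / g) * expR (- (C / (2 * S) * (b - a / C) ^+ 2)).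
    rewrite E -/g [RHS]mulrAC /e -expRD; congr (expR _ / _).
    have -> : a ^+ 2 * S / (2 * C) = a ^+ 2 * (C ^+ 2 - 1) / (2 * C * S).
      by rewrite CS; field; rewrite !gt_eqF.
    by field; rewrite !gt_eqF.
  rewrite EFinM; over.
have k0 : 0 < C / (2 * S) by rewrite divr_gt0// mulr_gt0.
rewrite ge0_integralZl_EFin//.
- rewrite integral_gauss// -EFinM; congr EFin.
  have -> : pi / (C / (2 * S)) = (2 * pi * S) / C by field; rewrite !gt_eqF.
  rewrite sqrtrM ?(ltW pS)// -/g sqrtrV ?(ltW C0)//.
  by rewrite -/e; field; rewrite !gt_eqF ?sqrtr_gt0.
- apply/measurable_EFinP; apply: measurableT_comp => //; apply: measurableT_comp => //.
  apply: measurable_funM => //; apply: measurable_funX; exact: measurable_funB.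
- by apply: divr_ge0; [exact: expR_ge0|exact: ltW].
Qed.

Lemma mehler_mass_le1 tau a : 0 < tau -> mehler_mass tau a <= 1.
Proof.
move=> t0; have S0 : 0 < sinh (2 * tau) by rewrite sinh_gt0// mulr_gt0.
have C0 := cosh_gt0 (2 * tau).
rewrite ler_pdivrMr ?sqrtr_gt0// mul1r (@le_trans _ _ 1)//.
  rewrite -[leRHS]expR0 ler_expR oppr_le0; apply: divr_ge0.
    by rewrite mulr_ge0 ?sqr_ge0// ltW.
  by rewrite mulr_ge0// ltW.
by rewrite -sqrtr1 ler_wsqrtr// cosh_ge1.
Qed.

(** The product is Gaussian in b, with rate U / (2 S T), where U = sinh (2 (s +
    t)) by the addition formula; after completing the square the remaining
    exponent is that of the kernel at time s + t by cosh^2 = 1 + sinh^2. *)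
Lemma mehler1_semigroup s t a c : 0 < s -> 0 < t ->
  (\int[mu]_b (mehler1 s a b * mehler1 t b c)%:E = (mehler1 (s + t) a c)%:E)%E.
Proof.
move=> s0 t0; have st0 : 0 < s + t by rewrite addr_gt0.
have E1 b := mehler1E a b s0; have E2 b := mehler1E b c t0.
rewrite (mehler1E _ _ st0); move: E1 E2.
rewrite (mulrDr 2 s t) sinhD coshD.
have := cosh_sqr (2 * s); have := cosh_sqr (2 * t).
have S0 : 0 < sinh (2 * s) by rewrite sinh_gt0// mulr_gt0.
have T0 : 0 < sinh (2 * t) by rewrite sinh_gt0// mulr_gt0.
move: S0 T0 (cosh_gt0 (2 * s)) (cosh_gt0 (2 * t)).
set S := sinh (2 * s); set T := sinh (2 * t); set C := cosh (2 * s); set D := cosh (2 * t).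
move=> S0 T0 C0 D0 DT CS E1 E2.
pose U := S * D + C * T.
have U0 : 0 < U by rewrite addr_gt0// mulr_gt0.
have p0 : 0 < (pi : R) := pi_gt0 R.
pose e := expR (- (((a ^+ 2 + c ^+ 2) * (C * D + S * T) - 2 * a * c) / (2 * U))).
pose g : R := Num.sqrt (2 * pi * S) * Num.sqrt (2 * pi * T).
have g0 : 0 < g by rewrite mulr_gt0// sqrtr_gt0 mulr2pi_gt0.
under eq_integral => b _.
  have -> : mehler1 s a b * mehler1 t b c =
      (e / g) * expR (- (U / (2 * S * T) * (b - (a * T + c * S) / U) ^+ 2)).
    rewrite E1 E2 mulf_div -/g -expRD [RHS]mulrAC -expRD; congr (expR _ / _).
    apply: subr0_eq.
    rewrite (_ : _ - _ = - (a ^+ 2 * T ^+ 2 * (C ^+ 2 - 1 - S ^+ 2) + c ^+ 2 * S ^+ 2 * (D ^+ 2 - 1 - T ^+ 2)) / (2 * S * T * U));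
      last by rewrite /U; field; rewrite -/U !gt_eqF.
    by rewrite CS DT; field; rewrite !gt_eqF.
  rewrite EFinM; over.
have k0 : 0 < U / (2 * S * T).
  by apply: divr_gt0 => //; apply: mulr_gt0 => //; apply: mulr_gt0.
rewrite ge0_integralZl_EFin//.
- rewrite integral_gauss// -EFinM -/U -/e; congr EFin.
  have alg (p : R) : 0 < p -> p / (U / (2 * S * T)) = (2 * p * S) * (2 * p * T) / (2 * p * U).
    by move=> ?; field; rewrite !gt_eqF.
  rewrite (alg _ p0).
  have := mulr2pi_gt0 U0; have := mulr2pi_gt0 T0; have := mulr2pi_gt0 S0.
  move: g0; rewrite /g; set u := 2 * pi * S; set v := 2 * pi * T; set w := 2 * pi * U.
  move=> uv u0 v0 w0.
  rewrite (sqrtr_div (mulr_gt0 u0 v0) w0) (sqrtrM v (ltW u0)).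
  have w1 : 0 < Num.sqrt w by rewrite sqrtr_gt0.
  by rewrite -/e mulrA divfK ?gt_eqF.
- apply/measurable_EFinP; apply: measurableT_comp => //; apply: measurableT_comp => //.
  apply: measurable_funM => //; apply: measurable_funX; exact: measurable_funB.
- by apply: divr_ge0; [exact: expR_ge0|exact: ltW].
Qed.

(** Outside the ball half of the Gaussian exponent is at least r^2 coth tau /
    8, and the other half still integrates to at most 2. As exp (- u) <= 1 / u,
    the mass lost is at most 16 tanh tau / r^2. *)
Lemma integral_mehler1_near tau a (r : R) (J : set R) : 0 < tau -> 0 < r ->
  measurable J -> (forall b, `|b - a| < r -> J b) ->
  ((mehler_mass tau a - 16 * tanh tau / r ^+ 2)%:E <=
   \int[mu]_(b in J) (mehler1 tau a b)%:E)%E.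
Proof.
move=> t0 r0 mJ aJ; have mf := measurable_mehler1 tau a.
have k0 : 0 < coth tau / 8 by rewrite divr_gt0// coth_gt0.
have f0 b : (0 <= (mehler1 tau a b)%:E)%E by rewrite lee_fin mehler1_ge0.
rewrite EFinB leeBlDr// -(integral_mehler1 a t0) -(setUv J) ge0_integral_setU//=; last 3 first.
- exact: measurableC.
- by rewrite setUv; exact/measurable_EFinP.
- by rewrite disj_set2E setICr.
rewrite leeD2l//.
pose c : R := expR (- (r ^+ 2 * (coth tau / 8))) / Num.sqrt (2 * pi * sinh (2 * tau)).
have c0 : 0 <= c by rewrite divr_ge0 ?expR_ge0.
have mg : measurable_fun setT (fun b => expR (- (coth tau / 8 * (b - a) ^+ 2))).
  apply: measurableT_comp => //; apply: measurableT_comp => //.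
  apply: measurable_funM => //; apply: measurable_funX; exact: measurable_funB.
apply: (@le_trans _ _ (\int[mu]_b (c%:E * (expR (- (coth tau / 8 * (b - a) ^+ 2)))%:E))%E).
  rewrite [leLHS]integral_mkcond; apply: ge0_le_integral => //.
  - by move=> b _; rewrite /patch; case: ifP.
  - apply/(measurable_restrictT _ _).1; first exact: measurableC.
    apply: measurable_funTS; exact/measurable_EFinP.
  - by apply/measurable_EFinP; exact: measurable_funM.
  move=> b _; rewrite /patch; case: ifPn => [|_]; last by rewrite mule_ge0 ?lee_fin ?expR_ge0.
  rewrite inE /= => Jb; have rb : r <= `|b - a| by rewrite leNgt; apply/negP => /aJ.
  rewrite -EFinM lee_fin /mehler1 /c [leRHS]mulrAC ler_wpM2r ?invr_ge0// -!expRD ler_expR.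
  have rb2 : r ^+ 2 <= (b - a) ^+ 2 by rewrite -(real_normK (num_real (b - a))) ler_pXn2r// nnegrE ltW.
  have h1 : r ^+ 2 * (coth tau / 8) <= (b - a) ^+ 2 * (coth tau / 8) by rewrite ler_wpM2r// ltW.
  have h2 : 0 <= (a + b) ^+ 2 / 4 * tanh tau by rewrite mulr_ge0 ?tanh_ge0// divr_ge0// sqr_ge0.
  rewrite -(opprB b a) sqrrN; move: h1 h2.
  set u := (b - a) ^+ 2; set k := coth tau; set v := (a + b) ^+ 2 / 4 * tanh tau.
  by rewrite !mulNr -/v; lra.
rewrite ge0_integralZl_EFin//; last exact/measurable_EFinP.
rewrite integral_gauss// -EFinM lee_fin /c.
have S0 : 0 < sinh (2 * tau) by rewrite sinh_gt0// mulr_gt0.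
have K0 := coth_gt0 t0; have p0 : 0 < (pi : R) := pi_gt0 R.
have th : tanh tau = (coth tau)^-1 by rewrite /tanh /coth [RHS]invf_div.
have q0 := mulr2pi_gt0 S0.
have pk0 : 0 < pi / (coth tau / 8) by rewrite divr_gt0.
rewrite (mulrAC (expR _)) -[leLHS]mulrA -(sqrtr_div pk0 q0).
have sq2 : Num.sqrt (pi / (coth tau / 8) * (2 * pi * sinh (2 * tau))^-1) <= 2.
  rewrite -[leRHS]ger0_norm// -sqrtr_sqr ler_wsqrtr//.
  have alg (p : R) : 0 < p ->
      p / (coth tau / 8) * (2 * p * sinh (2 * tau))^-1 = 4 / (coth tau * sinh (2 * tau)).
    by move=> ?; field; rewrite !gt_eqF.
  rewrite (alg _ p0).
  rewrite (ler_pdivrMr _ _ (mulr_gt0 K0 S0)) (cothE t0) divfK ?gt_eqF//.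
  by have := cosh_ge1 (2 * tau); lra.
apply: (@le_trans _ _ (2 * (r ^+ 2 * (coth tau / 8))^-1)).
  rewrite [leRHS]mulrC; apply: ler_pM; rewrite ?expR_ge0//.
  have rk0 : 0 < r ^+ 2 * (coth tau / 8) by rewrite (mulr_gt0 _ k0)// exprn_gt0.
  rewrite expRN lef_pV2 ?posrE ?expR_gt0//.
  by apply: le_trans (expR_ge1Dx _); rewrite lerDr.
rewrite th le_eqVlt; apply/orP; left; apply/eqP; field.
by rewrite !gt_eqF.
Qed.

Lemma cvg_mehler1_near a (J : set R) : open J -> J a ->
  fine (\int[mu]_(b in J) (mehler1 tau a b)%:E) @[tau --> 0^'+] --> (1 : R).
Proof.
move=> oJ Ja; have mJ : measurable J by exact: open_measurable.
have [r /= r0 ra] : nbhs_ball a J by apply/nbhs_ballP; exact: open_nbhs_nbhs.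
have aJ b : `|b - a| < r -> J b.
  by move=> ?; apply: ra; rewrite /ball/= distrC.
have int tau : 0 < tau ->
    (\int[mu]_(b in J) (mehler1 tau a b)%:E <= (mehler_mass tau a)%:E)%E.
  move=> t0; rewrite -integral_mehler1//; apply: ge0_subset_integral => //.
    by apply/measurable_EFinP; exact: measurable_mehler1.
  by move=> x _; rewrite lee_fin mehler1_ge0.
have int0 tau : (0 <= \int[mu]_(b in J) (mehler1 tau a b)%:E)%E.
  by apply: integral_ge0 => x _; rewrite lee_fin mehler1_ge0.
have cm : mehler_mass tau a @[tau --> 0^'+] --> (1 : R).
  have c2 : {for (0 : R), continuous (fun tau : R => 2 * tau)}.
    by apply: cvgM; [exact: cvg_cst|exact: cvg_id].
  have cs : {for (0 : R), continuous (fun tau : R => sinh (2 * tau))}.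
    exact: (continuous_comp c2 (@continuous_sinh R _)).
  have cc : {for (0 : R), continuous (fun tau : R => cosh (2 * tau))}.
    exact: (continuous_comp c2 (@continuous_cosh R _)).
  have -> : 1 = mehler_mass 0 a.
    rewrite /mehler_mass /sinh /cosh mulr0 oppr0 expR0 subrr mul0r mulr0 mul0r oppr0 expR0.
    by rewrite (_ : (1 + 1) / 2 = 1) ?sqrtr1 ?divr1//; field.
  apply: cvg_at_right_filter; apply: cvgM.
    apply: (@continuous_comp _ _ _ (fun tau : R => - (a ^+ 2 * sinh (2 * tau) / (2 * cosh (2 * tau)))) expR);
      last exact: continuous_expR.
    apply: cvgN; apply: cvgM; first by apply: cvgM; [exact: cvg_cst|exact: cs].
    apply: cvgV; first by rewrite gt_eqF// mulr_gt0// cosh_gt0.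
    by apply: cvgM; [exact: cvg_cst|exact: cc].
  apply: cvgV; first by rewrite gt_eqF// sqrtr_gt0 cosh_gt0.
  exact: (continuous_comp cc (@sqrt_continuous R _)).
apply: (@squeeze_cvgr _ _ _ _ (fun tau => mehler_mass tau a - 16 * tanh tau / r ^+ 2)
  (mehler_mass ^~ a)) => //.
  near=> tau; have t0 : 0 < tau by near: tau; exact: nbhs_right_gt.
  have f : (\int[mu]_(b in J) (mehler1 tau a b)%:E \is a fin_num)%E.
    by rewrite ge0_fin_numE// (le_lt_trans (int _ t0))// ltry.
  by rewrite -!lee_fin fineK// int// integral_mehler1_near.
rewrite -[X in _ --> X]subr0; apply: cvgB => //.
rewrite -[X in _ --> X](mul0r ((r ^+ 2)^-1)); apply: cvgM; last exact: cvg_cst.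
rewrite -[X in _ --> X](mulr0 16); apply: cvgM; first exact: cvg_cst.
have th0 : tanh 0 = 0 :> R by rewrite /tanh /sinh oppr0 subrr !mul0r.
by rewrite -[X in _ --> X]th0; apply: cvg_at_right_filter; exact: continuous_tanh.
Unshelve. all: by end_near. Qed.

End mehler_1d.

(** * Integrals of products over R^n *)

Section lebesgue_Rn_integrals.
Context {R : realType}.
Local Open Scope ereal_scope.

Lemma ge0_integral_lebesgue_RnS n (f : Rn R n.+1 -> \bar R) :
  measurable_fun setT f -> (forall z, 0 <= f z) ->
  \int[lebesgue_Rn R n.+1]_z f z =
  \int[lebesgue_measure]_a \int[lebesgue_Rn R n]_z f (Rn_cons (a, z)).
Proof.
move=> mf f0; rewrite (ge0_integral_pushforward (@measurable_Rn_cons R n))//.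
rewrite preimage_setT (fubini_tonelli1 (f \o @Rn_cons R n))//.
  by apply: measurableT_comp => //; exact: measurable_Rn_cons.
by move=> p; exact: f0.
Qed.

Lemma measurable_comp_tnth n (i : 'I_n) (g : R -> R) : measurable_fun setT g ->
  measurable_fun setT (fun z : Rn R n => g (tnth z i)).
Proof. by move=> mg; exact: (measurableT_comp mg (measurable_tnth i)). Qed.

Lemma ge0_integral_lebesgue_Rn_prod n (g : 'I_n -> R -> R) :
  (forall i, measurable_fun setT (g i)) -> (forall i a, (0 <= g i a)%R) ->
  \int[lebesgue_Rn R n]_z (\prod_i g i (tnth z i))%:E =
  \prod_i \int[lebesgue_measure]_a (g i a)%:E.
Proof.
elim: n g => [|n IH] g mg g0.
  rewrite big_ord0 -[RHS](_ : \int[\d_ ([tuple] : Rn R 0)]_z 1 = 1); last first.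
    by rewrite integral_cst//= diracE mem_setT mule1.
  by apply: eq_integral => z _; rewrite big_ord0.
rewrite ge0_integral_lebesgue_RnS; last 2 first.
- apply/measurable_EFinP; apply: measurable_prod => i _.
  exact: measurable_comp_tnth.
- by move=> z; rewrite lee_fin prodr_ge0.
pose B := \prod_(i < n) \int[lebesgue_measure]_a (g (lift ord0 i) a)%:E.
have mB : measurable_fun setT (fun z : Rn R n => \prod_(i < n) g (lift ord0 i) (tnth z i))%R.
  by apply: measurable_prod => i _; exact: measurable_comp_tnth.
under eq_integral => a _.
  rewrite (_ : (\int[lebesgue_Rn R n]_z _) = (g ord0 a)%:E * B); last first.
    rewrite /B -IH// -ge0_integralZl_EFin//.
    - apply: eq_integral => z _; rewrite -EFinM big_ord_recl tnth0; congr (_ * _)%:E%R.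
      by apply: eq_bigr => i _; rewrite tnthS.
    - by move=> z _; rewrite lee_fin prodr_ge0.
    - by apply/measurable_EFinP; exact: mB.
  over.
rewrite big_ord_recl -/B ge0_integralZr//.
- by apply/measurable_EFinP; exact: mg.
- by move=> a _; rewrite lee_fin.
- by rewrite /B; apply: prode_ge0 => i _; apply: integral_ge0 => a _; rewrite lee_fin.
Qed.

Lemma prod_EFin n (u : 'I_n -> R) : \prod_i (u i)%:E = (\prod_i u i)%:E.
Proof. by elim/big_rec2 : _ => // i x y _ ->; rewrite EFinM. Qed.

End lebesgue_Rn_integrals.

(** * The Mehler kernel on R^n *)

Section mehler_nd.
Context {R : realType} (n : nat).
Implicit Types (x z : Rn R n) (s t tau : R).
Notation mun := (lebesgue_Rn R n).

Lemma mehler_kernel_prod tau x z : 0 < tau ->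
  mehler_kernel tau x z = \prod_i mehler1 tau (tnth x i) (tnth z i).
Proof.
move=> t0; rewrite /mehler_kernel /mehler1 2!big_split/= -2!expR_sum prodr_const card_ord.
congr (_ * _ * _).
- by congr expR; rewrite mulr_suml -sumrN mulr_suml.
- by congr expR; rewrite mulr_suml -sumrN mulr_suml.
have p0 : 0 < 2 * pi * sinh (2 * tau) by rewrite mulr2pi_gt0// sinh_gt0// mulr_gt0.
rewrite exprVn -powR12_sqrt ?(ltW p0)// -powR_mulrn ?powR_ge0// -powRrM.
by rewrite (mulrC 2^-1).
Qed.

Lemma mehler_kernel_ge0 tau x z : 0 <= mehler_kernel tau x z.
Proof. by rewrite divr_ge0 ?mulr_ge0 ?expR_ge0// powR_ge0. Qed.

Lemma mehler_kernelC tau x z : mehler_kernel tau x z = mehler_kernel tau z x.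
Proof.
have Em : \sum_(i < n) (tnth x i - tnth z i) ^+ 2 = \sum_(i < n) (tnth z i - tnth x i) ^+ 2.
  by apply: eq_bigr => i _; rewrite -(opprB (tnth z i)) sqrrN.
have Ep : \sum_(i < n) (tnth x i + tnth z i) ^+ 2 = \sum_(i < n) (tnth z i + tnth x i) ^+ 2.
  by apply: eq_bigr => i _; rewrite addrC.
by rewrite /mehler_kernel Em Ep.
Qed.

Lemma measurable_mehler_kernel tau x : 0 < tau ->
  measurable_fun setT (mehler_kernel tau x).
Proof.
move=> t0; apply: (eq_measurable_fun (fun z => \prod_i mehler1 tau (tnth x i) (tnth z i))).
  by move=> z _; rewrite mehler_kernel_prod.
apply: measurable_prod => i _; apply: measurable_comp_tnth; exact: measurable_mehler1.
Qed.

Lemma integral_mehler_kernel_le1 tau x : 0 < tau ->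
  (\int[mun]_z (mehler_kernel tau x z)%:E <= 1)%E.
Proof.
move=> t0; under eq_integral do rewrite mehler_kernel_prod//.
rewrite (ge0_integral_lebesgue_Rn_prod (g := fun i => mehler1 tau (tnth x i))).
- under eq_bigr do rewrite integral_mehler1//.
  rewrite prod_EFin lee_fin; apply: prodr_ile1 => i _.
  by rewrite mehler_mass_le1// andbT /mehler_mass divr_ge0 ?expR_ge0.
- by move=> i; exact: measurable_mehler1.
- by move=> i a; exact: mehler1_ge0.
Qed.

Lemma mehler_kernel_semigroup s t x z : 0 < s -> 0 < t ->
  (\int[mun]_w (mehler_kernel s x w * mehler_kernel t w z)%:E =
   (mehler_kernel (s + t) x z)%:E)%E.
Proof.
move=> s0 t0; rewrite mehler_kernel_prod ?addr_gt0// -prod_EFin.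
under eq_bigr do rewrite -mehler1_semigroup//.
rewrite -(ge0_integral_lebesgue_Rn_prod
  (g := fun i b => mehler1 s (tnth x i) b * mehler1 t b (tnth z i))).
- apply: eq_integral => w _; rewrite (mehler_kernel_prod _ _ s0) (mehler_kernel_prod _ _ t0).
  by rewrite -big_split.
- move=> i; apply: measurable_funM; first exact: measurable_mehler1.
  by under eq_fun do rewrite mehler1C; exact: measurable_mehler1.
- by move=> i a; rewrite mulr_ge0// mehler1_ge0.
Qed.

(** On a box the mass is the product of the masses on the sides, which tend to
    1. *)
Lemma cvg_mehler_kernel_box x (J : 'I_n -> set R) :
  (forall i, open (J i)) -> (forall i, J i (tnth x i)) ->
  fine (\int[mun]_(z in [set z | forall i, J i (tnth z i)]) (mehler_kernel tau x z)%:E)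
    @[tau --> 0^'+] --> (1 : R).
Proof.
move=> oJ Jx.
pose B := [set z : Rn R n | forall i, J i (tnth z i)]; rewrite -/B.
have mJ i : measurable (J i) by exact: open_measurable.
pose m i tau := fine (\int[lebesgue_measure]_(b in J i) (mehler1 tau (tnth x i) b)%:E).
have cm : \prod_i m i tau @[tau --> 0^'+] --> (1 : R).
  elim: (index_enum 'I_n) => [|i l IH].
    by under eq_fun do rewrite big_nil; exact: cvg_cst.
  have -> : (fun tau => \prod_(j <- i :: l) m j tau) =
      (fun tau => m i tau * \prod_(j <- l) m j tau).
    by apply/funext => tau; rewrite big_cons.
  by rewrite -[X in _ --> X](mul1r 1); apply: cvgM => //; exact: cvg_mehler1_near.
apply: cvg_trans cm; apply: near_eq_cvg; near=> tau.
have t0 : 0 < tau by near: tau; exact: nbhs_right_gt.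
have fin i : (\int[lebesgue_measure]_(b in J i) (mehler1 tau (tnth x i) b)%:E \is a fin_num)%E.
  rewrite ge0_fin_numE; last by apply: integral_ge0 => b _; rewrite lee_fin mehler1_ge0.
  apply: (@le_lt_trans _ _ (mehler_mass tau (tnth x i))%:E); last by rewrite ltry.
  rewrite -integral_mehler1//; apply: ge0_subset_integral => //.
  - exact: mJ.
  - by apply/measurable_EFinP; exact: measurable_mehler1.
  by move=> b _; rewrite lee_fin mehler1_ge0.
apply: EFin_inj; rewrite /m -prod_EFin; under eq_bigr do rewrite fineK// integral_mkcond.
transitivity (\prod_(i < n) \int[lebesgue_measure]_b
    (mehler1 tau (tnth x i) b * \1_(J i) b)%:E)%E.
  apply: eq_bigr => i _; apply: eq_integral => b _.
  by rewrite /patch indicE; case: (b \in J i); rewrite ?mulr1 ?mulr0.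
rewrite -(ge0_integral_lebesgue_Rn_prod
  (g := fun i b => mehler1 tau (tnth x i) b * \1_(J i) b)); last 2 first.
- move=> i; apply: measurable_funM; first exact: measurable_mehler1.
  exact: measurable_indic.
- by move=> i b; rewrite mulr_ge0 ?mehler1_ge0// indicE.
have -> : (\int[mun]_(z in B) (mehler_kernel tau x z)%:E =
    \int[mun]_z (\prod_i (mehler1 tau (tnth x i) (tnth z i) * \1_(J i) (tnth z i)))%:E)%E.
  rewrite integral_mkcond; apply: eq_integral => z _.
  rewrite big_split/= -mehler_kernel_prod// /patch; case: ifPn => [|].
    by rewrite inE => Bz; rewrite big1 ?mulr1// => i _; rewrite indicE mem_set.
  move=> /negP; rewrite inE => /existsNP[i Jz].
  by rewrite (bigD1 i)//= indicE memNset// mul0r mulr0.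
rewrite fineK// ge0_fin_numE; last first.
  apply: integral_ge0 => z _; rewrite lee_fin prodr_ge0// => i _.
  by rewrite mulr_ge0 ?mehler1_ge0.
apply: le_lt_trans (ltry 1); apply: le_trans (integral_mehler_kernel_le1 x t0).
apply: ge0_le_integral => //.
- move=> z _; rewrite lee_fin prodr_ge0// => i _.
  by rewrite mulr_ge0 ?mehler1_ge0.
- apply/measurable_EFinP; apply: measurable_prod => i _; apply: measurable_funM.
    by apply: measurable_comp_tnth; exact: measurable_mehler1.
  by apply: measurable_comp_tnth; exact: measurable_indic.
- by apply/measurable_EFinP; exact: measurable_mehler_kernel.
move=> z _; rewrite lee_fin mehler_kernel_prod//; apply: ler_prod => i _.
rewrite mulr_ge0 ?mehler1_ge0//= -[leRHS]mulr1 ler_wpM2l ?mehler1_ge0//.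
Unshelve. all: by end_near. Qed.

End mehler_nd.

(** * Fubini for real-valued integrals *)

Section Rintegral_fubini.
Local Open Scope ereal_scope.
Context d1 d2 (T1 : measurableType d1) (T2 : measurableType d2) {R : realType}.
Variables (m1 : {sigma_finite_measure set T1 -> \bar R})
  (m2 : {sigma_finite_measure set T2 -> \bar R}).

Lemma Rintegral_prod (f : T1 * T2 -> R) : (m1 \x m2).-integrable setT (EFin \o f) ->
  (\int[m1 \x m2]_u f u = \int[m1]_x (\int[m2]_y f (x, y)))%R.
Proof.
move=> intf; have mF := measurable_fubini_F intf.
rewrite /Rintegral -(integral12_prod_meas1 intf); congr fine.
apply: ae_eq_integral => //.
  by apply/measurable_EFinP; exact: (measurableT_comp (f := fine)).
have := integrable_ae measurableT (integrable_fubini_F intf).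
by apply: filterS => x + _ => /(_ I)/fineK.
Qed.

(** Inner integrals are finite almost everywhere, so the values given by fine
    to the infinite ones do not matter. *)
Lemma Rintegral_exchange (f : T1 * T2 -> R) : measurable_fun setT f ->
  \int[m1]_x \int[m2]_y `|f (x, y)|%:E < +oo ->
  (\int[m1]_x (\int[m2]_y f (x, y)) = \int[m2]_y (\int[m1]_x f (x, y)))%R.
Proof.
move=> mf foo; have mf' : measurable_fun setT (EFin \o f) by exact/measurable_EFinP.
have intf : (m1 \x m2).-integrable setT (EFin \o f).
  exact: ((integrable12ltyP m1 m2 mf').2 foo).
have e2 : \int[m2]_y (\int[m1]_x f (x, y))%R%:E = \int[m2]_y \int[m1]_x (f (x, y))%:E.
  have mG := measurable_fubini_G intf.
  apply: ae_eq_integral => //.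
    apply/measurable_EFinP; exact: (measurableT_comp (f := fine)).
  pose f' (u : T2 * T1) := f (u.2, u.1).
  have mfs : measurable_fun setT (EFin \o f').
    apply/measurable_EFinP; apply: (measurableT_comp mf).
    by apply/measurable_fun_pair.
  have intf' := (integrable12ltyP m2 m1 mfs).2 ((integrable21ltyP m1 m2 mf').1 intf).
  have := integrable_ae measurableT (integrable_fubini_F intf').
  by apply: filterS => x + _ => /(_ I)/fineK.
by rewrite -Rintegral_prod// /Rintegral e2 -(Fubini intf) (integral12_prod_meas1 intf).
Qed.

End Rintegral_fubini.

(** * Functions determined by their integrals over a pi-system *)

Section density_measure.
Local Open Scope ereal_scope.
Context d (T : measurableType d) {R : realType} (mu : {measure set T -> \bar R}).

Definition density_measure (f : T -> R) (mf : measurable_fun setT f)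
  (f0 : forall x, (0 <= f x)%R) (A : set T) : \bar R := \int[mu]_(x in A) (f x)%:E.

Variables (f : T -> R) (mf : measurable_fun setT f) (f0 : forall x, (0 <= f x)%R).

Let density0 : density_measure mf f0 set0 = 0.
Proof. by rewrite /density_measure integral_set0. Qed.

Let density_ge0 A : 0 <= density_measure mf f0 A.
Proof. by apply: integral_ge0 => x _; rewrite lee_fin. Qed.

Let density_additive : semi_sigma_additive (density_measure mf f0).
Proof.
move=> F mF tF mUF; rewrite /density_measure ge0_integral_bigcup//.
- by apply: is_cvg_nneseries => n _ _; exact: density_ge0.
- by apply/measurable_EFinP; exact: measurable_funTS.
- by move=> x _; rewrite lee_fin.
Qed.

HB.instance Definition _ := isMeasure.Build _ _ _ (density_measure mf f0)
  density0 density_ge0 density_additive.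

End density_measure.

Section zero_integrals.
Context d (T : measurableType d) {R : realType} (mu : {measure set T -> \bar R}).
Local Open Scope ereal_scope.

(** The measures with densities the positive and the negative parts of h agree
    on a generating pi-system, hence everywhere, so the two parts are equal
    almost everywhere. *)
Lemma ae_eq0_of_integrals (G : set (set T)) (g : (set T)^nat) M (h : T -> R) :
  measurable = <<s G >> -> setI_closed G -> (forall i, G (g i)) ->
  \bigcup_i g i = setT -> (forall A, G A -> mu A < +oo) ->
  bounded_borel M h -> (forall A, G A -> (\int[mu]_(x in A) h x = 0)%R) ->
  {ae mu, forall x, h x = 0%R}.
Proof.
move=> mG GI Gg gT Goo [mh hM] h0.
have mGA A : G A -> measurable A by rewrite mG; exact: sub_sigma_algebra.
have inth A : G A -> mu.-integrable A (EFin \o h).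
  move=> GA; apply: measurable_bounded_integrable => //.
  - exact: mGA.
  - exact: Goo.
  - exact: measurable_funTS.
  exists M; split; first exact: num_real.
  by move=> r Mr x _ /=; rewrite (le_trans (hM x))// ltW.
pose hp x := Num.max (h x) 0%R; pose hn x := Num.max (- h x)%R 0%R.
have mp : measurable_fun setT hp by exact: measurable_maxr.
have mn : measurable_fun setT hn by apply: measurable_maxr => //; exact: measurableT_comp.
have p0 x : (0 <= hp x)%R by rewrite le_max lexx orbT.
have n0 x : (0 <= hn x)%R by rewrite le_max lexx orbT.
pose m1 : {measure set T -> \bar R} := density_measure mu mp p0.
pose m2 : {measure set T -> \bar R} := density_measure mu mn n0.
have intp A : G A -> mu.-integrable A (EFin \o hp).
  by move=> GA; have := integrable_funrpos (mGA _ GA) (inth _ GA).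
have intn A : G A -> mu.-integrable A (EFin \o hn).
  by move=> GA; have := integrable_funrneg (mGA _ GA) (inth _ GA).
have hpn x : h x = (hp x - hn x)%R.
  rewrite /hp /hn; case: (leP 0%R (h x)) => hx.
    by rewrite max_r ?oppr_le0// subr0.
  by rewrite max_l ?oppr_ge0 ?ltW//; rewrite sub0r opprK.
have m12 A : measurable A -> m1 A = m2 A.
  apply: (measure_unique G g) => //.
    move=> B GB; have mB := mGA _ GB.
    have := h0 B GB; have -> : (\int[mu]_(x in B) h x = \int[mu]_(x in B) (hp x - hn x))%R.
      by apply: eq_Rintegral => x _; rewrite hpn.
    rewrite RintegralB; [|exact: mB|exact: intp|exact: intn].
    move=> /subr0_eq E; rewrite /m1 /m2 /= /density_measure.
    rewrite -[LHS]fineK; last by have := integrable_fin_num mB (intp _ GB).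
    rewrite -[RHS]fineK; last by have := integrable_fin_num mB (intn _ GB).
    by congr EFin; exact: E.
  move=> i; have mB := mGA _ (Gg i).
  have := integrable_fin_num mB (intp _ (Gg i)).
  by rewrite ge0_fin_numE; [|exact: (measure_ge0 m1)].
have piece i : ae_eq mu (g i) (EFin \o hp) (EFin \o hn).
  apply: integral_ae_eq; [exact: mGA|exact: intp| |].
    by apply/measurable_EFinP; exact: measurable_funTS.
  by move=> E _ mE; exact: m12.
have all_pieces : {ae mu, forall x, forall i, g i x -> (hp x)%:E = (hn x)%:E}.
  have := @ae_foralln _ T R mu (fun i x => g i x -> (hp x)%:E = (hn x)%:E).
  by apply => i; exact: piece.
apply: filterS all_pieces => x hx.
have [i _ gx] : (\bigcup_i g i) x by rewrite gT.
by have [e] := hx i gx; rewrite hpn e subrr.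
Qed.

End zero_integrals.

(** * Semigroups of integral operators *)

Section kernel_semigroup.
Context d (T : measurableType d) {R : realType}.
Local Notation Rpos := (`]0%R, +oo[%classic : set R).

(** The mass bounds in both variables express the contraction on L^oo and on
    L^1. In pk_deriv_le the bound holds for all y >= a at once, so that it
    dominates in a neighbourhood of y; with a = y it gives the order 1/y of
    smoothing. In pk_concentrate the class G is a pi-system which generates the
    sigma-algebra and over whose members almost all the mass of the kernel
    lies, as y -> 0, once the pole is inside. *)
Record poisson_kernel (mu : {measure set T -> \bar R}) (k : R -> T -> T -> R)
    (K : R) : Prop := PoissonKernel {
  pk_cst_ge0 : 0 <= K ;
  pk_ge0 : forall y p q, 0 < y -> 0 <= k y p q ;
  pk_measurable : forall y, 0 < y ->
    measurable_fun setT (fun u : T * T => k y u.1 u.2) ;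
  pk_mass : forall y p, 0 < y -> (\int[mu]_q (k y p q)%:E <= 1)%E ;
  pk_dual_mass : forall y q, 0 < y -> (\int[mu]_p (k y p q)%:E <= 1)%E ;
  pk_chapman : forall s t p q, 0 < s -> 0 < t ->
    (\int[mu]_r (k s p r * k t r q)%:E = (k (s + t) p q)%:E)%E ;
  pk_derivable : forall y p q, 0 < y -> derivable (fun s => k s p q) y 1 ;
  pk_deriv_le : forall a y p q, 0 < a -> a <= y ->
    `|derive1 (fun s => k s p q) y| <= K / a * k (a / 2) p q ;
  pk_concentrate : exists G : set (set T), exists g : (set T)^nat,
    [/\ measurable = <<s G >>, setI_closed G, (forall i, G (g i)),
       \bigcup_i g i = setT & forall A, G A -> (mu A < +oo)%E /\ forall p, A p ->
       fine (\int[mu]_(q in A) (k n.+1%:R^-1 p q)%:E) @[n --> \oo] --> (1 : R)] }.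

Context (mu : {sigma_finite_measure set T -> \bar R}) (k : R -> T -> T -> R) (K : R).
Hypothesis PK : poisson_kernel mu k K.
Implicit Types (f g h : T -> R) (M s t y : R) (p q : T).

Definition kernel_op y f p : R := \int[mu]_q (k y p q * f q).

Lemma measurable_kernel_r y p : 0 < y -> measurable_fun setT (k y p).
Proof.
by move=> y0; exact: (measurableT_comp (pk_measurable PK y0) (measurable_pair1 p)).
Qed.

Lemma measurable_kernel_l y q : 0 < y -> measurable_fun setT (fun p => k y p q).
Proof.
by move=> y0; exact: (measurableT_comp (pk_measurable PK y0) (measurable_pair2 q)).
Qed.

Lemma integrable_kernel y p : 0 < y -> mu.-integrable setT (EFin \o k y p).
Proof.
move=> y0; apply/integrableP; split.
  by apply/measurable_EFinP; exact: measurable_kernel_r.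
under eq_integral => q _ do rewrite /= ger0_norm ?(pk_ge0 PK)//.
by rewrite (le_lt_trans (pk_mass PK p y0))// ltry.
Qed.

Lemma integrable_kernelM y p M f : 0 < y -> bounded_borel M f ->
  mu.-integrable setT (fun q => (k y p q * f q)%:E).
Proof.
move=> y0 bf; have [mf fM] := bf.
apply: (@le_integrable _ _ _ _ _ _ _ (fun q => M%:E * (k y p q)%:E)%E) => //.
- by apply/measurable_EFinP; apply: measurable_funM => //; exact: measurable_kernel_r.
- move=> q _; rewrite -EFinM !abse_EFin lee_fin !normrM mulrC ler_wpM2r//.
  by rewrite (le_trans (fM q))// ler_norm.
- by apply: integrableZl => //; exact: integrable_kernel.
Qed.

Lemma Rintegral_kernel_le1 y p : 0 < y -> \int[mu]_q k y p q <= 1.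
Proof.
move=> y0; rewrite -lee_fin fineK; first exact: (pk_mass PK).
exact: integrable_fin_num (integrable_kernel p y0).
Qed.

Lemma kernel_op_le y p M f : 0 < y -> bounded_borel M f -> `|kernel_op y f p| <= M.
Proof.
move=> y0 bf; have [mf fM] := bf; have M0 := bounded_borel_ge0 p bf.
have intk := integrable_kernelM p y0 bf.
apply: (le_trans (le_normr_Rintegral _ intk)) => //.
apply: (@le_trans _ _ (\int[mu]_q (M * k y p q))).
  apply: le_Rintegral => //.
  - have := integrable_abse intk; apply: eq_integrable => // q _ /=.
  - have := integrableZl measurableT M (integrable_kernel p y0).
    by apply: eq_integrable => // q _ /=.
  move=> q _; rewrite normrM (ger0_norm (pk_ge0 PK p q y0)) mulrC.
  by rewrite ler_wpM2r ?(pk_ge0 PK).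
rewrite RintegralZl//; last exact: integrable_kernel.
by rewrite -[leRHS]mulr1 ler_wpM2l// Rintegral_kernel_le1.
Qed.

(** The finiteness condition of Fubini for functions dominated by a multiple of
    the kernel. *)
Lemma ge0_integral_cst_lty M (F : T -> \bar R) y p : 0 < y -> 0 <= M ->
  measurable_fun setT F -> (forall q, 0 <= F q)%E ->
  (forall q, F q <= M%:E * (k y p q)%:E)%E -> (\int[mu]_q F q < +oo)%E.
Proof.
move=> y0 M0 mF F0 FM.
apply: (@le_lt_trans _ _ (\int[mu]_q (M%:E * (k y p q)%:E))%E).
  apply: ge0_le_integral => //.
  apply/measurable_EFinP; apply: measurable_funM => //; exact: measurable_kernel_r.
rewrite ge0_integralZl_EFin//; last 2 first.
- by move=> q _; rewrite lee_fin (pk_ge0 PK).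
- by apply/measurable_EFinP; exact: measurable_kernel_r.
apply: (@le_lt_trans _ _ (M%:E * 1)%E); first by rewrite lee_wpmul2l ?lee_fin// (pk_mass PK).
by rewrite mule1 ltry.
Qed.

Lemma kernel_opB y p M N f g : 0 < y -> bounded_borel M f -> bounded_borel N g ->
  kernel_op y (fun q => f q - g q) p = kernel_op y f p - kernel_op y g p.
Proof.
move=> y0 bf bg; rewrite -RintegralB//; last 2 first.
- exact: integrable_kernelM bf.
- exact: integrable_kernelM bg.
by apply: eq_Rintegral => q _; rewrite mulrBr.
Qed.

Lemma kernel_opZ y p M c f : 0 < y -> bounded_borel M f ->
  kernel_op y (fun q => c * f q) p = c * kernel_op y f p.
Proof.
move=> y0 bf; rewrite -RintegralZl//; last exact: integrable_kernelM bf.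
by apply: eq_Rintegral => q _; rewrite mulrCA.
Qed.

(** Fubini and the Chapman-Kolmogorov identity. *)
Lemma kernel_opD s t p M f : 0 < s -> 0 < t -> bounded_borel M f ->
  kernel_op s (kernel_op t f) p = kernel_op (s + t) f p.
Proof.
move=> s0 t0 bf; have [mf fM] := bf; have M0 := bounded_borel_ge0 p bf.
pose F (u : T * T) : R := k s p u.1 * k t u.1 u.2 * f u.2.
have mkk : measurable_fun setT (fun u : T * T => k s p u.1 * k t u.1 u.2).
  apply: measurable_funM; last exact: (pk_measurable PK).
  by apply: (measurableT_comp (measurable_kernel_r p s0)).
have mF : measurable_fun setT F.
  by apply: measurable_funM => //; exact: (measurableT_comp mf).
transitivity (\int[mu]_r \int[mu]_q F (r, q)).
  apply: eq_Rintegral => r _; rewrite -RintegralZl//; last exact: integrable_kernelM bf.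
  by apply: eq_Rintegral => q _; rewrite /F mulrA.
rewrite Rintegral_exchange//; last first.
  apply: (ge0_integral_cst_lty (M := M) (p := p) s0 M0).
  - apply: (@measurable_fun_parametric_integral _ _ _ _ _ mu setT
      (fun u => (`|F u|)%:E)) => //.
    by apply/measurable_EFinP; exact: measurableT_comp.
  - by move=> q; apply: integral_ge0.
  - move=> r; apply: (@le_trans _ _ (\int[mu]_q ((M * k s p r)%:E * (k t r q)%:E))%E).
      apply: ge0_le_integral => //.
      + apply/measurable_EFinP; apply: measurableT_comp => //.
        exact: (measurableT_comp mF (measurable_pair1 r)).
      + apply/measurable_EFinP; apply: measurable_funM => //; exact: measurable_kernel_r.
      + move=> q _; rewrite -EFinM lee_fin /F !normrM /=.
        rewrite !(ger0_norm (pk_ge0 PK _ _ _))// mulrC -mulrA ler_wpM2r//.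
        by rewrite mulr_ge0 ?(pk_ge0 PK).
    rewrite ge0_integralZl_EFin//.
    + rewrite -EFinM -[leRHS]mule1 lee_wpmul2l ?lee_fin ?mulr_ge0 ?(pk_ge0 PK)//.
      exact: (pk_mass PK).
    + by move=> q _; rewrite lee_fin (pk_ge0 PK).
    + by apply/measurable_EFinP; exact: measurable_kernel_r.
    + by rewrite mulr_ge0 ?(pk_ge0 PK).
apply: eq_Rintegral => q _; rewrite /F /= -(_ : \int[mu]_r (k s p r * k t r q) = k (s + t) p q).
  rewrite RintegralZr//; apply/integrableP; split.
    by apply/measurable_EFinP; exact: (measurableT_comp mkk (measurable_pair2 q)).
  under eq_integral => r _ do rewrite /= ger0_norm ?mulr_ge0 ?(pk_ge0 PK)//.
  by rewrite (pk_chapman PK)// ltry.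
by rewrite /Rintegral (pk_chapman PK).
Qed.

Lemma kernel_op_cvg y M (f_ : nat -> T -> R) f p : 0 < y ->
  (forall n, bounded_borel M (f_ n)) -> (forall q, f_ n q @[n --> \oo] --> f q) ->
  kernel_op y (f_ n) p @[n --> \oo] --> kernel_op y f p.
Proof.
move=> y0 bf cf; have mk := measurable_kernel_r p y0.
have mf : measurable_fun setT f.
  by apply: (@measurable_fun_cvg _ _ _ _ f_) => [n|q _ //]; have [] := bf n.
have [|||||intf _ h] := @dominated_convergence _ T R mu setT measurableT
  (fun n q => (k y p q * f_ n q)%:E) (fun q => (k y p q * f q)%:E)
  (fun q => M%:E * (k y p q)%:E)%E.
- by move=> n; apply/measurable_EFinP; apply: measurable_funM => //; have [] := bf n.
- by apply/measurable_EFinP; exact: measurable_funM.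
- apply: aeW => q _; apply: cvg_EFin; first by apply: nearW.
  by apply: cvgM; [exact: cvg_cst|exact: cf].
- by apply: integrableZl => //; exact: integrable_kernel.
- apply: aeW => q n _; have [_ fM] := bf n.
  by rewrite -EFinM abse_EFin lee_fin normrM (ger0_norm (pk_ge0 PK _ _ y0)) mulrC ler_wpM2r ?(pk_ge0 PK).
- rewrite /kernel_op /Rintegral; apply: fine_cvg.
  by rewrite fineK//; exact: integrable_fin_num intf.
Qed.

Lemma measurable_kernel_deriv y p : 0 < y ->
  measurable_fun setT (fun q => derive1 (fun s => k s p q) y).
Proof.
move=> y0; apply: (@measurable_fun_cvg _ _ _ _
  (fun n q => n.+1%:R * (k (y + n.+1%:R^-1) p q - k y p q))).
  move=> n; have yn0 : 0 < y + n.+1%:R^-1 by rewrite addr_gt0// invr_gt0.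
  apply: measurable_funM => //; apply: measurable_funB; exact: measurable_kernel_r.
by move=> q _; apply: cvg_difference_quotient; exact: (pk_derivable PK).
Qed.

(** Differentiation under the integral on (y/2, 2y), dominated by the kernel at
    y/4; the bound at y itself then uses the kernel at y/2, of mass at most
    1. *)
Lemma kernel_op_deriv y M f p : 0 < y -> bounded_borel M f ->
  derivable (fun s => kernel_op s f p) y 1 /\
  `|derive1 (fun s => kernel_op s f p) y| <= K * M / y.
Proof.
move=> y0 bf; have [mf fM] := bf; have M0 := bounded_borel_ge0 p bf.
have K0 := pk_cst_ge0 PK.
have y2 : 0 < y / 2 by rewrite divr_gt0.
have y4 : 0 < y / 2 / 2 by rewrite divr_gt0.
pose F s q := k s p q * f q.
have dF s q : 0 < s -> is_derive s 1 (F ^~ q) (f q * derive1 (fun s => k s p q) s).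
  move=> s0; have h : is_derive s 1 (fun s => k s p q) (derive1 (fun s => k s p q) s).
    by rewrite derive1E; apply/derivableP; exact: (pk_derivable PK).
  have -> : F ^~ q = fun s => f q * k s p q by apply/funext => s'; rewrite /F mulrC.
  exact: (is_deriveZ (f q) h).
have FE s q : 0 < s -> partial1of2 F s q = f q * derive1 (fun s => k s p q) s.
  by move=> s0; rewrite partial1of2E; have [_ ->] := dF s q s0.
have le_F a s q : 0 < a -> a <= s -> `|partial1of2 F s q| <= K / a * M * k (a / 2) p q.
  move=> a0 las; rewrite FE ?(lt_le_trans a0)// normrM.
  rewrite (mulrAC K) mulrAC -/(_ * _) mulrC -[leRHS]mulrA.
  rewrite mulrC [leRHS](_ : _ = M * (K / a * k (a / 2) p q)); last by ring.
  by apply: ler_pM => //; exact: (pk_deriv_le PK).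
pose I : set R := `](y / 2), (2 * y)[%classic.
have Iy : I y by rewrite /I/= in_itv/=; apply/andP; split; lra.
have I0 s : I s -> 0 < s /\ y / 2 <= s.
  by rewrite /I/= in_itv/= => /andP[h _]; split; [exact: lt_trans h|exact: ltW].
pose G q := K / (y / 2) * M * k (y / 2 / 2) p q.
have G0 q : 0 <= G q by rewrite mulr_ge0 ?(pk_ge0 PK)// mulr_ge0// divr_ge0// ltW.
have intG : mu.-integrable setT (EFin \o G).
  have := integrableZl measurableT (K / (y / 2) * M) (integrable_kernel p y4).
  by apply: eq_integrable => // q _ /=.
have intF s : I s -> mu.-integrable setT (EFin \o F s).
  by move=> /I0[s0 _]; exact: integrable_kernelM bf.
have derF s q : I s -> setT q -> derivable (F ^~ q) s 1.
  by move=> /I0[s0 _] _; have [] := dF s q s0.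
have GF s q : I s -> setT q -> `|partial1of2 F s q| <= G q.
  by move=> /I0[s0 ys] _; exact: le_F.
split.
  exact: (derivable_under_integral measurableT Iy intF derF G0 intG GF).
rewrite (differentiation_under_integral measurableT Iy intF derF G0 intG GF).
have mD : measurable_fun setT (partial1of2 F y).
  have -> : partial1of2 F y = fun q => f q * derive1 (fun s => k s p q) y.
    by apply/funext => q; rewrite FE.
  by apply: measurable_funM => //; exact: measurable_kernel_deriv.
have intB : mu.-integrable setT (EFin \o (fun q => K / y * M * k (y / 2) p q)).
  have := integrableZl measurableT (K / y * M) (integrable_kernel p y2).
  by apply: eq_integrable => // q _ /=.
have intD : mu.-integrable setT (EFin \o partial1of2 F y).
  apply: le_integrable intB => //; first exact/measurable_EFinP.
  move=> q _ /=; rewrite lee_fin; apply: le_trans (ler_norm _); exact: le_F.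
apply: (le_trans (le_normr_Rintegral _ intD)) => //.
apply: (@le_trans _ _ (\int[mu]_q (K / y * M * k (y / 2) p q))).
  apply: le_Rintegral => //; last by move=> q _; exact: le_F.
  by have := integrable_abse intD; apply: eq_integrable => // q _ /=.
rewrite RintegralZl//; last exact: integrable_kernel.
rewrite (mulrAC K) -[leRHS]mulr1 ler_wpM2l ?Rintegral_kernel_le1//.
by rewrite divr_ge0 ?mulr_ge0// ltW.
Qed.

(** Let a_n q be the integral over p in A of the kernel at time 1/(n+1).
    Exchanging integrals, the integral of a_n h is that over A of the semigroup
    applied to h, which is 0. On the other hand a_n tends to the indicator of A
    in L^1: since both take values in [0, 1], the distance is at most twice the
    measure of A minus the integral of a_n over A, and this integral tends to
    the measure of A because the kernel concentrates at each point of A. *)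
Lemma kernel_approx_identity (A : set T) : measurable A -> (mu A < +oo)%E ->
  (forall p, A p -> fine (\int[mu]_(q in A) (k n.+1%:R^-1 p q)%:E) @[n --> \oo] --> (1 : R)) ->
  (forall M h, bounded_borel M h -> (forall s p, 0 < s -> kernel_op s h p = 0) ->
  \int[mu]_(p in A) h p = 0).
Proof.
move=> mA Aoo cA M h bh h0; have [mh hM] := bh.
pose e p : R := \1_A p; pose s_ n : R := n.+1%:R^-1.
have s0 n : 0 < s_ n by rewrite invr_gt0.
have me : measurable_fun setT e by exact: measurable_indic.
have e01 p : 0 <= e p <= 1 by rewrite /e indicE; case: (p \in A); rewrite /= ?lexx ?ler01.
have e0 p : 0 <= e p by have /andP[] := e01 p.
pose V := fine (mu A).
have intEe : (\int[mu]_p (e p)%:E = V%:E)%E.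
  by rewrite integral_indic// setIT fineK// ge0_fin_numE.
have inte : mu.-integrable setT (EFin \o e).
  apply/integrableP; split; first exact/measurable_EFinP.
  under eq_integral => p _ do rewrite /= ger0_norm//.
  by rewrite intEe ltry.
pose F n (u : T * T) := e u.1 * k (s_ n) u.1 u.2.
have F0 n u : 0 <= F n u by rewrite mulr_ge0// (pk_ge0 PK).
have mF n : measurable_fun setT (F n).
  by apply: measurable_funM; [exact: (measurableT_comp me)|exact: (pk_measurable PK)].
have mF1 n p : measurable_fun setT (fun q => F n (p, q)).
  exact: (measurableT_comp (mF n) (measurable_pair1 p)).
have mF2 n q : measurable_fun setT (fun p => F n (p, q)).
  exact: (measurableT_comp (mF n) (measurable_pair2 q)).
pose a n q := \int[mu]_p F n (p, q).
have leF n q : (\int[mu]_p (F n (p, q))%:E <= 1)%E.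
  apply: le_trans (pk_dual_mass PK q (s0 n)); apply: ge0_le_integral => //.
  - by move=> p _; rewrite lee_fin.
  - exact/measurable_EFinP.
  - by apply/measurable_EFinP; exact: measurable_kernel_l.
  move=> p _; rewrite lee_fin -[leRHS]mul1r ler_wpM2r ?(pk_ge0 PK)//.
  by have /andP[] := e01 p.
have aE n q : (\int[mu]_p (F n (p, q))%:E = (a n q)%:E)%E.
  rewrite /a /Rintegral fineK// ge0_fin_numE ?(le_lt_trans (leF n q)) ?ltry//.
  by apply: integral_ge0 => p _; rewrite lee_fin.
have a01 n q : 0 <= a n q <= 1.
  by rewrite -!lee_fin -aE leF andbT; apply: integral_ge0 => p _; rewrite lee_fin.
have a0 n q : 0 <= a n q by have /andP[] := a01 n q.
have ma n : measurable_fun setT (a n).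
  apply: (@measurable_fun_parametric_Rintegral _ _ _ _ _ mu setT
    (fun u : T * T => F n (u.2, u.1))) => //.
  by apply: (measurableT_comp (mF n)); apply/measurable_fun_pair.
have row n p : (\int[mu]_q (F n (p, q))%:E <= (e p)%:E)%E.
  under eq_integral => q _ do rewrite /F EFinM/=.
  rewrite ge0_integralZl_EFin//.
  - by rewrite -[leRHS]mule1 lee_wpmul2l ?lee_fin// (pk_mass PK).
  - by move=> q _; rewrite lee_fin (pk_ge0 PK).
  - by apply/measurable_EFinP; exact: measurable_kernel_r.
have inta n : (\int[mu]_q (a n q)%:E <= V%:E)%E.
  under eq_integral => q _ do rewrite -aE.
  rewrite -(@fubini_tonelli _ _ _ _ _ mu mu (EFin \o F n))//; last first.
  - by move=> u; rewrite lee_fin.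
  - exact/measurable_EFinP.
  rewrite -intEe; apply: ge0_le_integral => //.
  - by move=> p _; apply: integral_ge0 => q _; rewrite lee_fin.
  - apply: (@measurable_fun_parametric_integral _ _ _ _ _ mu setT (EFin \o F n)) => //.
    exact/measurable_EFinP.
  - exact/measurable_EFinP.
  - by move=> p _; exact: row.
have intga n : mu.-integrable setT (EFin \o a n).
  apply/integrableP; split; first exact/measurable_EFinP.
  under eq_integral => q _ do rewrite /= ger0_norm//.
  by rewrite (le_lt_trans (inta n))// ltry.
pose c n p := \int[mu]_(q in A) k (s_ n) p q.
have c01 n p : 0 <= c n p <= 1.
  have h1 : (0 <= \int[mu]_(q in A) (k (s_ n) p q)%:E)%E.
    by apply: integral_ge0 => q _; rewrite lee_fin (pk_ge0 PK).
  have h2 : (\int[mu]_(q in A) (k (s_ n) p q)%:E <= 1)%E.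
    apply: le_trans (pk_mass PK p (s0 n)); apply: ge0_subset_integral => //.
      by apply/measurable_EFinP; exact: measurable_kernel_r.
    by move=> q _; rewrite lee_fin (pk_ge0 PK).
  by rewrite fine_ge0//= -lee_fin fineK// ge0_fin_numE// (le_lt_trans h2)// ltry.
have mc n : measurable_fun setT (c n).
  by apply: (@measurable_fun_parametric_Rintegral _ _ _ _ _ mu A
    (fun u : T * T => k (s_ n) u.1 u.2)) => //; exact: (pk_measurable PK).
have cE n p : c n p = \int[mu]_q (e q * k (s_ n) p q).
  rewrite /c Rintegral_mkcond; apply: eq_Rintegral => q _.
  by rewrite /patch /e indicE; case: (q \in A); rewrite ?mul1r ?mul0r.
have eaE n : \int[mu]_q (e q * a n q) = \int[mu]_p (e p * c n p).
  transitivity (\int[mu]_q \int[mu]_p (e q * F n (p, q))).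
    apply: eq_Rintegral => q _; rewrite RintegralZl//.
    apply/integrableP; split; first exact/measurable_EFinP.
    under eq_integral => p _ do rewrite /= ger0_norm//.
    by rewrite aE ltry.
  rewrite -(@Rintegral_exchange _ _ _ _ _ mu mu (fun u => e u.2 * F n u)).
  - apply: eq_Rintegral => p _; rewrite cE -RintegralZl//.
      by apply: eq_Rintegral => q _; rewrite /F mulrCA.
    have := integrable_kernelM p (s0 n) (_ : bounded_borel 1 e).
    have be : bounded_borel 1 e by split=> // q; rewrite ger0_norm//; have /andP[] := e01 q.
    by move=> /(_ be); apply: eq_integrable => // q _ /=; rewrite mulrC.
  - by apply: measurable_funM => //; exact: (measurableT_comp me).
  - apply: (@le_lt_trans _ _ (\int[mu]_p (e p)%:E)%E); last by rewrite intEe ltry.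
    apply: ge0_le_integral => //.
    + by move=> p _; apply: integral_ge0.
    + apply: (@measurable_fun_parametric_integral _ _ _ _ _ mu setT
        (fun u => (`|e u.2 * F n u|)%:E)) => //.
      apply/measurable_EFinP; apply: measurableT_comp => //.
      by apply: measurable_funM => //; exact: (measurableT_comp me).
    + exact/measurable_EFinP.
    move=> p _; apply: le_trans (row n p); apply: ge0_le_integral => //.
    + apply/measurable_EFinP; apply: measurableT_comp => //.
      exact: measurable_funM.
    + exact/measurable_EFinP.
    move=> q _; have /andP[_ eq1] := e01 q.
    by rewrite lee_fin normrM (ger0_norm (e0 q)) (ger0_norm (F0 n _)) ler_piMl.
have ahE n : \int[mu]_q (a n q * h q) = 0.
  transitivity (\int[mu]_q \int[mu]_p (F n (p, q) * h q)).
    apply: eq_Rintegral => q _; rewrite RintegralZr//.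
    apply/integrableP; split; first exact/measurable_EFinP.
    under eq_integral => p _ do rewrite /= ger0_norm//.
    by rewrite aE ltry.
  rewrite -(@Rintegral_exchange _ _ _ _ _ mu mu (fun u => F n u * h u.2)).
  - rewrite [RHS](_ : _ = \int[mu]_(p in setT) 0); last first.
      by rewrite Rintegral_cst// mul0r.
    apply: eq_Rintegral => p _; rewrite -[RHS](mulr0 (e p)) -(h0 (s_ n) p (s0 n)).
    rewrite -RintegralZl//; last exact: integrable_kernelM bh.
    by apply: eq_Rintegral => q _; rewrite /F mulrA.
  - by apply: measurable_funM => //; exact: (measurableT_comp mh).
  - apply: (@le_lt_trans _ _ (\int[mu]_p (`|M|%:E * (e p)%:E))%E); last first.
      rewrite ge0_integralZl_EFin//; last exact/measurable_EFinP.
        by rewrite intEe -EFinM ltry.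
      by move=> p _; rewrite lee_fin.
    apply: ge0_le_integral => //.
    + by move=> p _; apply: integral_ge0.
    + apply: (@measurable_fun_parametric_integral _ _ _ _ _ mu setT
        (fun u => (`|F n u * h u.2|)%:E)) => //.
      apply/measurable_EFinP; apply: measurableT_comp => //.
      by apply: measurable_funM => //; exact: (measurableT_comp mh).
    + by apply/measurable_EFinP; apply: measurable_funM.
    move=> p _; apply: (@le_trans _ _ (`|M|%:E * \int[mu]_q (F n (p, q))%:E)%E); last first.
      by rewrite lee_wpmul2l ?lee_fin.
    rewrite -ge0_integralZl_EFin//; last 2 first.
    + by move=> q _; rewrite lee_fin.
    + exact/measurable_EFinP.
    apply: ge0_le_integral => //.
    + apply/measurable_EFinP; apply: measurableT_comp => //.
      exact: measurable_funM.
    + by apply/measurable_EFinP; apply: measurable_funM.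
    move=> q _; rewrite -EFinM lee_fin normrM (ger0_norm (F0 _ _)) mulrC ler_wpM2r//.
    by rewrite (le_trans (hM q))// ler_norm.
have cI : \int[mu]_p (e p * c n p) @[n --> \oo] --> V.
  have [|||||intf _ hc] := @dominated_convergence _ T R mu setT measurableT
    (fun n p => (e p * c n p)%:E) (EFin \o e) (EFin \o e).
  - by move=> n; apply/measurable_EFinP; exact: measurable_funM.
  - exact/measurable_EFinP.
  - apply: aeW => p _; apply: cvg_EFin; first by apply: nearW.
    rewrite /comp /=; have [Ap|Ap] := pselect (A p).
      rewrite -[X in _ --> X]mulr1; apply: cvgM; first exact: cvg_cst.
      exact: cA.
    rewrite /e indicE memNset//; under eq_fun do rewrite mul0r.
    exact: cvg_cst.
  - exact: inte.
  - apply: aeW => p n _; rewrite abse_EFin lee_fin; have /andP[c0 c1] := c01 n p.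
    by rewrite ger0_norm ?mulr_ge0// -[leRHS]mulr1 ler_wpM2l.
  - rewrite /Rintegral; have -> : V = fine (\int[mu]_p (e p)%:E)%E by rewrite intEe.
    by apply: fine_cvg; rewrite fineK//; exact: integrable_fin_num intf.
have M0 : 0 <= `|M| by [].
(* On the indicator e, which takes the values 0 and 1, the distance from e to a
   value of a n is e + a n - 2 e (a n). *)
have key n : `|\int[mu]_(p in A) h p| <= `|M| * (2 * (V - \int[mu]_p (e p * c n p))).
  have be : bounded_borel 1 e by split=> // q; rewrite ger0_norm//; have /andP[] := e01 q.
  have inteh : mu.-integrable setT (EFin \o (fun q => e q * h q)).
    apply: (@le_integrable _ _ _ _ _ _ _ (fun q => `|M|%:E * (e q)%:E)%E) => //.
    - by apply/measurable_EFinP; exact: measurable_funM.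
    - move=> q _; rewrite -EFinM !abse_EFin lee_fin !normrM mulrC ler_wpM2r//.
      by rewrite normr_id (le_trans (hM q))// ler_norm.
    - exact: integrableZl.
  have intah : mu.-integrable setT (EFin \o (fun q => a n q * h q)).
    apply: (@le_integrable _ _ _ _ _ _ _ (fun q => `|M|%:E * (a n q)%:E)%E) => //.
    - by apply/measurable_EFinP; exact: measurable_funM.
    - move=> q _; rewrite -EFinM !abse_EFin lee_fin !normrM mulrC ler_wpM2r//.
      by rewrite normr_id (le_trans (hM q))// ler_norm.
    - exact: (integrableZl measurableT `|M| (intga n)).
  have intea : mu.-integrable setT (EFin \o (fun q => e q * a n q)).
    apply: (@le_integrable _ _ _ _ _ _ _ (EFin \o a n)) => //.
    - by apply/measurable_EFinP; exact: measurable_funM.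
    - move=> q _; rewrite !abse_EFin lee_fin !ger0_norm ?mulr_ge0//.
      by rewrite -[leRHS]mul1r ler_wpM2r//; have /andP[] := e01 q.
  have -> : \int[mu]_(p in A) h p = \int[mu]_q (e q * h q - a n q * h q).
    rewrite RintegralB// ahE subr0 Rintegral_mkcond; apply: eq_Rintegral => q _.
    by rewrite /patch /e indicE; case: (q \in A); rewrite ?mul1r ?mul0r.
  have intd : mu.-integrable setT (EFin \o (fun q => e q * h q - a n q * h q)).
    by have := integrableB measurableT inteh intah; apply: eq_integrable => // q _ /=.
  apply: (le_trans (le_normr_Rintegral _ intd)) => //.
  have int2 : mu.-integrable setT (EFin \o (fun q => e q + a n q - 2 * (e q * a n q))).
    have h1 := integrableD measurableT inte (intga n).
    have h2 := integrableZl measurableT 2 intea.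
    by have := integrableB measurableT h1 h2; apply: eq_integrable => // q _ /=.
  apply: (@le_trans _ _ (\int[mu]_q (`|M| * (e q + a n q - 2 * (e q * a n q))))).
    apply: le_Rintegral => //.
    - by have := integrable_abse intd; apply: eq_integrable => // q _ /=.
    - by have := integrableZl measurableT `|M| int2; apply: eq_integrable => // q _ /=.
    move=> q _; rewrite -mulrBl normrM mulrC.
    have -> : e q + a n q - 2 * (e q * a n q) = `|e q - a n q|.
      have /andP[a0q a1q] := a01 n q; rewrite /e indicE; case: (q \in A).
        by rewrite ger0_norm ?subr_ge0// mul1r; ring.
      by rewrite sub0r normrN ger0_norm// mul0r mulr0 subr0 add0r.
    by rewrite ler_wpM2r// (le_trans (hM q))// ler_norm.
  rewrite RintegralZl//; apply: ler_wpM2l => //.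
  rewrite RintegralB//; last 2 first.
  - by have := integrableD measurableT inte (intga n); apply: eq_integrable => // q _ /=.
  - by have := integrableZl measurableT 2 intea; apply: eq_integrable => // q _ /=.
  rewrite RintegralD// RintegralZl// eaE.
  have -> : \int[mu]_q e q = V by rewrite /Rintegral intEe.
  have : \int[mu]_q a n q <= V.
    rewrite -lee_fin fineK ?inta//; exact: integrable_fin_num (intga n).
  by set I := Rintegral _ _ _; lra.
apply/eqP; rewrite -normr_le0.
have lim0 : `|M| * (2 * (V - \int[mu]_p (e p * c n p))) @[n --> \oo] --> `|M| * (2 * (V - V)).
  apply: cvgM; first exact: cvg_cst.
  apply: cvgM; first exact: cvg_cst.
  by apply: cvgB; first exact: cvg_cst.
rewrite (_ : 0 = `|M| * (2 * (V - V))); last by rewrite subrr !mulr0.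
by apply: (cvgr_to_ge lim0); apply: nearW.
Qed.

Lemma kernel_op_inj M h : bounded_borel M h ->
  (forall s p, 0 < s -> kernel_op s h p = 0) -> {ae mu, forall p, h p = 0}.
Proof.
move=> bh h0; have [G [g [mG GI Gg gT HG]]] := pk_concentrate PK.
apply: (ae_eq0_of_integrals mG GI Gg gT _ bh) => A GA; have [Aoo cA] := HG A GA => //.
have mA : measurable A by rewrite mG; exact: sub_sigma_algebra.
exact: (kernel_approx_identity mA Aoo cA bh).
Qed.

(** The functions are extended by 0 to negative times, in order to exchange
    integrals over whole spaces. *)
Lemma kernel_op_fubini y p (G : R -> R) (H : T * measurableTypeR R -> R) : 0 < y ->
  measurable_fun setT H ->
  lebesgue_measure.-integrable Rpos (EFin \o G) ->
  (forall q t, 0 < t -> `|H (q, t)| <= G t) ->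
  kernel_op y (fun q => \int[lebesgue_measure]_(t in Rpos) H (q, t)) p =
  \int[lebesgue_measure]_(t in Rpos) kernel_op y (fun q => H (q, t)) p.
Proof.
move=> y0 mH intG HG.
pose H' (u : T * measurableTypeR R) := H u * \1_Rpos (u.2 : R).
have mH' : measurable_fun setT H'.
  apply: measurable_funM => //; apply: (measurableT_comp (measurable_indic _)) => //.
pose G' t := `|G t| * \1_Rpos t.
have intG' : lebesgue_measure.-integrable setT (EFin \o G').
  have := (integrable_mkcond _ _).1 (integrable_abse intG).
  move=> /(_ (measurable_itv _)); apply: eq_integrable => // t _.
  by rewrite /patch /comp /G' indicE /=; case: (t \in _); rewrite ?mulr1 ?mulr0.
have HG' u : `|H' u| <= G' u.2.
  rewrite /H' /G' normrM [`|\1_Rpos _|]ger0_norm ?indicE//.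
  have [t0|] := boolP (_ \in Rpos); last by rewrite !mulr0.
  rewrite !mulr1; case: u t0 => q t /=; rewrite inE /= in_itv/= andbT => t0.
  by rewrite (le_trans (HG q t t0))// ler_norm.
have sub (f : R -> R) : \int[lebesgue_measure]_(t in Rpos) f t =
    \int[lebesgue_measure]_t (f t * \1_Rpos t).
  rewrite Rintegral_mkcond; apply: eq_Rintegral => t _.
  by rewrite /patch indicE; case: (t \in _); rewrite ?mulr1 ?mulr0.
pose F (u : T * measurableTypeR R) := k y p u.1 * H' u.
have mF : measurable_fun setT F.
  apply: measurable_funM => //.
  exact: (measurableT_comp (measurable_kernel_r p y0)).
have intH' q : lebesgue_measure.-integrable setT (EFin \o (fun t => H' (q, t))).
  apply: le_integrable intG' => //.
    by apply/measurable_EFinP; exact: (measurableT_comp mH' (measurable_pair1 q)).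
  by move=> t _ /=; rewrite lee_fin (le_trans (HG' _))// ler_norm.
transitivity (\int[mu]_q \int[lebesgue_measure]_t F (q, t)).
  by apply: eq_Rintegral => q _; rewrite sub -RintegralZl//; exact: intH'.
rewrite Rintegral_exchange//.
  rewrite [RHS]sub; apply: eq_Rintegral => t _.
  rewrite /F /H' /= indicE; case: (t \in _); last first.
    by rewrite mulr0; under eq_Rintegral do rewrite mulr0 mulr0; rewrite Rintegral_cst// mul0r.
  by rewrite mulr1; apply: eq_Rintegral => q _; rewrite mulr1.
pose N := \int[lebesgue_measure]_t G' t.
have G'0 t : 0 <= G' t by rewrite mulr_ge0// indicE.
apply: (ge0_integral_cst_lty (M := N) (p := p) y0 (Rintegral_ge0 _ _)) => //.
- apply: (@measurable_fun_parametric_integral _ _ _ _ _ lebesgue_measure setT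
    (fun u => (`|F u|)%:E)) => //.
  by apply/measurable_EFinP; exact: measurableT_comp.
- by move=> q; apply: integral_ge0.
move=> q; rewrite muleC /N /Rintegral fineK; last exact: integrable_fin_num intG'.
rewrite -ge0_integralZl_EFin ?(pk_ge0 PK)//; last 2 first.
- by move=> t _; rewrite lee_fin.
- exact: measurable_int intG'.
apply: ge0_le_integral => //.
- apply/measurable_EFinP; apply: measurableT_comp => //.
  exact: (measurableT_comp mF (measurable_pair1 q)).
- by apply: emeasurable_funM => //; exact: measurable_int intG'.
- move=> t _; rewrite -EFinM lee_fin normrM (ger0_norm (pk_ge0 PK _ _ y0)).
  by rewrite ler_wpM2l ?(pk_ge0 PK)//; exact: HG'.
Qed.

(** P f is compared with the kernel operator on a bounded g equal to f almost
    everywhere, because f itself, a representative of a class, need not be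
    bounded. *)
Theorem kernel_smoothing_semigroup (P : R -> (T -> R) -> T -> R) :
  (forall M f, bounded_borel M f ->
    measurable_fun setT (fun q : measurableTypeR R * T => P q.1 f q.2)) ->
  (forall y M f g p, 0 < y -> measurable_fun setT f -> bounded_borel M g ->
    {ae mu, forall q, f q = g q} -> P y f p = kernel_op y g p) ->
  smoothing_semigroup mu P K.
Proof.
move=> mP PE.
have PE' y M f p : 0 < y -> bounded_borel M f -> P y f p = kernel_op y f p.
  by move=> y0 bf; apply: (PE y M) => //; [exact: bf.1|exact: aeW].
have PF y M f : 0 < y -> bounded_borel M f -> P y f = kernel_op y f.
  by move=> y0 bf; apply/funext => p; exact: PE' bf.
have bP y M f : 0 < y -> bounded_borel M f -> bounded_borel M (P y f).
  move=> y0 bf; split.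
    exact: (measurableT_comp (mP M f bf) (measurable_pair1 y)).
  by move=> p; rewrite (PE' _ M)//; exact: kernel_op_le.
constructor.
- exact: bP.
- move=> y M N f g p y0 bf bg.
  rewrite (PE' _ (M + N))//; last exact: bounded_borelB.
  by rewrite (PE' _ M)// (PE' _ N)//; exact: (kernel_opB p y0 bf bg).
- move=> y M c f p y0 bf; rewrite (PE' _ (`|c| * M))//; last exact: bounded_borelZ.
  by rewrite (PE' _ M)//; exact: (kernel_opZ p c y0 bf).
- move=> s t M f p s0 t0 bf; rewrite (PE' _ M)//; last exact: bP.
  rewrite (PE' _ M) ?addr_gt0// (PF t M)//; exact: kernel_opD bf.
- move=> y M f_ f p y0 bf cf.
  have bl : bounded_borel M f.
    split.
      by apply: (@measurable_fun_cvg _ _ _ _ f_) => [n|q _ //]; have [] := bf n.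
    move=> q; apply: (cvgr_to_le (cvg_norm (cf q))).
    by apply: nearW => n; have [_] := bf n; apply.
  rewrite (PE' _ M)//; under eq_fun do rewrite (PE' _ M)//.
  exact: kernel_op_cvg bf cf.
- move=> y M f p y0 bf; have [d1 d2] := kernel_op_deriv p y0 bf.
  have E : \forall s \near y, kernel_op s f p = P s f p.
    near=> s; apply/esym; apply: (PE' _ M) => //; near: s; exact: lt_nbhsr.
  have hd : is_derive y 1 (fun s => P s f p) (derive1 (fun s => kernel_op s f p) y).
    apply: near_eq_is_derive; last by rewrite derive1E; exact/derivableP.
    exact: E.
  by rewrite derive1E; have [h ->] := hd.
- move=> M h bh h0; apply: (kernel_op_inj bh) => s p s0.
  by rewrite -(PE' _ M)// h0.
- exact: mP.
- move=> y p G H y0 mH intG HG.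
  pose N := \int[lebesgue_measure]_(t in Rpos) `|G t|.
  have mHr q : measurable_fun setT (fun t => H (q, t)).
    exact: (measurableT_comp mH (measurable_pair1 q)).
  have bI : bounded_borel N (fun q => \int[lebesgue_measure]_(t in Rpos) H (q, t)).
    split; first exact: (@measurable_fun_parametric_Rintegral _ _ _ _ _ lebesgue_measure).
    move=> q.
    have intH : lebesgue_measure.-integrable Rpos (EFin \o (fun t => H (q, t))).
      apply: le_integrable; [exact: measurable_itv| | |exact: intG].
        by apply/measurable_EFinP; apply: measurable_funTS; exact: mHr.
      move=> t; rewrite /= in_itv/= andbT => t0; rewrite lee_fin.
      by rewrite (le_trans (HG q t t0))// ler_norm.
    apply: (le_trans (le_normr_Rintegral _ intH)) => //.
    apply: le_Rintegral => //.
    + by have := integrable_abse intH; apply: eq_integrable => // t _ /=.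
    + by have := integrable_abse intG; apply: eq_integrable => // t _ /=.
    move=> t; rewrite /= in_itv/= andbT => t0.
    by rewrite (le_trans (HG q t t0))// ler_norm.
  rewrite (PE' _ N)// (kernel_op_fubini _ y0 mH intG HG).
  apply: eq_Rintegral => t; rewrite inE /= in_itv/= andbT => t0.
  rewrite (PE' _ (G t))//; split; last by move=> q; exact: HG.
  exact: (measurableT_comp mH (measurable_pair2 t)).
- move=> y M f g p y0 mf bg fg; rewrite (PE _ M f g)// (PE' _ M)//.
Unshelve. all: by end_near. Qed.

End kernel_semigroup.

(** * Joint measurability of the two factors of the kernel *)

Section measurability.
Context {R : realType}.

(** Continuous off 0, and 0 is a single point. *)
Lemma measurable_invr : measurable_fun setT (fun x : R => x^-1).
Proof.
have -> : setT = [set x : R | x != 0] `|` [set 0].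
  apply/seteqP; split=> // x _ /=; have [->|] := eqVneq x 0; [by right|by left].
have op : open [set x : R | x != 0].
  rewrite (_ : [set x : R | x != 0] = ~` [set 0]); first exact/closed_openC/closed_eq.
  by apply/seteqP; split=> x /= /eqP.
apply/measurable_funU => //; first exact: open_measurable.
split; last exact: measurable_fun_set1.
apply: open_continuous_measurable_fun => // x; rewrite inE /= => x0.
exact: inv_continuous.
Qed.

Lemma measurable_funV d (T : measurableType d) (f : T -> R) :
  measurable_fun setT f -> measurable_fun setT (fun x => (f x)^-1).
Proof. by move=> mf; exact: (measurableT_comp measurable_invr mf). Qed.

Lemma measurable_mehler_kernel_comp d (T : measurableType d) n
    (tau : T -> R) (x z : T -> Rn R n) :
  measurable_fun setT tau -> measurable_fun setT x -> measurable_fun setT z ->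
  measurable_fun setT (fun u => mehler_kernel (tau u) (x u) (z u)).
Proof.
move=> mt mx mz.
have mx_ i : measurable_fun setT (fun u => tnth (x u) i : R).
  exact: (measurableT_comp (measurable_tnth i) mx).
have mz_ i : measurable_fun setT (fun u => tnth (z u) i : R).
  exact: (measurableT_comp (measurable_tnth i) mz).
have mE (g : T -> R) : measurable_fun setT g -> measurable_fun setT (fun u => expR (g u)).
  by move=> mg; exact: measurableT_comp.
have mN (g : T -> R) : measurable_fun setT g -> measurable_fun setT (fun u => - g u).
  by move=> mg; exact: measurableT_comp.
have msinh (g : T -> R) : measurable_fun setT g -> measurable_fun setT (fun u => sinh (g u)).
  move=> mg; apply: measurable_funM => //; apply: measurable_funB; first exact: mE.
  by apply: mE; exact: mN.
have mcosh (g : T -> R) : measurable_fun setT g -> measurable_fun setT (fun u => cosh (g u)).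
  move=> mg; apply: measurable_funM => //; apply: measurable_funD; first exact: mE.
  by apply: mE; exact: mN.
rewrite /mehler_kernel; apply: measurable_funM; [apply: measurable_funM|].
- apply: measurableT_comp => //; apply: measurable_funM.
    apply: measurableT_comp => //; apply: measurable_funM => //.
    by apply: measurable_sum => i; apply: measurable_funX; exact: measurable_funB.
  apply: measurable_funM; [exact: mcosh|apply: measurable_funV; exact: msinh].
- apply: measurableT_comp => //; apply: measurable_funM.
    apply: measurableT_comp => //; apply: measurable_funM => //.
    by apply: measurable_sum => i; apply: measurable_funX; exact: measurable_funD.
  apply: measurable_funM; [exact: msinh|apply: measurable_funV; exact: mcosh].
apply: measurable_funV.
apply: (measurableT_comp (measurable_powR _)); apply: measurable_funM => //.
by apply: msinh; exact: measurable_funM.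
Qed.

Lemma measurable_levy_comp d (T : measurableType d) (y tau : T -> R) :
  measurable_fun setT y -> measurable_fun setT tau ->
  measurable_fun setT (fun u => levy (y u) (tau u)).
Proof.
move=> my mt; rewrite /levy; apply: measurable_funM; last first.
  by apply: measurable_funV; exact: (measurableT_comp (measurable_powR _)).
apply: measurable_funM; first exact: measurable_funM.
apply: measurableT_comp => //; apply: measurableT_comp => //.
apply: measurable_funM; first exact: measurable_funX.
by apply: measurable_funV; exact: measurable_funM.
Qed.

End measurability.

(** * Derivative and concentration of the stable density *)

Section levy_derivative.
Context {R : realType}.
Implicit Types (a s y tau : R).
Notation mu := (@lebesgue_measure R).
Local Notation Rpos := (`]0%R, +oo[%classic : set R).

Lemma is_derive_levy y tau : 0 < tau -> is_derive y 1 (levy ^~ tau)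
  ((1 - 2 * (y ^+ 2 / (4 * tau))) * expR (- (y ^+ 2 / (4 * tau))) /
   (2 * Num.sqrt pi * tau `^ (3 / 2))).
Proof.
move=> t0; have sp := @sqrtpi_gt0 R.
have dq : is_derive y 1 (fun s => - (s ^+ 2 / (4 * tau))) (- (2 * y / (4 * tau))).
  have h := is_deriveZ (- (4 * tau)^-1) (is_derive_mul (is_derive_id y 1) (is_derive_id y 1)).
  have -> : (fun s => - (s ^+ 2 / (4 * tau))) = (fun s => - (4 * tau)^-1 * (s * s)).
    by apply/funext => s; rewrite expr2 mulNr mulrC.
  by apply: is_derive_eq h _; rewrite /GRing.scale/=; field; rewrite gt_eqF.
have dE := @is_derive_comp1 _ expR _ y _ _ (is_derive_expR _) dq.
pose c : R := (2 * Num.sqrt pi * tau `^ (3 / 2))^-1.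
have h := is_deriveZ c (is_derive_mul (is_derive_id y 1) dE).
have p0 : 0 < tau `^ (3 / 2) by rewrite powR_gt0.
have -> : levy ^~ tau = fun s => c * (s * expR (- (s ^+ 2 / (4 * tau)))).
  by apply/funext => s; rewrite /levy /c; field; rewrite !gt_eqF.
apply: is_derive_eq h _; rewrite /GRing.scale/= /c; field; rewrite !gt_eqF//.
Qed.

(** The derivative in y produces the factor 1 - 2 u with u = y^2 / (4 tau),
    absorbed by 3/4 of the exponential as |1 - 2 u| <= 3 exp (3 u / 4). The
    quarter of the exponent left over is exactly that of the density at half
    the parameter. *)
Lemma levy_deriv_le a y tau : 0 < a -> a <= y -> 0 < tau ->
  `|derive1 (levy ^~ tau) y| <= 6 / a * levy (a / 2) tau.
Proof.
move=> a0 ay t0; have sp := @sqrtpi_gt0 R.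
have p0 : 0 < tau `^ (3 / 2) by rewrite powR_gt0.
rewrite derive1E; have [_ ->] := is_derive_levy y t0.
have c0 : 0 < (2 * Num.sqrt pi * tau `^ (3 / 2))^-1 by rewrite invr_gt0 !mulr_gt0.
have -> : 6 / a * levy (a / 2) tau =
    3 * expR (- (a ^+ 2 / (4 * tau) / 4)) * (2 * Num.sqrt pi * tau `^ (3 / 2))^-1.
  rewrite /levy (_ : (a / 2) ^+ 2 / (4 * tau) = a ^+ 2 / (4 * tau) / 4).
    by field; rewrite !gt_eqF.
  by field; rewrite gt_eqF.
rewrite normrM (gtr0_norm c0) ler_pM2r// normrM (ger0_norm (expR_ge0 _)).
set u := y ^+ 2 / (4 * tau); set v := a ^+ 2 / (4 * tau).
have v0 : 0 <= v by rewrite divr_ge0 ?sqr_ge0// mulr_ge0// ltW.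
have vu : v <= u.
  by rewrite ler_pM2r ?invr_gt0 ?mulr_gt0// ler_pXn2r// nnegrE ltW// (lt_le_trans a0).
have u0 : 0 <= u by exact: le_trans vu.
have e34 : 1 + 3 / 4 * u <= expR (3 / 4 * u) by apply: expR_ge1Dx.
have h1 : `|1 - 2 * u| <= 3 * expR (3 / 4 * u).
  by rewrite ler_norml; apply/andP; split; lra.
apply: (@le_trans _ _ (3 * expR (3 / 4 * u) * expR (- u))).
  by rewrite ler_wpM2r ?expR_ge0.
rewrite -mulrA -expRD ler_pM2l// ler_expR; lra.
Qed.

(** Away from 0 the density at parameter s is at most a multiple of s times the
    density at parameter 1, so its mass there vanishes with s, and near 0 the
    function g is close to 1. *)
Lemma levy_approx_identity (g : R -> R) : measurable_fun setT g ->
  (forall tau, 0 <= g tau <= 1) -> g tau @[tau --> 0^'+] --> (1 : R) ->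
  fine (\int[mu]_(tau in Rpos) (levy n.+1%:R^-1 tau * g tau)%:E) @[n --> \oo] --> (1 : R).
Proof.
move=> mg g01 cg.
pose s_ n : R := n.+1%:R^-1.
have s0 n : 0 < s_ n by rewrite invr_gt0.
have ml s : measurable_fun setT (levy s) by exact: measurable_levy_comp.
have l0 n tau : 0 <= levy (s_ n) tau by rewrite levy_ge0// ltW.
have g0 tau : 0 <= g tau by have /andP[] := g01 tau.
have mE (phi : R -> R) : measurable_fun setT phi -> measurable_fun Rpos (EFin \o phi).
  by move=> mphi; apply/measurable_EFinP; exact: measurable_funTS.
have mlg n : measurable_fun setT (fun tau => levy (s_ n) tau * g tau) by exact: measurable_funM.
have mcl c s : measurable_fun setT (fun tau => c * levy s tau) by exact: measurable_funM.
have mRp : measurable Rpos by exact: measurable_itv.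
have upper n : (\int[mu]_(tau in Rpos) (levy (s_ n) tau * g tau)%:E <= 1)%E.
  rewrite -(integral_levy (s0 n)); apply: ge0_le_integral => //.
  - by move=> tau _; rewrite lee_fin mulr_ge0.
  - exact: mE (mlg n).
  - exact: mE (ml _).
  by move=> tau _; rewrite lee_fin ler_piMr//; have /andP[] := g01 tau.
have fin n : (\int[mu]_(tau in Rpos) (levy (s_ n) tau * g tau)%:E \is a fin_num)%E.
  rewrite ge0_fin_numE ?(le_lt_trans (upper n)) ?ltry//.
  by apply: integral_ge0 => tau _; rewrite lee_fin mulr_ge0.
apply/cvgrPdist_le => eps eps0.
have e2 : 0 < eps / 2 by rewrite divr_gt0.
have [dl /= dl0 hdl] : \forall tau \near 0^'+, `|1 - g tau| <= eps / 2.
  by move/cvgrPdist_le : cg; apply.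
pose C := expR (4 * dl)^-1.
have bound n tau : 0 < tau ->
    levy (s_ n) tau <= levy (s_ n) tau * g tau + (eps / 2 * levy (s_ n) tau + s_ n * C * levy 1 tau).
  move=> t0; have l1 : 0 <= levy 1 tau by rewrite levy_ge0.
  have sC0 : 0 <= s_ n * C by rewrite mulr_ge0 ?expR_ge0// ltW.
  have [td|dt] := ltP tau dl.
    have gt : 1 - g tau <= eps / 2.
      apply: le_trans (ler_norm _) _; apply: hdl => //=.
      by rewrite /ball/= sub0r normrN gtr0_norm.
    have : levy (s_ n) tau * (1 - g tau) <= levy (s_ n) tau * (eps / 2) by rewrite ler_wpM2l.
    have : 0 <= s_ n * C * levy 1 tau by rewrite mulr_ge0.
    by rewrite mulrBr mulr1; lra.
  have h1 : levy (s_ n) tau <= s_ n * C * levy 1 tau.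
    pose w : R := (2 * Num.sqrt pi)^-1 * (tau `^ (3 / 2))^-1.
    have w0 : 0 <= w by rewrite mulr_ge0 ?invr_ge0 ?powR_ge0 ?mulr_ge0.
    have E y : levy y tau = y * w * expR (- (y ^+ 2 / (4 * tau))) by rewrite /levy /w; ring.
    rewrite !E mul1r (_ : s_ n * C * _ = s_ n * w * (C * expR (- (1 ^+ 2 / (4 * tau))))); last by ring.
    apply: ler_wpM2l; first by rewrite mulr_ge0// ltW.
    rewrite -expRD ler_expR expr1n.
    have : (4 * tau)^-1 <= (4 * dl)^-1.
      by rewrite lef_pV2 ?posrE ?mulr_gt0// ler_pM2l.
    have : 0 <= s_ n ^+ 2 / (4 * tau) by rewrite divr_ge0 ?sqr_ge0// mulr_ge0// ltW.
    by rewrite mul1r; lra.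
  have : 0 <= levy (s_ n) tau * g tau by rewrite mulr_ge0.
  have : 0 <= eps / 2 * levy (s_ n) tau by rewrite mulr_ge0// ltW.
  lra.
have lower n : 1 <= fine (\int[mu]_(tau in Rpos) (levy (s_ n) tau * g tau)%:E)%E +
    (eps / 2 + s_ n * C).
  rewrite -lee_fin EFinD fineK// -(integral_levy (s0 n)).
  have -> : (eps / 2 + s_ n * C)%:E = (\int[mu]_(tau in Rpos)
      ((eps / 2 * levy (s_ n) tau)%:E + (s_ n * C * levy 1 tau)%:E))%E.
    have C0 : 0 <= s_ n * C by rewrite mulr_ge0 ?expR_ge0// ltW.
    rewrite ge0_integralD//; last 4 first.
    - by move=> tau _; rewrite lee_fin mulr_ge0// ltW.
    - exact: mE (mcl _ _).
    - by move=> tau _; rewrite lee_fin mulr_ge0// levy_ge0.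
    - exact: mE (mcl _ _).
    under eq_integral do rewrite EFinM.
    under [X in (_ + X)%E]eq_integral do rewrite EFinM.
    rewrite !ge0_integralZl_EFin//.
    - by rewrite !integral_levy// !mule1 EFinD.
    - by move=> tau _; rewrite lee_fin levy_ge0.
    - exact: mE (ml _).
    - by move=> tau _; rewrite lee_fin.
    - exact: mE (ml _).
    - exact: ltW.
  rewrite -ge0_integralD//; last 4 first.
  - by move=> tau _; rewrite lee_fin mulr_ge0.
  - exact: mE (mlg n).
  - move=> tau _; rewrite -EFinD lee_fin; apply: addr_ge0; apply: mulr_ge0 => //.
    + exact: ltW.
    + by rewrite mulr_ge0 ?expR_ge0// ltW.
    + exact: levy_ge0.
  - by apply: emeasurable_funD; exact: mE (mcl _ _).
  apply: ge0_le_integral => //.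
  - by move=> tau _; rewrite lee_fin.
  - exact: mE (ml _).
  - apply: emeasurable_funD; first exact: mE (mlg n).
    by apply: emeasurable_funD; exact: mE (mcl _ _).
  by move=> tau; rewrite /= in_itv/= andbT -!EFinD lee_fin => t0; exact: bound.
have cs : s_ n * C @[n --> \oo] --> (0 : R).
  rewrite -[X in _ --> X](mul0r C); apply: cvgM; last exact: cvg_cst.
  exact: cvg_harmonic.
have hs : \forall n \near \oo, s_ n * C <= eps / 2.
  by have := cvgr_le _ cs; apply.
near=> n.
have hn : s_ n * C <= eps / 2 by near: n.
have up : fine (\int[mu]_(tau in Rpos) (levy (s_ n) tau * g tau)%:E)%E <= 1.
  by rewrite -lee_fin fineK.
rewrite ger0_norm ?subr_ge0//; have := lower n; rewrite -/(s_ n); lra.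
Unshelve. all: by end_near. Qed.

End levy_derivative.

(** * The kernel on space-time *)

Section extended_levy.
Context {R : realType}.
Implicit Types (s t y tau x : R).
Notation mu := (@lebesgue_measure R).
Local Notation Rpos := (`]0%R, +oo[%classic : set R).

(** Extended by 0 to negative times, so that the kernel on space-time does not
    let the future act. *)
Definition levy0 y tau : R := if 0 < tau then levy y tau else 0.

Lemma levy0_ge0 y tau : 0 <= y -> 0 <= levy0 y tau.
Proof. by move=> y0; rewrite /levy0; case: ifP => // _; exact: levy_ge0. Qed.

Lemma measurable_levy0_comp d (T : measurableType d) (y : R) (tau : T -> R) :
  measurable_fun setT tau -> measurable_fun setT (fun u => levy0 y (tau u)).
Proof.
move=> mt; rewrite /levy0; apply: measurable_fun_ifT => //.
- exact: measurable_fun_ltr.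
- exact: measurable_levy_comp.
Qed.

Lemma measurable_levy0 y : measurable_fun setT (levy0 y).
Proof. exact: measurable_levy0_comp. Qed.

Lemma integral_levy0 y : 0 < y -> (\int[mu]_x (levy0 y x)%:E = 1)%E.
Proof.
move=> y0; rewrite -(integral_levy y0) [RHS]integral_mkcond; apply: eq_integral => x _.
rewrite /levy0 /patch; case: ifPn => x0.
  by rewrite mem_set//= in_itv/= x0.
by rewrite memNset//= in_itv/= andbT; exact/negP.
Qed.

Lemma levy0_convolution s t tau : 0 < s -> 0 < t ->
  (\int[mu]_x (levy0 s x * levy0 t (tau - x))%:E = (levy0 (s + t) tau)%:E)%E.
Proof.
move=> s0 t0; rewrite {3}/levy0; case: ifPn => [tau0|tau0].
  rewrite -(levy_convolution s0 t0 tau0) [RHS]integral_mkcond; apply: eq_integral => x _.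
  rewrite /levy0 /patch subr_gt0; have [x0|x0] := ltP 0 x; have [xt|xt] := ltP x tau.
  - by rewrite mem_set//= in_itv/= x0.
  - by rewrite mulr0 memNset//= in_itv/= x0 ltNge xt.
  - by rewrite mul0r memNset//= in_itv/= ltNge x0.
  - by rewrite mul0r memNset//= in_itv/= ltNge x0.
under eq_integral => x _.
  rewrite (_ : levy0 s x * levy0 t (tau - x) = 0); first over.
  rewrite /levy0 subr_gt0; have [x0|x0] := ltP 0 x; last by rewrite mul0r.
  rewrite ifN ?mulr0// -leNgt; apply: le_trans (ltW x0); rewrite leNgt; exact: tau0.
by rewrite integral_cst//= mul0e.
Qed.

Lemma is_derive_levy0 y tau :
  derivable (levy0 ^~ tau) y 1.
Proof.
rewrite /levy0; have [t0|_] := boolP (0 < tau); last by [].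
by have [] := is_derive_levy y t0.
Qed.

Lemma levy0_deriv_le a y tau : 0 < a -> a <= y ->
  `|derive1 (levy0 ^~ tau) y| <= 6 / a * levy0 (a / 2) tau.
Proof.
move=> a0 ay; rewrite /levy0; case: ifPn => t0; first exact: levy_deriv_le.
by rewrite derive1_cst normr0 mulr0.
Qed.

End extended_levy.

Section spacetime_kernel.
Context {R : realType} (n : nat).
Local Notation T := (spacetime R n).
Local Notation leb := (@lebesgue_measure R).
Local Notation lebn := (lebesgue_Rn R n).
Local Notation mu := ((leb \x lebn)%E).
Implicit Types (p q r : T) (s t y tau a : R) (x z : Rn R n).

Definition spacetime_kernel y p q : R :=
  levy0 y ((p.1 : R) - q.1) * mehler_kernel ((p.1 : R) - q.1) p.2 q.2.

Lemma spacetime_kernel_ge0 y p q : 0 <= y -> 0 <= spacetime_kernel y p q.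
Proof. by move=> y0; rewrite mulr_ge0 ?levy0_ge0 ?mehler_kernel_ge0. Qed.

Lemma measurable_spacetime_kernel_comp d (U : measurableType d) y (p q : U -> T) :
  measurable_fun setT p -> measurable_fun setT q ->
  measurable_fun setT (fun u => spacetime_kernel y (p u) (q u)).
Proof.
move=> mp mq.
have m1 (f : U -> T) : measurable_fun setT f -> measurable_fun setT (fun u => (f u).1 : R).
  by move=> mf; exact: (measurableT_comp measurable_fst mf).
have m2 (f : U -> T) : measurable_fun setT f -> measurable_fun setT (fun u => (f u).2).
  by move=> mf; exact: (measurableT_comp measurable_snd mf).
have mt : measurable_fun setT (fun u => ((p u).1 : R) - (q u).1).
  by apply: measurable_funB; exact: m1.
apply: measurable_funM; first exact: measurable_levy0_comp.
by apply: measurable_mehler_kernel_comp => //; exact: m2.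
Qed.

(** In elapsed time tau > 0 the mass in space is at most 1; for tau <= 0, where
    the formula for the Mehler kernel is meaningless, the factor levy0
    vanishes. *)
Lemma levy0_mehler_mass y tau x : 0 < y ->
  (\int[lebn]_z (levy0 y tau * mehler_kernel tau x z)%:E <= (levy0 y tau)%:E)%E.
Proof.
move=> y0; rewrite /levy0; case: ifPn => t0; last first.
  by under eq_integral do rewrite mul0r; rewrite integral_cst//= mul0e.
under eq_integral do rewrite EFinM; rewrite ge0_integralZl_EFin//.
- rewrite -[leRHS]mule1; apply: lee_wpmul2l; last exact: integral_mehler_kernel_le1.
  by rewrite lee_fin levy_ge0// ltW.
- by move=> z _; rewrite lee_fin mehler_kernel_ge0.
- by apply/measurable_EFinP; exact: measurable_mehler_kernel.
- by rewrite levy_ge0// ltW.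
Qed.

Lemma spacetime_kernel_mass y p : 0 < y ->
  (\int[mu]_q (spacetime_kernel y p q)%:E <= 1)%E.
Proof.
move=> y0; have k0 q : (0 <= (spacetime_kernel y p q)%:E)%E.
  by rewrite lee_fin spacetime_kernel_ge0// ltW.
have mk : measurable_fun setT (fun q : T => (spacetime_kernel y p q)%:E).
  by apply/measurable_EFinP; exact: measurable_spacetime_kernel_comp.
rewrite (fubini_tonelli1 (fun q : T => (spacetime_kernel y p q)%:E))//.
rewrite -(integral_levy0 y0) -(@ge0_integral_reflect R (p.1 : R) (fun w => (levy0 y w)%:E)); last 2 first.
- by apply/measurable_EFinP; exact: measurable_levy0.
- by move=> x; rewrite lee_fin levy0_ge0// ltW.
apply: ge0_le_integral => //.
- by move=> t _; apply: integral_ge0.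
- exact: measurable_fun_fubini_tonelli_F.
- by apply/measurable_EFinP; apply: measurable_levy0_comp; exact: measurable_funB.
- by move=> t _; exact: (levy0_mehler_mass ((p.1 : R) - t) p.2 y0).
Qed.

Lemma spacetime_kernel_dual_mass y q : 0 < y ->
  (\int[mu]_p (spacetime_kernel y p q)%:E <= 1)%E.
Proof.
move=> y0; have k0 p : (0 <= (spacetime_kernel y p q)%:E)%E.
  by rewrite lee_fin spacetime_kernel_ge0// ltW.
have mk : measurable_fun setT (fun p : T => (spacetime_kernel y p q)%:E).
  by apply/measurable_EFinP; exact: measurable_spacetime_kernel_comp.
rewrite (fubini_tonelli1 (fun p : T => (spacetime_kernel y p q)%:E))//.
rewrite -(integral_levy0 y0) -(@ge0_integral_translate R (q.1 : R) (fun w => (levy0 y w)%:E)); last 2 first.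
- by apply/measurable_EFinP; exact: measurable_levy0.
- by move=> x; rewrite lee_fin levy0_ge0// ltW.
apply: ge0_le_integral => //.
- by move=> t _; apply: integral_ge0.
- exact: measurable_fun_fubini_tonelli_F.
- by apply/measurable_EFinP; apply: measurable_levy0_comp; exact: measurable_funB.
- move=> t _; apply: le_trans (levy0_mehler_mass ((t : R) - q.1) q.2 y0).
  by rewrite /fubini_F /spacetime_kernel /=; under eq_integral do rewrite mehler_kernelC.
Qed.

(** In space the Mehler kernels compose, and the elapsed times add up; what is
    left is the convolution of the stable densities. *)
Lemma spacetime_kernel_chapman s t p q : 0 < s -> 0 < t ->
  (\int[mu]_r (spacetime_kernel s p r * spacetime_kernel t r q)%:E =
   (spacetime_kernel (s + t) p q)%:E)%E.
Proof.
move=> s0 t0; pose F r := (spacetime_kernel s p r * spacetime_kernel t r q)%:E.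
have F0 r : (0 <= F r)%E by rewrite lee_fin mulr_ge0// spacetime_kernel_ge0// ltW.
have mF : measurable_fun setT F.
  apply/measurable_EFinP; apply: measurable_funM; exact: measurable_spacetime_kernel_comp.
rewrite (fubini_tonelli1 F)//.
pose m := mehler_kernel ((p.1 : R) - q.1) p.2 q.2.
pose tau : R := (p.1 : R) - q.1.
have tel (a b c : R) : a - b + (b - c) = a - c by ring.
have -> : (\int[leb]_t' fubini_F lebn F t' =
    \int[leb]_t' (m%:E * (levy0 s ((p.1 : R) - t') * levy0 t (tau - ((p.1 : R) - t')))%:E))%E.
  apply: eq_integral => t' _; rewrite /fubini_F /F /spacetime_kernel /=.
  have -> : tau - ((p.1 : R) - t') = t' - q.1 by rewrite /tau; ring.
  rewrite -EFinM {3 4}/levy0; case: (ltP 0 ((p.1 : R) - t')) => h1; last first.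
    under eq_integral => z _ do rewrite {1}/levy0 ifN ?mul0r -?leNgt//.
    by rewrite mul0r mulr0 integral_cst//= mul0e.
  case: (ltP 0 (t' - q.1)) => h2; last first.
    under eq_integral => z _ do rewrite {2}/levy0 (ifN _ _ (_ : ~~ (0 < t' - q.1))) ?mul0r ?mulr0 -?leNgt//.
    by rewrite !mulr0 integral_cst//= mul0e.
  under eq_integral => z _ do rewrite mulrACA EFinM.
  rewrite ge0_integralZl_EFin//.
  - by rewrite (mehler_kernel_semigroup p.2 q.2 h1 h2) -EFinM mulrC tel -/m /levy0 h1 h2.
  - by move=> z _; rewrite lee_fin mulr_ge0// mehler_kernel_ge0.
  - apply/measurable_EFinP; apply: measurable_funM; exact: measurable_mehler_kernel_comp.
  - by rewrite mulr_ge0// levy0_ge0// ltW.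
have mL : measurable_fun setT (fun w => (levy0 s w * levy0 t (tau - w))%:E).
  apply/measurable_EFinP; apply: measurable_funM; first exact: measurable_levy0.
  by apply: measurable_levy0_comp; exact: measurable_funB.
have L0 (w : R) : (0 <= (levy0 s w * levy0 t (tau - w))%:E)%E.
  by rewrite lee_fin mulr_ge0// levy0_ge0// ltW.
rewrite ge0_integralZl_EFin//.
- rewrite (@ge0_integral_reflect R (p.1 : R) (fun w => (levy0 s w * levy0 t (tau - w))%:E))//.
  by rewrite levy0_convolution// -EFinM mulrC.
- apply: (measurableT_comp mL); exact: measurable_funB.
- exact: mehler_kernel_ge0.
Qed.

Lemma spacetime_kernel_derivable y p q : derivable (fun s => spacetime_kernel s p q) y 1.
Proof.
apply: derivableM; last exact: derivable_cst.
exact: is_derive_levy0.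
Qed.

Lemma spacetime_kernel_deriv_le a y p q : 0 < a -> a <= y ->
  `|derive1 (fun s => spacetime_kernel s p q) y| <= 6 / a * spacetime_kernel (a / 2) p q.
Proof.
move=> a0 ay; rewrite derive1E.
have h : is_derive y 1 (levy0 ^~ ((p.1 : R) - q.1)) (derive1 (levy0 ^~ ((p.1 : R) - q.1)) y).
  by rewrite derive1E; apply/derivableP; exact: is_derive_levy0.
have h2 := is_deriveZ (mehler_kernel ((p.1 : R) - q.1) p.2 q.2) h.
have -> : (fun s => spacetime_kernel s p q) =
    (mehler_kernel ((p.1 : R) - q.1) p.2 q.2) \*: (levy0 ^~ ((p.1 : R) - q.1)).
  by apply/funext => s; rewrite /spacetime_kernel mulrC.
have [_ ->] := h2; rewrite /GRing.scale/= normrM (ger0_norm (mehler_kernel_ge0 _ _ _)).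
rewrite /spacetime_kernel mulrA [leRHS]mulrC.
by apply: ler_wpM2l; [exact: mehler_kernel_ge0|exact: levy0_deriv_le].
Qed.

End spacetime_kernel.

(** * Bounded open boxes and concentration of the kernel *)

Section open_boxes.
Context {R : realType} (n : nat).
Local Notation T := (spacetime R n).
Local Notation leb := (@lebesgue_measure R).
Local Notation lebn := (lebesgue_Rn R n).
Local Notation mu := ((leb \x lebn)%E).
Local Notation Rpos := (`]0%R, +oo[%classic : set R).
Implicit Types (p q : T) (J : 'I_n -> set R).

Definition box_base J : set (Rn R n) := [set z | forall i, J i (tnth z i)].

Definition open_box (J0 : set R) J : set T := [set p | J0 p.1 /\ box_base J p.2].

Definition bounded_open (m : R) (A : set R) := open A /\ A `<=` `](- m), m[%classic.

(** Boxes because the mass of the kernel on them factorizes, open so that they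
    contain a neighbourhood of each of their points, bounded so that they have
    finite measure. *)
Definition boxes : set (set T) := [set A | exists (m : R) (J0 : set R) J,
  [/\ bounded_open m J0, forall i, bounded_open m (J i) & A = open_box J0 J]].

Lemma bounded_open_itv (m : R) : bounded_open m `](- m), m[%classic.
Proof. by split=> //; exact: interval_open. Qed.

Lemma bounded_openI (m m' : R) (A B : set R) : bounded_open m A -> bounded_open m' B ->
  bounded_open m (A `&` B).
Proof. by move=> [oA Am] [oB _]; split; [exact: openI|move=> x [/Am]]. Qed.

Lemma measurable_box_base J : (forall i, open (J i)) -> measurable (box_base J).
Proof.
move=> oJ; rewrite (_ : box_base J =
    \bigcap_(i in setT) ((fun x : Rn R n => tnth x i) @^-1` (J i))).
  apply: fin_bigcap_measurable => // i _.
  rewrite -[X in measurable X]setTI; apply: measurable_tnth => //.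
  exact: open_measurable.
by apply/seteqP; split => x H i; [move=> _; exact: (H i)|exact: (H i I)].
Qed.

Lemma open_boxE (J0 : set R) J : open_box J0 J = J0 `*` box_base J.
Proof. by []. Qed.

Lemma measurable_open_box (J0 : set R) J : open J0 -> (forall i, open (J i)) ->
  measurable (open_box J0 J).
Proof.
move=> oJ0 oJ; rewrite open_boxE; apply: measurableX; last exact: measurable_box_base.
exact: open_measurable.
Qed.

Lemma boxes_setI : setI_closed boxes.
Proof.
move=> _ _ [m [J0 [J [b0 b ->]]]] [m' [J0' [J' [b0' b' ->]]]].
exists m, (J0 `&` J0'), (fun i => J i `&` J' i); split.
- exact: bounded_openI b0'.
- by move=> i; exact: bounded_openI (b' i).
apply/seteqP; split=> p.
  by move=> [[h1 h2] [h3 h4]]; split => [//|i]; split.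
by move=> [[h1 h3] h]; split; split=> // i; have [] := h i.
Qed.

Lemma point_in_box p : exists m : nat,
  `](- m%:R), m%:R[%classic (p.1 : R) /\ forall i, `](- m%:R), m%:R[%classic (tnth p.2 i : R).
Proof.
pose S : R := `|p.1 : R| + \sum_i `|tnth p.2 i : R|.
have S0 : 0 <= S by rewrite addr_ge0// sumr_ge0.
have Sm := archi_boundP S0; set m := Num.bound S in Sm.
have itv (a : R) : `|a| <= S -> `](- m%:R), m%:R[%classic a.
  by move=> aS; rewrite /= in_itv/= -ltr_norml (le_lt_trans aS).
exists m; split=> [|i]; apply: itv; first by rewrite lerDl sumr_ge0.
by rewrite /S (bigD1 i)//= addrCA lerDl addr_ge0// sumr_ge0.
Qed.

(** Every coordinate is measurable for the sigma-algebra of boxes: the inverse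
    image of an interval is the union over m of its intersections with the
    cubes of side 2 m. *)
Lemma boxes_generate : measurable = <<s boxes >> :> set (set T).
Proof.
apply/seteqP; split; last first.
  apply: smallest_sub; first exact: sigma_algebra_measurable.
  by move=> _ [m [J0 [J [[u0 _] u ->]]]]; apply: measurable_open_box => // i; have [] := u i.
pose S : measurableType _ := g_sigma_algebraType boxes.
have proj (f : S -> measurableTypeR R) (J0 : R -> R -> nat -> set R)
    (J : R -> R -> nat -> 'I_n -> set R) :
    (forall a b m, bounded_open m%:R (J0 a b m)) ->
    (forall a b m i, bounded_open m%:R (J a b m i)) ->
    (forall a b, f @^-1` `]a, b[%classic = \bigcup_m open_box (J0 a b m) (J a b m)) ->
    measurable_fun setT f.
  move=> b0 b fE; apply: (measurability _ (RGenOpens.measurableE R)).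
  move=> _ [_ [a [c ->]] <-]; rewrite setTI fE; apply: bigcupT_measurable => m.
  apply: sub_sigma_algebra; exists m%:R, (J0 a c m), (J a c m); split=> //.
pose I_ (m : nat) : set R := `](- m%:R), m%:R[%classic.
have bI m : bounded_open m%:R (I_ m) by exact: bounded_open_itv.
have bIab a b m : bounded_open m%:R (I_ m `&` `]a, b[%classic).
  by split; [apply: openI => //; exact: interval_open|move=> x []].
have m1 : measurable_fun setT (fun u : S => (u : T).1).
  apply: (proj _ (fun a b m => I_ m `&` `]a, b[%classic) (fun _ _ m _ => I_ m)) => // a b.
  apply/seteqP; split=> p; last by move=> [m _ [[]]].
  by move=> pab; have [m [h1 h2]] := point_in_box p; exists m => //; split.
have m2 i : measurable_fun setT (fun u : S => tnth (u : T).2 i).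
  apply: (proj _ (fun _ _ m => I_ m)
    (fun a b m j => if j == i then I_ m `&` `]a, b[%classic else I_ m)) => [//|a b m j|a b].
    by case: ifP.
  apply/seteqP; split=> p; last by move=> [m _ [_ /(_ i)]]; rewrite eqxx => -[].
  move=> pab; have [m [h1 h2]] := point_in_box p; exists m => //; split => // j.
  case: ifPn => [/eqP ->|_]; last exact: h2.
  by split; [exact: h2|].
have mid : measurable_fun setT (fun u : S => ((u : T).1, (u : T).2)).
  apply/measurable_fun_pair; first exact: m1.
  by apply/measurable_fun_tnthP => i; exact: m2.
move=> A mA; have := mid measurableT A mA; rewrite setTI.
by rewrite (_ : _ @^-1` A = A)//; apply/seteqP; split=> -[].
Qed.

Lemma boxes_finite A : boxes A -> (mu A < +oo)%E.
Proof.
move=> [m [J0 [J [[u0 b0] b ->]]]].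
have mJ0 : measurable J0 by exact: open_measurable.
have mJ i : measurable (J i) by apply: open_measurable; have [] := b i.
have fin (B : set R) : measurable B -> B `<=` `](- m), m[%classic -> (leb B \is a fin_num)%E.
  move=> mB Bm; rewrite ge0_fin_numE//.
  have : (leb `](- m)%R, m[%classic < +oo)%E by rewrite lebesgue_measure_itv/=; case: ifP; rewrite ?ltry.
  apply: le_lt_trans; apply: le_measure => //; rewrite inE//; exact: measurable_itv.
rewrite open_boxE product_measure1E//; last first.
  by apply: measurable_box_base => i; have [] := b i.
rewrite -ge0_fin_numE; last by rewrite mule_ge0.
rewrite fin_numM ?fin//; rewrite /box_base (lebesgue_Rn_box mJ).
elim/big_ind : _ => // [x y ? ?|i _]; first by rewrite fin_numM.
by apply: fin => //; have [] := b i.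
Qed.

(** In the elapsed time tau, the mass over the box is the integral of the
    stable density times g tau, where g tau is the Mehler mass of the base if
    p.1 - tau is still in J0. As tau -> 0 the function g tends to 1, so
    levy_approx_identity applies. *)
Lemma spacetime_kernel_concentrate (J0 : set R) J p : open J0 -> (forall i, open (J i)) ->
  open_box J0 J p ->
  fine (\int[mu]_(q in open_box J0 J) (spacetime_kernel i.+1%:R^-1 p q)%:E)
    @[i --> \oo] --> (1 : R).
Proof.
move=> oJ0 oJ [p0 pJ].
have mJ0 : measurable J0 by exact: open_measurable.
have mB := measurable_box_base oJ.
pose m (tau : R) : R := \int[lebn]_(z in box_base J) mehler_kernel tau p.2 z.
pose g (tau : R) : R := \1_J0 ((p.1 : R) - tau) * (if 0 < tau then m tau else 0).
have mm : measurable_fun setT m.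
  apply: (@measurable_fun_parametric_Rintegral _ _ _ _ _ lebn (box_base J)
    (fun u : measurableTypeR R * Rn R n => mehler_kernel u.1 p.2 u.2)) => //.
  exact: measurable_mehler_kernel_comp.
have mg : measurable_fun setT g.
  apply: measurable_funM.
    apply: (measurableT_comp (measurable_indic _)) => //; exact: measurable_funB.
  by apply: measurable_fun_ifT => //; exact: measurable_fun_ltr.
have mehler_le tau : 0 < tau ->
    (\int[lebn]_(z in box_base J) (mehler_kernel tau p.2 z)%:E <= 1)%E.
  move=> t0; apply: le_trans (integral_mehler_kernel_le1 p.2 t0).
  apply: ge0_subset_integral => //.
    by apply/measurable_EFinP; exact: measurable_mehler_kernel.
  by move=> z _; rewrite lee_fin mehler_kernel_ge0.
have mehler_ge0 tau : (0 <= \int[lebn]_(z in box_base J) (mehler_kernel tau p.2 z)%:E)%E.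
  by apply: integral_ge0 => z _; rewrite lee_fin mehler_kernel_ge0.
have mE tau : 0 < tau ->
    (\int[lebn]_(z in box_base J) (mehler_kernel tau p.2 z)%:E = (m tau)%:E)%E.
  move=> t0; rewrite /m /Rintegral fineK// ge0_fin_numE//.
  by rewrite (le_lt_trans (mehler_le _ t0))// ltry.
have g01 tau : 0 <= g tau <= 1.
  rewrite /g indicE; case: (_ \in J0); rewrite /= ?mul0r ?mul1r ?lexx ?ler01//.
  case: ifPn => t0; rewrite ?lexx ?ler01//.
  by rewrite -!lee_fin -mE// mehler_ge0 mehler_le.
have cg : g tau @[tau --> 0^'+] --> (1 : R).
  apply: cvg_trans (cvg_mehler_kernel_box oJ pJ); apply: near_eq_cvg; near=> tau.
  have t0 : 0 < tau by near: tau; exact: nbhs_right_gt.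
  rewrite /g t0 indicE mem_set ?mul1r//.
  near: tau.
  have cs : (p.1 : R) - tau @[tau --> 0^'+] --> (p.1 : R).
    rewrite -[X in _ --> X]subr0; apply: cvg_at_right_filter.
    by apply: cvgB; [exact: cvg_cst|exact: cvg_id].
  by apply: cs; exact: open_nbhs_nbhs.
apply: cvg_trans (levy_approx_identity mg g01 cg); apply: near_eq_cvg; apply: nearW => i.
set s := _^-1; have s0 : 0 < s by rewrite invr_gt0.
congr fine.
pose F (q : T) := (spacetime_kernel s p q * (\1_J0 (q.1 : R) * \1_(box_base J) q.2))%:E.
have F0 q : (0 <= F q)%E.
  rewrite lee_fin; apply: mulr_ge0; first by rewrite spacetime_kernel_ge0// ltW.
  by rewrite mulr_ge0// indicE.
have mF : measurable_fun setT F.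
  apply/measurable_EFinP; apply: measurable_funM; first exact: measurable_spacetime_kernel_comp.
  apply: measurable_funM; first exact: (measurableT_comp (measurable_indic mJ0)).
  exact: (measurableT_comp (measurable_indic mB)).
transitivity (\int[mu]_q F q)%E; last first.
  rewrite [RHS]integral_mkcond; apply: eq_integral => q _; rewrite /patch /F !indicE open_boxE.
  have [h|h] := pselect ((J0 `*` box_base J) q).
    by rewrite (mem_set h); have [h1 h2] := h; rewrite !mem_set// !mulr1.
  rewrite (memNset h); congr EFin.
  have [h1|h1] := boolP ((q.1 : R) \in J0); last by rewrite mul0r mulr0.
  rewrite (memNset (_ : ~ box_base J q.2)) ?mulr0// => h2.
  by apply: h; split=> //; exact: set_mem.
rewrite (fubini_tonelli1 F)//.
pose W (tau : R) := (levy0 s tau * g tau)%:E.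
have -> : (\int[leb]_t fubini_F lebn F t = \int[leb]_t W ((p.1 : R) - t)%R)%E.
  apply: eq_integral => t _; rewrite /fubini_F /F /W /spacetime_kernel /g /levy0 /=.
  case: ifPn => t0; last first.
    by under eq_integral do rewrite !mul0r; rewrite integral_cst//= mul0e mul0r.
  rewrite (_ : (p.1 : R) - (p.1 - t) = t); last by rewrite opprB addrCA subrr addr0.
  transitivity (\int[lebn]_z ((levy s ((p.1 : R) - t) * \1_J0 t)%:E *
      (mehler_kernel ((p.1 : R) - t) p.2 z * \1_(box_base J) z)%:E))%E.
    by apply: eq_integral => z _; rewrite -EFinM mulrACA.
  rewrite ge0_integralZl_EFin//; last 3 first.
  - by move=> z _; rewrite lee_fin mulr_ge0 ?mehler_kernel_ge0// indicE.
  - apply/measurable_EFinP; apply: measurable_funM; first exact: measurable_mehler_kernel.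
    exact: measurable_indic.
  - by apply: mulr_ge0; [rewrite levy_ge0// ltW|rewrite indicE].
  rewrite [X in (_ * X)%E](_ : _ = (m ((p.1 : R) - t))%:E); first by rewrite -EFinM -mulrA.
  rewrite -mE// [RHS]integral_mkcond; apply: eq_integral => z _.
  by rewrite /patch indicE; case: (z \in _); rewrite ?mulr1 ?mulr0.
rewrite ge0_integral_reflect; last 2 first.
- apply/measurable_EFinP; apply: measurable_funM => //; exact: measurable_levy0.
- move=> tau; rewrite lee_fin; apply: mulr_ge0; first by rewrite levy0_ge0// ltW.
  by have /andP[] := g01 tau.
rewrite [LHS]integral_mkcond; apply: eq_integral => tau _; rewrite /patch /W /levy0.
case: ifPn => t0; first by move: t0; rewrite inE /= in_itv/= andbT => ->.
by move: t0; rewrite notin_setE /= in_itv/= andbT => /negP/negbTE ->; rewrite mul0r.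
Unshelve. all: by end_near. Qed.

Lemma poisson_kernel_spacetime : poisson_kernel mu (@spacetime_kernel R n) 6.
Proof.
constructor.
- by [].
- by move=> y p q y0; rewrite spacetime_kernel_ge0// ltW.
- by move=> y _; exact: measurable_spacetime_kernel_comp.
- exact: spacetime_kernel_mass.
- exact: spacetime_kernel_dual_mass.
- exact: spacetime_kernel_chapman.
- by move=> y p q _; exact: spacetime_kernel_derivable.
- exact: spacetime_kernel_deriv_le.
pose I_ (m : nat) : set R := `](- m%:R), m%:R[%classic.
exists boxes, (fun m => open_box (I_ m) (fun _ => I_ m)); split.
- exact: boxes_generate.
- exact: boxes_setI.
- by move=> m; exists m%:R, (I_ m), (fun _ => I_ m); split=> // *; exact: bounded_open_itv.
- apply/seteqP; split=> // p _; have [m [h1 h2]] := point_in_box p.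
  by exists m => //; split.
move=> A bA; split; first exact: boxes_finite.
move: bA => [m [J0 [J [[u0 _] u ->]]]] p Ap.
by apply: spacetime_kernel_concentrate => // i; have [] := u i.
Qed.

End open_boxes.

(** * The Poisson semigroup on space-time *)

Section Rintegral_scaling.
Context d (T : measurableType d) {R : realType} (mu : {measure set T -> \bar R}).
Local Open Scope ereal_scope.

(** For a divergent integral both sides are 0, as fine sends infinities to 0.
    The defining formula of the semigroup, where the integrals are total as
    well, is rewritten with it. *)
Lemma Rintegral_scale (D : set T) (a : R) (f : T -> R) : measurable D -> (0 < a)%R ->
  measurable_fun D f -> (\int[mu]_(x in D) (a * f x) = a * \int[mu]_(x in D) f x)%R.
Proof.
move=> mD a0 mf; rewrite /Rintegral.
have mEf : measurable_fun D (EFin \o f) by exact/measurable_EFinP.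
have a0' : (0 <= a)%R by exact: ltW.
have -> : \int[mu]_(x in D) (a * f x)%:E = \int[mu]_(x in D) ((fun x => a%:E * (EFin \o f) x) x).
  by apply: eq_integral => x _; rewrite EFinM.
rewrite integralE [in RHS]integralE ge0_funeposM// ge0_funenegM//.
rewrite !ge0_integralZl_EFin//; last 2 first.
- exact: measurable_funeneg.
- exact: measurable_funepos.
have : 0 <= \int[mu]_(x in D) (EFin \o f)^\+ x by apply: integral_ge0.
have : 0 <= \int[mu]_(x in D) (EFin \o f)^\- x by apply: integral_ge0.
case: (\int[mu]_(x in D) (EFin \o f)^\+ x) => [u| |] //;
  case: (\int[mu]_(x in D) (EFin \o f)^\- x) => [v| |] // _ _.
- by rewrite -!EFinM -!EFinB /= mulrBr.
- by rewrite gt0_muley ?lte_fin//= mulr0.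
- by rewrite gt0_muley ?lte_fin//= mulr0.
- by rewrite gt0_muley ?lte_fin//= mulr0.
Qed.

End Rintegral_scaling.

Lemma Rintegral_reflect {R : realType} (t : R) (f : R -> R) : measurable_fun setT f ->
  \int[lebesgue_measure]_x f x = \int[lebesgue_measure]_x f (t - x).
Proof.
move=> mf; rewrite /Rintegral integralE [in RHS]integralE.
have mE : measurable_fun setT (EFin \o f) by exact/measurable_EFinP.
have Ep := ge0_integral_reflect t (measurable_funepos mE) (funepos_ge0 _).
have En := ge0_integral_reflect t (measurable_funeneg mE) (funeneg_ge0 _).
transitivity (fine (\int[lebesgue_measure]_x (EFin \o f)^\+ x - \int[lebesgue_measure]_x (EFin \o f)^\- x)%E) => //.
congr fine; congr (_ - _)%E.
  by rewrite -Ep; apply: eq_integral => x _; rewrite !funeposE.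
by rewrite -En; apply: eq_integral => x _; rewrite !funenegE.
Qed.

Section spacetime_measure.
Context {R : realType} (n : nat).
Local Notation leb := (@lebesgue_measure R).

(** The Lebesgue measure of space-time, under a name that can carry the
    sigma-finite structure required by Fubini. *)
Definition spacetime_measure : set (spacetime R n) -> \bar R := (leb \x lebesgue_Rn R n)%E.

HB.instance Definition _ := Measure.copy spacetime_measure (lebesgue_spacetime R n).

Lemma spacetime_measure_sigma_finite : sigma_finite setT spacetime_measure.
Proof.
pose I_ (m : nat) : set R := `](- m%:R), m%:R[%classic.
have bI m : bounded_open m%:R (I_ m) by exact: bounded_open_itv.
have box m : boxes (open_box (I_ m) (fun _ : 'I_n => I_ m)).
  by exists m%:R, (I_ m), (fun _ => I_ m).
exists (fun m => open_box (I_ m) (fun _ : 'I_n => I_ m)).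
  apply/esym/seteqP; split=> // p _; have [m [h1 h2]] := point_in_box p.
  by exists m => //; split.
move=> m; split; last exact: boxes_finite.
by apply: measurable_open_box => [|i]; have [] := bI m.
Qed.

HB.instance Definition _ := Measure_isSigmaFinite.Build _ _ _ spacetime_measure
  spacetime_measure_sigma_finite.

End spacetime_measure.

Section poissonL_semigroup.
Context {R : realType} (n : nat).
Local Notation T := (spacetime R n).
Local Notation leb := (@lebesgue_measure R).
Local Notation lebn := (lebesgue_Rn R n).
Local Notation mu := ((leb \x lebn)%E).
Local Notation Rpos := (`]0%R, +oo[%classic : set R).
Implicit Types (f g : T -> R) (p q : T) (s t y tau : R).

(** The time variable of the formula is the elapsed time tau; substituting s =
    p.1 - tau turns the iterated integral into one over space-time. *)
Lemma poissonL_kernel y f p : 0 < y -> measurable_fun setT f ->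
  mu.-integrable setT (EFin \o (fun q => spacetime_kernel y p q * f q)) ->
  poissonL y f p = \int[mu]_q (spacetime_kernel y p q * f q).
Proof.
move=> y0 mf intf; have sp := @sqrtpi_gt0 R.
have mk : measurable_fun setT (fun q : T => spacetime_kernel y p q * f q).
  by apply: measurable_funM => //; exact: measurable_spacetime_kernel_comp.
rewrite (Rintegral_prod intf) (@Rintegral_reflect R (p.1 : R)); last first.
  exact: (@measurable_fun_parametric_Rintegral _ _ _ _ _ lebn setT
    (fun q : T => spacetime_kernel y p q * f q)).
have c0 : 0 < y / (2 * Num.sqrt pi) by rewrite divr_gt0// mulr_gt0.
pose m2 (u : measurableTypeR R * Rn R n) :=
  mehler_kernel (u.1 : R) p.2 u.2 * f ((p.1 : R) - u.1, u.2).
have mshift : measurable_fun setT (fun u : measurableTypeR R * Rn R n =>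
    f ((p.1 : R) - u.1, u.2)).
  apply: (measurableT_comp mf); apply/measurable_fun_pair => //=.
  by apply: measurable_funB => //; exact: (measurableT_comp measurable_fst).
have mm2 : measurable_fun setT m2.
  by apply: measurable_funM => //; exact: measurable_mehler_kernel_comp.
have mm2r (tau : measurableTypeR R) : measurable_fun setT (fun z => m2 (tau, z)).
  exact: (measurableT_comp mm2 (measurable_pair1 tau)).
have mI : measurable_fun setT (fun tau : measurableTypeR R => \int[lebn]_z m2 (tau, z)).
  exact: (@measurable_fun_parametric_Rintegral _ _ _ _ _ lebn setT m2).
rewrite /poissonL -Rintegral_scale//; last first.
  apply: measurable_funTS; apply: measurable_funM.
    apply: (@measurable_fun_parametric_Rintegral _ _ _ _ _ lebn setT
      (fun u : measurableTypeR R * Rn R n => expR (- (y ^+ 2 / (4 * u.1))) *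
        mehler_kernel (u.1 : R) p.2 u.2 * f ((p.1 : R) - u.1, u.2))) => //.
    apply: measurable_funM => //; apply: measurable_funM; last exact: measurable_mehler_kernel_comp.
    apply: measurableT_comp => //; apply: measurableT_comp => //.
    apply: measurable_funM => //; apply: measurable_funV; apply: measurable_funM => //.
  by apply: measurable_funV; exact: (measurableT_comp (measurable_powR _)).
rewrite Rintegral_mkcond; apply: eq_Rintegral => tau _; rewrite /patch.
rewrite /spacetime_kernel /levy0 /= (_ : (p.1 : R) - (p.1 - tau) = tau); last first.
  by rewrite opprB addrCA subrr addr0.
case: ifPn => [|].
  rewrite inE /= in_itv/= andbT => t0; rewrite t0.
  have l0 : 0 < levy y tau by rewrite /levy divr_gt0 ?powR_gt0// mulr_gt0 ?expR_gt0.
  have -> : \int[lebn]_z (levy y tau * mehler_kernel tau p.2 z * f ((p.1 : R) - tau, z)) =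
      levy y tau * \int[lebn]_z m2 (tau, z).
    by rewrite -Rintegral_scale//; apply: eq_Rintegral => z _; rewrite /m2 /= mulrA.
  have -> : \int[lebn]_z (expR (- (y ^+ 2 / (4 * tau))) * mehler_kernel tau p.2 z *
      f ((p.1 : R) - tau, z)) = expR (- (y ^+ 2 / (4 * tau))) * \int[lebn]_z m2 (tau, z).
    rewrite -Rintegral_scale ?expR_gt0//.
    by apply: eq_Rintegral => z _; rewrite /m2 /= mulrA.
  by rewrite /levy; ring.
move=> h; have /negbTE -> : ~~ (0 < tau).
  by move: h; rewrite notin_setE /= in_itv/= andbT => /negP.
under eq_Rintegral do rewrite !mul0r.
by rewrite Rintegral_cst// mul0r.
Qed.

Lemma measurable_poissonL f : measurable_fun setT f ->
  measurable_fun setT (fun u : measurableTypeR R * T => poissonL u.1 f u.2).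
Proof.
move=> mf.
pose V := ((measurableTypeR R * T) * measurableTypeR R)%type.
pose in1 (w : V * Rn R n) : R := expR (- ((w.1.1.1 : R) ^+ 2 / (4 * w.1.2))) *
  mehler_kernel (w.1.2 : R) w.1.1.2.2 w.2 * f ((w.1.1.2.1 : R) - w.1.2, w.2).
have m1 : measurable_fun setT (fun w : V * Rn R n => w.1.1.1 : R).
  by do 2! apply: (measurableT_comp measurable_fst).
have m2 : measurable_fun setT (fun w : V * Rn R n => w.1.2 : R).
  by apply: (measurableT_comp measurable_snd).
have m3 : measurable_fun setT (fun w : V * Rn R n => w.1.1.2).
  by apply: (measurableT_comp measurable_snd); apply: (measurableT_comp measurable_fst).
have min1 : measurable_fun setT in1.
  apply: measurable_funM; [apply: measurable_funM|].
  - apply: measurableT_comp => //; apply: measurableT_comp => //; apply: measurable_funM.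
      exact: measurable_funX.
    by apply: measurable_funV; apply: measurable_funM.
  - apply: measurable_mehler_kernel_comp => //.
    by apply: (measurableT_comp measurable_snd).
  - apply: (measurableT_comp mf); apply/measurable_fun_pair => //=.
    by apply: measurable_funB => //; apply: (measurableT_comp measurable_fst).
have mout : measurable_fun setT (fun v : V => \int[lebn]_z in1 (v, z) / (v.2 : R) `^ (3 / 2)).
  apply: measurable_funM.
    exact: (@measurable_fun_parametric_Rintegral _ _ _ _ _ lebn setT in1).
  by apply: measurable_funV; exact: (measurableT_comp (measurable_powR _)).
apply: measurable_funM.
  by apply: measurable_funM => //; exact: measurable_fst.
exact: (@measurable_fun_parametric_Rintegral _ _ _ _ _ leb Rpos
  (fun v : V => \int[lebn]_z in1 (v, z) / (v.2 : R) `^ (3 / 2))).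
Qed.

(** The constant 6 is that of levy_deriv_le. *)
Lemma smoothing_semigroup_poissonL :
  smoothing_semigroup (lebesgue_spacetime R n) (@poissonL R n) 6.
Proof.
pose mu' : {sigma_finite_measure set T -> \bar R} := @spacetime_measure R n.
have PK : poisson_kernel mu' (@spacetime_kernel R n) 6 := @poisson_kernel_spacetime R n.
apply: (@kernel_smoothing_semigroup _ T R mu' _ _ PK (@poissonL R n)).
  by move=> M f [mf _]; exact: measurable_poissonL.
move=> y M f g p y0 mf bg fg; have [mg gM] := bg.
have mk : measurable_fun setT (spacetime_kernel y p).
  exact: measurable_spacetime_kernel_comp.
have intg := integrable_kernelM PK p y0 bg.
have ae_fg : ae_eq mu setT (fun q => (spacetime_kernel y p q * g q)%:E)
    (fun q => (spacetime_kernel y p q * f q)%:E).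
  by apply: filterS fg => q -> _.
have intf : mu.-integrable setT (EFin \o (fun q => spacetime_kernel y p q * f q)).
  have mkf : measurable_fun setT (fun q => (spacetime_kernel y p q * f q)%:E).
    by apply/measurable_EFinP; exact: measurable_funM.
  apply/integrableP; split=> //; have /integrableP[mkg] := intg.
  congr (_ < _)%E; apply: ae_eq_integral => //.
  - exact: measurableT_comp.
  - exact: measurableT_comp.
  by apply: filterS fg => q /= -> _.
rewrite poissonL_kernel// /kernel_op /Rintegral; congr fine.
apply: ae_eq_integral => //.
- by apply/measurable_EFinP; exact: measurable_funM.
- by apply/measurable_EFinP; exact: measurable_funM.
by apply: filterS fg => q -> _.
Qed.

End poissonL_semigroup.

(** * Functions independent of time *)

Section time_independent.
Context {R : realType} (n : nat).
Local Notation T := (spacetime R n).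
Local Notation leb := (@lebesgue_measure R).
Local Notation lebn := (lebesgue_Rn R n).
Local Notation mu := (lebesgue_spacetime R n).
Implicit Types (g h : Rn R n -> R).

(** A null set of space-time has null sections at almost every time, and one
    such time is enough when the property does not depend on it. *)
Lemma ae_time_independent (Q : Rn R n -> Prop) :
  {ae mu, forall p, Q p.2} <-> {ae lebn, forall x, Q x}.
Proof.
split=> [[A [mA A0 QA]]|[A [mA A0 QA]]]; last first.
  exists (setT `*` A); split; first exact: measurableX.
  - by rewrite /lebesgue_spacetime /= product_measure1E// A0 mule0.
  - by move=> p /= Qp; split=> //; exact: QA.
have int0 : (\int[leb]_t `|(lebn \o xsection A) t| = 0)%E.
  by rewrite -A0; apply: eq_integral => t _; rewrite gee0_abs.
have mS : measurable_fun setT (lebn \o xsection A) by exact: measurable_fun_xsection.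
have [N [mN N0 hN]] := (ae_eq_integral_abs leb measurableT mS).1 int0.
have [t Nt] : exists t, ~ N t.
  apply/existsNP => NT; have : leb setT = 0%E.
    by rewrite -N0; congr (leb _); apply/seteqP; split.
  move=> leb0; have : (leb `]0%R, 1%R[%classic <= leb setT)%E.
    by apply: le_measure => //; rewrite inE //; exact: measurable_itv.
  by rewrite leb0 lebesgue_measure_itv/= lte_fin ltr01 -EFinB subr0 lee_fin ler10.
exists (xsection A t); split; first exact: measurable_xsection.
- by apply: contrapT => h; apply: Nt; apply: hN => /(_ I).
- move=> x Qx; rewrite /xsection /= inE; exact: (QA (t, x)).
Qed.

Lemma Lnorm_time_independent h :
  Lnorm mu +oo (EFin \o (h \o snd)) = Lnorm lebn +oo (EFin \o h).
Proof.
apply/eqP; rewrite eq_le; apply/andP; split.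
- have := Lnorm_ge0 lebn +oo (EFin \o h).
  move E : (Lnorm lebn +oo (EFin \o h)) => [r|_|]; [|by rewrite leey|by rewrite leeNy_eq].
  rewrite lee_fin => r0; apply: Lnorm_infty_le => //.
  apply/(ae_time_independent (fun x => `|h x| <= r)).
  by apply: Lnorm_infty_ae; rewrite E.
- have := Lnorm_ge0 mu +oo (EFin \o (h \o snd)).
  move E : (Lnorm mu +oo (EFin \o (h \o snd))) => [r|_|]; [|by rewrite leey|by rewrite leeNy_eq].
  rewrite lee_fin => r0; apply: Lnorm_infty_le => //.
  apply/(ae_time_independent (fun x => `|h x| <= r)).
  by apply: Lnorm_infty_ae; rewrite E.
Qed.

Lemma Lfun_time_independent h :
  h \o snd \in Lfun mu +oo%E <-> h \in Lfun lebn +oo%E.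
Proof.
have Ln := Lnorm_time_independent h.
rewrite !inE; split=> /andP[]; rewrite !inE /= => mh; rewrite /finite_norm => fh.
- apply/andP; split; rewrite !inE /=; last by rewrite /finite_norm -Ln.
  have := measurableT_comp mh (measurable_pair1 (0 : measurableTypeR R)).
  by apply: eq_measurable_fun.
- apply/andP; split; rewrite !inE /=; last by rewrite /finite_norm Ln.
  exact: (measurableT_comp mh measurable_snd).
Qed.

Lemma lip_const_time_independent al g :
  lip_const mu (@poissonL R n) al (g \o snd) = lip_const lebn (@poissonH R n) al g.
Proof.
by apply/seteqP; split=> C hC y y0; have := hC y y0;
  rewrite -(Lnorm_time_independent (fun x => derive1n (lip_order al) (fun s => poissonH s g x) y)).
Qed.

Lemma Lip_time_independent al g :
  Lip mu (@poissonL R n) al (g \o snd) <-> Lip lebn (@poissonH R n) al g.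
Proof.
by rewrite /Lip /= lip_const_time_independent; split=> -[h1 h2]; split=> //;
  exact/(Lfun_time_independent g).
Qed.

Lemma Lip_norm_time_independent al g :
  Lip_norm mu (@poissonL R n) al (g \o snd) = Lip_norm lebn (@poissonH R n) al g.
Proof. by rewrite /Lip_norm lip_const_time_independent Lnorm_time_independent. Qed.

Lemma frac_integrand_time_independent be g (p : T) tau :
  frac_integrand (@poissonL R n) be (g \o snd) p tau =
  frac_integrand (@poissonH R n) be g p.2 tau.
Proof.
rewrite /frac_integrand; congr (_ / _).
suff -> m : iter m (fun (f : T -> R) q => poissonL tau f q - f q) (g \o snd) =
    (iter m (fun h x => poissonH tau h x - h x) g) \o snd by [].
elim: m => //= m IH.
by apply/funext => q /=; rewrite IH.
Qed.

Lemma frac_power_time_independent be g :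
  frac_power (@poissonL R n) be (g \o snd) = frac_power (@poissonH R n) be g \o snd.
Proof.
apply/funext => p; rewrite /frac_power /=; congr (_ * _).
by apply: eq_Rintegral => tau _; rewrite frac_integrand_time_independent.
Qed.

Lemma frac_power_defined_time_independent be g :
  frac_power_defined mu (@poissonL R n) be (g \o snd) ->
  frac_power_defined lebn (@poissonH R n) be g.
Proof.
move=> h; apply/ae_time_independent; apply: filterS h => p.
apply: eq_integrable => // tau _ /=.
by rewrite frac_integrand_time_independent.
Qed.

End time_independent.

Theorem theorem5 (R : realType) (n : nat) (alpha beta : R) :
  (0 < n)%N -> 0 < 2 * beta -> 2 * beta < alpha ->
  exists C : R,
    (forall f : spacetime R n -> R,
       Lip (lebesgue_spacetime R n) (@poissonL R n) alpha f ->
       [/\ frac_power_defined (lebesgue_spacetime R n) (@poissonL R n) beta f,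
           Lip (lebesgue_spacetime R n) (@poissonL R n) (alpha - 2 * beta)
             (frac_power (@poissonL R n) beta f) &
           Lip_norm (lebesgue_spacetime R n) (@poissonL R n) (alpha - 2 * beta)
             (frac_power (@poissonL R n) beta f) <=
           C * Lip_norm (lebesgue_spacetime R n) (@poissonL R n) alpha f]) /\
    (forall g : Rn R n -> R,
       Lip (lebesgue_Rn R n) (@poissonH R n) alpha g ->
       [/\ frac_power_defined (lebesgue_Rn R n) (@poissonH R n) beta g,
           Lip (lebesgue_Rn R n) (@poissonH R n) (alpha - 2 * beta)
             (frac_power (@poissonH R n) beta g) &
           Lip_norm (lebesgue_Rn R n) (@poissonH R n) (alpha - 2 * beta)
             (frac_power (@poissonH R n) beta g) <=
           C * Lip_norm (lebesgue_Rn R n) (@poissonH R n) alpha g]).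
Proof.
move=> _ be0 beal.
have [C _ HC] := frac_power_Lip (@smoothing_semigroup_poissonL R n) be0 beal.
exists C; split=> [|g /Lip_time_independent/HC]; first exact: HC.
rewrite frac_power_time_independent !Lip_norm_time_independent => -[h1 h2 h3].
split=> //; first exact: frac_power_defined_time_independent.
exact/Lip_time_independent.
Qed.
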